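(* Let $k$ be an integer with $k\equiv 2\pmod 4$ and $6\le k\le 100$. Then the only integer solutions $(x,y,n)$ of the Diophantine equation $$x^k+(x+1)^k=y^n,\qquad n\ge 3,$$ are those with $x\in\{-1,0\}$.
   Context: The unknowns $x,y,n$ are rational integers. *)

(* Defs.v *)
From mathcomp Require Import all_boot all_order all_algebra.

Set Implicit Arguments.
Unset Strict Implicit.
Unset Printing Implicit Defensive.

(* Main.v *)
(* Put S = x^2 + (x+1)^2 and F_m = x^(2m) + (x+1)^(2m) for odd m; F_m is S times a polynomial W_m
   in w = x(x+1). Passing to a divisor of m, F_m and the exponent n, one may assume that n is 4 or an
   odd prime p and that m is 25 or a prime. Since no prime = 3 mod 4 divides F_m, either S and W_m are
   both n-th powers, or q | S for a prime q = 1 mod 4 with m = q^e, and then S q^e = z^n and W_q = q c^n.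

   In the first case S = z^p is excluded by Stormer's theorem, and S = z^4 by a Pell equation combined
   with Runge's method for W_m = t^4.

   In the second case n = 4 is excluded by congruences. For n = p write x^m + i(x+1)^m = unit * gamma^p
   in Z[i]. If p does not divide w, then the parts of gamma are, up to sign, m-th powers, and comparing
   modulo q^(e+1) gives 2^((p-1)(q-1)) = 1, hence p = 1 mod q^e. If p divides w, then q^(p-1) = 1 mod
   p^2. The few small p left are excluded modulo a prime l = hp + 1. For large p,
   Aurifeuille's identity gives W_q / q = V^2 + q U^2 with V + U sqrt(-q) = +-Gamma^p in Z[sqrt(-q)].
   The argument of gamma^p is close to an odd multiple of pi/4 and that of Gamma^p to an odd multiple
   of pi/2. A short vector (a, b) of a lattice of determinant p makes the argument of
   gamma^a Gamma^b extremely close to a multiple of pi/4, so that some r0 + r1 sqrt q with integers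
   r0, r1 depending on gamma^a and Gamma^b has norm of absolute value less than 1; then r0 = r1 = 0,
   which is impossible. *)

Require Import Defs.
From Stdlib Require Import ZArith Znumtheory Zpow_facts Reals Psatz.
From mathcomp Require Import all_boot all_order all_algebra.
From mathcomp Require Import zify ssrZ.

(** Taken singly, the two estimates of the second case contradict nothing: they place arg gamma and
    arg Gamma within O(1/(pX)) of a multiple of pi/(4p), where X = 2x + 1. A vector (a, b) with
    entries of size sqrt p turns them into one approximation by a multiple of pi/4 itself, with
    error O(1/X), while |gamma^a Gamma^b|^2 = y^|a| c^|b| is at most X^(T/p) with T = 2m|a| +
    2(q-1)|b|. This is below X^(19/20) as soon as p exceeds a constant times m^2 + (q-1)^2, which is
    the origin of [exponent_bound] and of the length of the tables. Below that bound the two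
    congruence conditions on p leave so few primes that each can be treated by its own auxiliary
    prime l.

    The ring Z[sqrt(-q)] is not factorial, so p-th roots are extracted there through reduced binary
    quadratic forms. Genus theory leaves only classes of order 1, 2, 3 or 4, and p is prime to 6;
    the exponent p = 3 is therefore confined to the treatment of small exponents. *)

Local Notation "x ^^ n" := (Z.pow x (Z.of_nat n)) (at level 30, right associativity).

(** * Powers of integers and coprime factors of a perfect power *)

Section Divisibility.
Local Open Scope Z_scope.

Lemma powS x n : x ^^ n.+1 = x * x ^^ n.
Proof. rewrite Nat2Z.inj_succ Z.pow_succ_r //; lia. Qed.

Lemma pow_pos x n : 0 < x -> 0 < x ^^ n.
Proof. move=> ?; apply: Z.pow_pos_nonneg; lia. Qed.

Lemma powD x n m : x ^^ (n + m) = x ^^ n * x ^^ m.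
Proof. by rewrite -Z.pow_add_r; [f_equal; lia | lia | lia]. Qed.

Lemma powM x n m : x ^^ (n * m) = (x ^^ n) ^^ m.
Proof. by rewrite -Z.pow_mul_r; [f_equal; lia | lia | lia]. Qed.

Lemma pow_mull x y n : (x * y) ^^ n = x ^^ n * y ^^ n.
Proof. exact: Z.pow_mul_l. Qed.

Lemma pow1n n : 1 ^^ n = 1.
Proof. by rewrite Z.pow_1_l; lia. Qed.

Lemma pow_dvd_sub N a b n : (N | a - b) -> (N | a ^^ n - b ^^ n).
Proof.
move=> [k Hk]; elim: n => [|n [l Hl]]; first by exists 0.
rewrite !powS; exists (k * a ^^ n + b * l).
transitivity ((a - b) * a ^^ n + b * (a ^^ n - b ^^ n)); first ring.
rewrite Hk Hl; ring.
Qed.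

Lemma coprime_pow_r a b n : Z.gcd a b = 1 -> Z.gcd a (b ^^ n) = 1.
Proof.
move=> H; apply/Zgcd_1_rel_prime; apply: rel_prime_Zpower_r; first lia.
exact/Zgcd_1_rel_prime.
Qed.

Lemma coprime_pow a b n m : Z.gcd a b = 1 -> Z.gcd (a ^^ n) (b ^^ m) = 1.
Proof.
move=> H; apply: coprime_pow_r; rewrite Z.gcd_comm; apply: coprime_pow_r.
by rewrite Z.gcd_comm.
Qed.

Lemma coprime_dvd_l a b c : (c | a) -> Z.gcd a b = 1 -> Z.gcd c b = 1.
Proof.
move=> Hc H; apply/Zgcd_1_rel_prime; apply: rel_prime_div Hc.
exact/Zgcd_1_rel_prime.
Qed.

Lemma coprime_mul a b c : Z.gcd a b = 1 -> Z.gcd a c = 1 -> Z.gcd a (b * c) = 1.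
Proof.
move=> /Zgcd_1_rel_prime H1 /Zgcd_1_rel_prime H2; apply/Zgcd_1_rel_prime.
exact: rel_prime_mult.
Qed.

(** The root is g = gcd(a, y). With a = g a' and y = g y' the equation becomes a' b = g^(n-1) y'^n,
    where a' is coprime to y' and g to b; hence a' = g^(n-1). *)
Lemma coprime_pow_factor a b y n : 0 < a -> 0 < y -> (0 < n)%N ->
  Z.gcd a b = 1 -> a * b = y ^^ n -> exists2 c, 0 < c & a = c ^^ n.
Proof.
move=> Ha Hy Hn Hab Heq.
have Hg : 0 < Z.gcd a y by have := Z.gcd_nonneg a y; have := Z.gcd_eq_0_l a y; lia.
exists (Z.gcd a y) => //.
case: (Z.gcd_divide_l a y) => a' Ha'; case: (Z.gcd_divide_r a y) => y' Hy'.
set g := Z.gcd a y in Hg Ha' Hy' *.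
have Hc : Z.gcd a' y' = 1.
  have : Z.gcd (a' * g) (y' * g) = Z.gcd a' y' * g by apply: Z.gcd_mul_mono_r_nonneg; lia.
  rewrite -Ha' -Hy' -/g => E; nia.
case: n Hn Heq => // n _ Heq.
have E1 : a' * b = g ^^ n * y' ^^ n.+1.
  apply: (Z.mul_reg_l _ _ g); first lia.
  transitivity (a * b); first by rewrite {1}Ha'; ring.
  rewrite Heq {1}Hy' pow_mull (powS g); ring.
have D1 : (a' | g ^^ n).
  apply: (Z.gauss _ (y' ^^ n.+1)); last exact: coprime_pow_r.
  by exists b; rewrite Z.mul_comm -E1; ring.
have D2 : (g ^^ n | a').
  apply: (Z.gauss _ b); first by exists (y' ^^ n.+1); rewrite Z.mul_comm E1; ring.
  rewrite Z.gcd_comm; apply: coprime_pow_r; rewrite Z.gcd_comm.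
  by apply: coprime_dvd_l Hab; exists a'.
have P := pow_pos g n Hg.
have Ha'0 : 0 < a' by nia.
have E2 : a' = g ^^ n by apply: Z.divide_antisym_nonneg => //; lia.
rewrite powS Ha' E2; ring.
Qed.

End Divisibility.

(** * Arithmetic of Z[sqrt(-D)] and reduction of plane lattices *)

Section QuadraticRing.
Local Open Scope Z_scope.

(** The pair (a, b) stands for a + b sqrt(-D); D = 1 gives the Gaussian integers. *)
Definition qmul (D : Z) (a b : Z * Z) : Z * Z :=
  (a.1 * b.1 - D * (a.2 * b.2), a.1 * b.2 + a.2 * b.1).
Definition qnorm (D : Z) (a : Z * Z) : Z := a.1 * a.1 + D * (a.2 * a.2).
Definition qconj (a : Z * Z) : Z * Z := (a.1, - a.2).
Fixpoint qpow (D : Z) (a : Z * Z) (n : nat) : Z * Z :=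
  if n is n'.+1 then qmul D a (qpow D a n') else (1, 0).

Lemma qmulC D a b : qmul D a b = qmul D b a.
Proof. by rewrite /qmul; congr (_, _); ring. Qed.

Lemma qmulA D a b c : qmul D a (qmul D b c) = qmul D (qmul D a b) c.
Proof. by rewrite /qmul; cbn [fst snd]; congr (_, _); ring. Qed.

Lemma qmul1 D a : qmul D (1, 0) a = a.
Proof. case: a => a b; rewrite /qmul; cbn [fst snd]; congr (_, _); ring. Qed.

Lemma qmulr1 D a : qmul D a (1, 0) = a.
Proof. by rewrite qmulC qmul1. Qed.

Lemma qpowS D a n : qpow D a n.+1 = qmul D a (qpow D a n).
Proof. by []. Qed.

Lemma qpow1 D a : qpow D a 1 = a.
Proof. by rewrite qpowS /= qmulr1. Qed.

Lemma qpowD D a m n : qpow D a (m + n) = qmul D (qpow D a m) (qpow D a n).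
Proof. by elim: m => [|m IH]; rewrite ?qmul1 // addSn !qpowS IH qmulA. Qed.

Lemma qpow_mul D a b n : qpow D (qmul D a b) n = qmul D (qpow D a n) (qpow D b n).
Proof.
elim: n => [|n IH]; first by rewrite /= qmul1.
by rewrite !qpowS IH -!qmulA (qmulA D b) (qmulC D b) -!qmulA.
Qed.

Lemma qpowM D a m n : qpow D a (m * n) = qpow D (qpow D a m) n.
Proof. by elim: n => [|n IH]; rewrite ?muln0 // mulnS qpowD IH. Qed.

Lemma qnorm_mul D a b : qnorm D (qmul D a b) = qnorm D a * qnorm D b.
Proof. rewrite /qnorm /qmul; cbn [fst snd]; ring. Qed.

Lemma qnorm_pow D a n : qnorm D (qpow D a n) = qnorm D a ^^ n.
Proof. elim: n => [|n IH]; last by rewrite qpowS qnorm_mul IH powS.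
by rewrite /qnorm /= Z.mul_0_r. Qed.

Lemma qconj_mul D a b : qconj (qmul D a b) = qmul D (qconj a) (qconj b).
Proof. by rewrite /qconj /qmul; cbn [fst snd]; congr (_, _); ring. Qed.

Lemma qconj_pow D a n : qconj (qpow D a n) = qpow D (qconj a) n.
Proof. by elim: n => [//|n IH]; rewrite !qpowS qconj_mul IH. Qed.

Lemma qnorm_conj D a : qnorm D (qconj a) = qnorm D a.
Proof. rewrite /qnorm /qconj; cbn [fst snd]; ring. Qed.

Lemma qmul_conj D a : qmul D a (qconj a) = (qnorm D a, 0).
Proof. rewrite /qmul /qconj /qnorm; cbn [fst snd]; congr (_, _); ring. Qed.

Lemma qpow_real D a n : qpow D (a, 0) n = (a ^^ n, 0).
Proof. by elim: n => [//|n IH]; rewrite qpowS IH powS /qmul; cbn [fst snd]; congr (_, _); ring. Qed.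

(** Gauss reduction for the norm form, by induction on a bound for the norm of the first vector.
    Closure of [L] under x - k y also yields negatives, so the determinant can be kept exactly and
    not only up to sign. It serves both for ideals and for the lattice of exponents (a, b). *)
Lemma lattice_reduction (D N : Z) (L : Z * Z -> Prop) (a b : Z * Z) :
  0 < D -> 0 < N ->
  (forall x y k, L x -> L y -> L (x.1 - k * y.1, x.2 - k * y.2)) ->
  L a -> L b -> a.1 * b.2 - a.2 * b.1 = N ->
  exists a' b', [/\ L a', L b', a'.1 * b'.2 - a'.2 * b'.1 = N,
    2 * Z.abs (a'.1 * b'.1 + D * (a'.2 * b'.2)) <= qnorm D a' &
    qnorm D a' <= qnorm D b'].
Proof.
move=> HD HN Lsub La Lb det.
have [n Hn] : exists n : nat, qnorm D a <= Z.of_nat n.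
  by exists (Z.to_nat (qnorm D a)); rewrite /qnorm; nia.
elim: n a b La Lb det Hn => [|n IH] a b La Lb det Hn.
  have : a.1 = 0 /\ a.2 = 0 by rewrite /qnorm in Hn; split; nia.
  by case=> E1 E2; move: det; rewrite E1 E2; lia.
have A0 : 0 < qnorm D a.
  have : ~ (a.1 = 0 /\ a.2 = 0) by case=> E1 E2; move: det; rewrite E1 E2; lia.
  rewrite /qnorm; nia.
set A := qnorm D a in A0 *.
set B := a.1 * b.1 + D * (a.2 * b.2).
(* The integer nearest to B / A. *)
pose k := (2 * B + A) / (2 * A).
pose b' := (b.1 - k * a.1, b.2 - k * a.2).
have Lb' : L b' by exact: Lsub.
have det' : a.1 * b'.2 - a.2 * b'.1 = N by rewrite /b' /= -det; ring.
have B' : 2 * Z.abs (a.1 * b'.1 + D * (a.2 * b'.2)) <= A.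
  have -> : a.1 * b'.1 + D * (a.2 * b'.2) = B - k * A.
    by rewrite /b' /B /A /qnorm; cbn [fst snd]; ring.
  have := Z.div_mod (2 * B + A) (2 * A); have := Z.mod_pos_bound (2 * B + A) (2 * A).
  rewrite -/k; lia.
case: (Z_le_gt_dec A (qnorm D b')) => Hab; first by exists a, b'.
have La' : L (- a.1, - a.2).
  have -> : (- a.1, - a.2) = (a.1 - 2 * a.1, a.2 - 2 * a.2) by congr (_, _); ring.
  exact: Lsub.
apply: (IH b' (- a.1, - a.2)) => //; last by lia.
by rewrite -det'; cbn [fst snd]; ring.
Qed.

End QuadraticRing.

(** * Ideals of Z[sqrt(-D)] and their reduced forms *)

Section Roots.
Local Open Scope Z_scope.

(* The ideal (N, k - sqrt(-D)), as a lattice. *)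
Definition in_ideal (N k : Z) (a : Z * Z) : Prop := (N | a.1 - k * a.2).

Lemma in_ideal_mul D M N k a b : (M * N | k * k + D) ->
  in_ideal M k a -> in_ideal N k b -> in_ideal (M * N) k (qmul D a b).
Proof.
rewrite /in_ideal /qmul => -[t Ht] [u Hu] [v Hv]; exists (u * v - t * (a.2 * b.2)).
transitivity ((a.1 - k * a.2) * (b.1 - k * b.2) - (k * k + D) * (a.2 * b.2)).
  by cbn [fst snd]; ring.
by rewrite Hu Hv Ht; ring.
Qed.

Lemma in_ideal_pow D N k a j : (N ^^ j | k * k + D) ->
  in_ideal N k a -> in_ideal (N ^^ j) k (qpow D a j).
Proof.
move=> H Ha; elim: j H => [|j IH] H; first by rewrite /in_ideal; apply: Z.divide_1_l.
rewrite powS in H *; apply: in_ideal_mul => //; apply: IH.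
by apply: Z.divide_trans H; exists N.
Qed.

(** An element [A] of the ideal whose norm is exactly N generates it: a times the conjugate of [A]
    is divisible by N, and the quotient is [B]. *)
Lemma in_ideal_quotient D N k t A a : 0 < N -> (N | k * k + D) ->
  in_ideal N k A -> qnorm D A = N -> in_ideal N k a -> qnorm D a = N * t ->
  exists2 B, qnorm D B = t & a = qmul D B A.
Proof.
rewrite /in_ideal => HN [z Hz] [v Hv] nA [u Hu] na.
pose B := (u * A.1 + k * a.2 * v + a.2 * A.2 * z, a.2 * v - A.2 * u).
have EB : qmul D a (qconj A) = (N * B.1, N * B.2).
  rewrite /qmul /qconj /B; cbn [fst snd]; congr (_, _).
    transitivity ((a.1 - k * a.2) * A.1 + k * a.2 * (A.1 - k * A.2)
      + a.2 * A.2 * (k * k + D)); first ring.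
    by rewrite Hu Hv Hz; ring.
  transitivity (a.2 * (A.1 - k * A.2) - A.2 * (a.1 - k * a.2)); first ring.
  by rewrite Hu Hv; ring.
have nB : N * N * qnorm D B = N * N * t.
  transitivity (qnorm D (N * B.1, N * B.2)); first by rewrite /qnorm; cbn [fst snd]; ring.
  by rewrite -EB qnorm_mul qnorm_conj nA na; ring.
exists B; first by apply: Z.mul_reg_l nB; lia.
have E : qmul D (qmul D a (qconj A)) A = (N * a.1, N * a.2).
  rewrite -qmulA (qmulC D (qconj A)) qmul_conj nA /qmul; cbn [fst snd]; congr (_, _); ring.
move: E; rewrite EB /qmul; cbn [fst snd] => -[E1 E2].
rewrite (surjective_pairing a) /qmul; congr (_, _); apply: (Z.mul_reg_l _ _ N); try lia.
  by rewrite -E1 /B; cbn [fst snd]; ring.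
by rewrite -E2 /B; cbn [fst snd]; ring.
Qed.

Lemma root_of_minus_D D N A : 0 < N -> Z.gcd A.2 N = 1 -> qnorm D A = N ->
  exists2 k, (N | k * k + D) & in_ideal N k A.
Proof.
move=> HN /Zgcd_1_rel_prime/rel_prime_bezout [u v Huv] nA.
move: nA; rewrite /in_ideal /qnorm; case: A Huv => V U; cbn [fst snd] => Huv nA.
have E : v * N = 1 - u * U by lia.
(* The root is V / U modulo N, [u] being an inverse of U. *)
exists (V * u).
  exists (u * u + D * (v * (1 + u * U))).
  transitivity (u * u * N + D * (v * N) * (1 + u * U)); last ring.
  by rewrite E -nA; ring.
exists (V * v); transitivity (V * (v * N)); cbn [fst snd]; last ring.
by rewrite E; ring.
Qed.

(** In a reduced basis the norm form of the ideal, divided by c, is aX^2 + 2bXY + eY^2. The basis is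
    itself expressed by a, b, e and its second coordinates [h1], [h2], and c is a value of the same
    form; norms of combinations of products of basis elements thus become polynomial identities. *)
Lemma reduced_form D c k : 0 < D -> 0 < c -> (c | k * k + D) ->
  exists a b e h1 h2, [/\ 2 * Z.abs b <= a <= e, a * e = b * b + D,
    c = a * (h2 * h2) - 2 * b * (h1 * h2) + e * (h1 * h1),
    in_ideal c k (a * h2 - b * h1, h1) & in_ideal c k (b * h2 - e * h1, h2)].
Proof.
move=> HD Hc [z Hz].
have Lsub x y l : in_ideal c k x -> in_ideal c k y ->
    in_ideal c k (x.1 - l * y.1, x.2 - l * y.2).
  rewrite /in_ideal => -[u Hu] [v Hv]; exists (u - l * v); cbn [fst snd].
  by rewrite Z.mul_sub_distr_r -Z.mul_assoc -Hu -Hv; ring.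
have Lc : in_ideal c k (c, 0) by exists 1; cbn [fst snd]; ring.
have Lk : in_ideal c k (k, 1) by exists 0; cbn [fst snd]; ring.
have det : (c, 0).1 * (k, 1).2 - (c, 0).2 * (k, 1).1 = c by cbn [fst snd]; ring.
case: (lattice_reduction _ _ _ _ _ HD Hc Lsub Lc Lk det) => -[g1 h1] [[g2 h2]].
rewrite /in_ideal /qnorm; cbn [fst snd] => -[[u Hu] [v Hv] {}det HB HA].
have G1 : g1 = k * h1 + u * c by lia.
have G2 : g2 = k * h2 + v * c by lia.
pose a := z * (h1 * h1) + 2 * k * h1 * u + u * u * c.
pose b := z * (h1 * h2) + k * h1 * v + k * h2 * u + u * v * c.
pose e := z * (h2 * h2) + 2 * k * h2 * v + v * v * c.
have EA : g1 * g1 + D * (h1 * h1) = c * a.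
  transitivity ((k * k + D) * (h1 * h1) + 2 * k * h1 * u * c + u * u * c * c).
    by rewrite G1; ring.
  by rewrite Hz /a; ring.
have EB : g1 * g2 + D * (h1 * h2) = c * b.
  transitivity ((k * k + D) * (h1 * h2) + k * h1 * v * c + k * h2 * u * c + u * v * c * c).
    by rewrite G1 G2; ring.
  by rewrite Hz /b; ring.
have EE : g2 * g2 + D * (h2 * h2) = c * e.
  transitivity ((k * k + D) * (h2 * h2) + 2 * k * h2 * v * c + v * v * c * c).
    by rewrite G2; ring.
  by rewrite Hz /e; ring.
have R1 : g1 = a * h2 - b * h1.
  apply: (Z.mul_reg_l _ _ c); first lia.
  transitivity ((c * a) * h2 - (c * b) * h1); last ring.
  by rewrite -EA -EB -[in LHS]det; ring.
have R2 : g2 = b * h2 - e * h1.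
  apply: (Z.mul_reg_l _ _ c); first lia.
  transitivity ((c * b) * h2 - (c * e) * h1); last ring.
  by rewrite -EE -EB -[in LHS]det; ring.
exists a, b, e, h1, h2; split.
- move: HB HA; rewrite EA EB EE => HB HA; split.
    apply/(Z.mul_le_mono_pos_l _ _ c) => //; move: HB.
    by rewrite Z.abs_mul (Z.abs_eq c); lia.
  by apply/(Z.mul_le_mono_pos_l _ _ c).
- apply: (Z.mul_reg_l _ _ (c * c)); first by move=> /Z.mul_eq_0; lia.
  transitivity ((c * a) * (c * e)); first ring.
  transitivity ((c * b) * (c * b) + D * (c * c)); last ring.
  by rewrite -EA -EB -EE -det; ring.
- by rewrite -{1}det R1 R2; ring.
- by exists u; cbn [fst snd]; rewrite -R1; lia.
- by exists v; cbn [fst snd]; rewrite -R2; lia.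
Qed.

End Roots.

(** * Congruences of integers and Fermat's little theorem *)

Section Congruences.
Local Open Scope Z_scope.

Definition cong (N x y : Z) : Prop := (N | x - y).

Lemma cong_refl N x : cong N x x.
Proof. by exists 0; ring. Qed.

Lemma cong_sym N x y : cong N x y -> cong N y x.
Proof. by move=> [k H]; exists (- k); lia. Qed.

Lemma cong_trans N x y z : cong N x y -> cong N y z -> cong N x z.
Proof. by move=> [k H] [l H']; exists (k + l); lia. Qed.

Lemma cong_add N x y x' y' : cong N x y -> cong N x' y' -> cong N (x + x') (y + y').
Proof. by move=> [k H] [l H']; exists (k + l); lia. Qed.

Lemma cong_opp N x y : cong N x y -> cong N (- x) (- y).
Proof. by move=> [k H]; exists (- k); lia. Qed.

Lemma cong_mul N x y x' y' : cong N x y -> cong N x' y' -> cong N (x * x') (y * y').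
Proof.
move=> [k H] [l H']; exists (k * x' + y * l).
by transitivity ((x - y) * x' + y * (x' - y')); [ring | rewrite H H'; ring].
Qed.

Lemma cong_pow N x y n : cong N x y -> cong N (x ^^ n) (y ^^ n).
Proof. exact: pow_dvd_sub. Qed.

Lemma cong_dvd M N x y : (M | N) -> cong N x y -> cong M x y.
Proof. exact: Z.divide_trans. Qed.

Lemma cong0P N x : cong N x 0 <-> (N | x).
Proof. by rewrite /cong Z.sub_0_r. Qed.

Lemma cong_modP N x y : 0 < N -> cong N x y <-> x mod N = y mod N.
Proof.
move=> HN; split=> [[k H]|H].
  have -> : x = y + k * N by lia.
  by rewrite Z.mod_add //; lia.
exists (x / N - y / N); have := Z.div_mod x N; have := Z.div_mod y N; lia.
Qed.

Lemma cong_mod N x : 0 < N -> cong N (x mod N) x.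
Proof. by move=> HN; apply/cong_modP => //; rewrite Z.mod_mod; lia. Qed.

Lemma cong_cancel N a x y : Z.gcd N a = 1 -> cong N (a * x) (a * y) -> cong N x y.
Proof. by rewrite /cong => H; rewrite -Z.mul_sub_distr_l => /Z.gauss; apply. Qed.

Lemma prime_Z p : prime p -> Znumtheory.prime (Z.of_nat p).
Proof.
move=> /primeP [p1 pP]; apply/Znumtheory.prime_alt; split; first by lia.
move=> n [n1 np] [k Hk].
have H : (Z.to_nat n %| p)%N by apply/dvdnP; exists (Z.to_nat k); nia.
by have := pP _ H; lia.
Qed.

Lemma prime_dvd_mul p a b : prime p -> (Z.of_nat p | a * b) ->
  (Z.of_nat p | a) \/ (Z.of_nat p | b).
Proof. move=> /prime_Z pp; exact: (Znumtheory.prime_mult _ pp). Qed.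

Lemma prime_dvd_pow p a n : prime p -> (Z.of_nat p | a ^^ n) -> (Z.of_nat p | a).
Proof.
move=> pp; elim: n => [|n IH]; last by rewrite powS => /(prime_dvd_mul _ _ _ pp) [].
by move=> /Z.divide_1_r_nonneg; have := prime_gt1 pp; lia.
Qed.

Lemma prime_coprime_Z p a : prime p -> ~ (Z.of_nat p | a) -> Z.gcd (Z.of_nat p) a = 1.
Proof.
move=> /prime_Z pp H; apply/Zgcd_1_rel_prime.
exact: (Znumtheory.prime_rel_prime _ pp).
Qed.

Lemma modn_Z a b : (0 < b)%N -> Z.of_nat (a %% b)%N = Z.of_nat a mod Z.of_nat b.
Proof.
move=> Hb; apply: (Z.mod_unique _ _ (Z.of_nat (a %/ b)%N)); first by have := ltn_pmod a Hb; lia.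
by rewrite {1}(divn_eq a b); nia.
Qed.

Lemma fermat_Z p a : prime p -> ~ (Z.of_nat p | a) -> cong (Z.of_nat p) (a ^^ p.-1) 1.
Proof.
move=> pp Ha; have p1 := prime_gt1 pp.
have P0 : 0 < Z.of_nat p by lia.
apply: (cong_cancel _ a); first exact: prime_coprime_Z.
rewrite -powS Z.mul_1_r (ltn_predK p1).
apply: cong_trans (cong_trans _ _ _ _ _ _); last exact: cong_mod.
  by apply: cong_pow; apply: cong_sym; apply: cong_mod.
have [r ->] : exists r : nat, a mod Z.of_nat p = Z.of_nat r.
  by exists (Z.to_nat (a mod Z.of_nat p)); have := Z.mod_pos_bound a (Z.of_nat p); lia.
apply/cong_modP => //; have := fermat_little r pp.
have -> : Z.of_nat r ^^ p = Z.of_nat (r ^ p)%N by lia.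
by rewrite -!modn_Z; [move=> -> | lia | lia].
Qed.

End Congruences.

(** * Extraction of p-th roots in Z[i] and in Z[sqrt(-q)] *)

Section QuadraticRoots.
Local Open Scope Z_scope.

Definition qadd (a b : Z * Z) : Z * Z := (a.1 + b.1, a.2 + b.2).
Definition qscale (s : Z) (a : Z * Z) : Z * Z := (s * a.1, s * a.2).

Lemma in_ideal_add N k a b : in_ideal N k a -> in_ideal N k b -> in_ideal N k (qadd a b).
Proof. by move=> [u Hu] [v Hv]; exists (u + v); rewrite /qadd; cbn [fst snd]; lia. Qed.

Lemma in_ideal_scale N k s a : in_ideal N k a -> in_ideal N k (qscale s a).
Proof.
move=> [u Hu]; exists (s * u); rewrite -Z.mul_assoc -Hu /qscale; cbn [fst snd]; ring.
Qed.

(** A single k, a square root of -D modulo c^p, is used for all powers of c: the powers of the ideal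
    given by c and k are then those given by c^j and k, and the p-th one is generated by [A]. *)
Lemma form_of_power D A c p : 0 < D -> 0 < c -> Z.gcd A.2 c = 1 ->
  qnorm D A = c ^^ p -> (0 < p)%N ->
  exists k a b e h1 h2, [/\ (c ^^ p | k * k + D) /\ in_ideal (c ^^ p) k A,
    2 * Z.abs b <= a <= e, a * e = b * b + D,
    c = a * (h2 * h2) - 2 * b * (h1 * h2) + e * (h1 * h1) &
    in_ideal c k (a * h2 - b * h1, h1) /\ in_ideal c k (b * h2 - e * h1, h2)].
Proof.
move=> HD Hc gA nA p0.
have gA' : Z.gcd A.2 (c ^^ p) = 1 by apply: coprime_pow_r.
case: (root_of_minus_D _ _ _ (pow_pos _ p Hc) gA' nA) => k Hk LA.
have Hck : (c | k * k + D).
  by apply: Z.divide_trans Hk; case: p p0 {nA gA' LA} => // p _; rewrite powS; apply: Z.divide_factor_l.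
case: (reduced_form _ _ _ HD Hc Hck) => a [b [e [h1 [h2 [H1 H2 H3 H4 H5]]]]].
by exists k, a, b, e, h1, h2.
Qed.

(** For D = 1 the only reduced form is X^2 + Y^2, so the ideal is principal. *)
Lemma gauss_root A c p : 0 < c -> Z.gcd A.2 c = 1 -> qnorm 1 A = c ^^ p -> (0 < p)%N ->
  exists g B, [/\ qnorm 1 g = c, qnorm 1 B = 1 & qpow 1 g p = qmul 1 B A].
Proof.
move=> Hc gA nA p0.
case: (form_of_power 1 A c p _ Hc gA nA p0) => //.
move=> k [a [b [e [h1 [h2 [[Hk LA] Hb Hae Ec [L1 _]]]]]]].
have a1 : a = 1 by nia.
have b0 : b = 0 by lia.
have e1 : e = 1 by nia.
set g := (_, h1) in L1.
have ng : qnorm 1 g = c by rewrite Ec /qnorm /g a1 b0 e1; cbn [fst snd]; ring.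
have Lg := in_ideal_pow 1 _ _ _ _ Hk L1.
have [] := in_ideal_quotient 1 (c ^^ p) k 1 A (qpow 1 g p) (pow_pos _ _ Hc) Hk LA nA Lg.
  by rewrite qnorm_pow ng; ring.
by move=> B nB EB; exists g, B.
Qed.

(** In terms of an ideal I of norm c: if w generates I^i and I^r contains v of norm c^r t, then w^j
    v lies in I^p, which is generated by [A], and division by [A] leaves an element of norm t. A t
    that is not a norm therefore excludes the class of I. *)
Lemma small_norm_of_power D A c p k w i v r t j : 0 < c ->
  (c ^^ p | k * k + D) -> in_ideal (c ^^ p) k A -> qnorm D A = c ^^ p ->
  in_ideal (c ^^ i) k w -> qnorm D w = c ^^ i ->
  in_ideal (c ^^ r) k v -> qnorm D v = c ^^ r * t ->
  p = (i * j + r)%N -> exists B, qnorm D B = t.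
Proof.
move=> Hc Hk LA nA Lw nw Lv nv Ep.
have D1 : ((c ^^ i) ^^ j | k * k + D).
  by apply: Z.divide_trans Hk; rewrite Ep powD powM; apply: Z.divide_factor_l.
have Lwj := in_ideal_pow D _ _ _ _ D1 Lw.
have Lwv : in_ideal (c ^^ p) k (qmul D (qpow D w j) v).
  rewrite Ep powD powM; apply: in_ideal_mul => //.
  by move: Hk; rewrite {1}Ep powD powM.
have [] := in_ideal_quotient D (c ^^ p) k t A _ (pow_pos _ _ Hc) Hk LA nA Lwv.
  by rewrite qnorm_mul qnorm_pow nw nv Ep powD powM; ring.
by move=> B nB _; exists B.
Qed.

(* Genus theory: an odd power of c is a square modulo Q, hence so is c, hence
   only quadratic residues a occur in ac = g^2 + Q h^2. *)
Lemma nonresidue_form Q E a c p V U g h : prime Q -> Q = (2 * E + 1)%N -> odd p ->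
  c ^^ p = V * V + Z.of_nat Q * (U * U) -> Z.gcd (Z.of_nat Q) c = 1 ->
  g * g + Z.of_nat Q * (h * h) = a * c -> cong (Z.of_nat Q) (a ^^ E) (-1) -> False.
Proof.
move=> pQ EQ po Ec gc Eg Ha; set q := Z.of_nat Q in Ec gc Eg Ha.
have Q1 := prime_gt1 pQ.
have sq z : ~ (q | z) -> cong q ((z * z) ^^ E) 1.
  move=> Hz; have := fermat_Z Q z pQ Hz.
  by rewrite {2}EQ addn1 /= pow_mull -powD addnn -mul2n.
have nq1 : ~ (q | 1) by move=> /Z.divide_1_r_nonneg; lia.
have nqc n : ~ (q | c ^^ n).
  move=> /(prime_dvd_pow _ _ _ pQ) Hd; apply: nq1; rewrite -gc.
  by apply: Z.gcd_greatest => //; apply: Z.divide_refl.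
have nqV : ~ (q | V).
  move=> Hd; apply: (nqc p); rewrite Ec; apply: Z.divide_add_r.
    exact: Z.divide_mul_l.
  exact: Z.divide_factor_l.
have cp : cong q ((c ^^ p) ^^ E) 1.
  apply: cong_trans (sq _ nqV); apply: cong_pow.
  by exists (U * U); rewrite Ec; ring.
have nqa : ~ (q | a).
  move=> Hd; have E0 : E <> 0%N by lia.
  have : (q | a ^^ E).
    by case: E E0 {EQ Ha sq cp} => // E _; rewrite powS; apply: Z.divide_mul_l.
  move=> Hd'; apply: nq1.
  have -> : 1 = (a ^^ E - -1) - a ^^ E by ring.
  exact: Z.divide_sub_r.
have nqg : ~ (q | g).
  move=> Hd; have : (q | a * c).
    rewrite -Eg; apply: Z.divide_add_r; first exact: Z.divide_mul_l.
    exact: Z.divide_factor_l.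
  by move=> /(prime_dvd_mul _ _ _ pQ) [] //; have := nqc 1%N; rewrite powS Z.mul_1_r.
have ac : cong q ((a * c) ^^ E) 1.
  apply: cong_trans (sq _ nqg); apply: cong_pow; apply: cong_sym.
  by exists (- (h * h)); rewrite -Eg; ring.
have acp : cong q (((a * c) ^^ E) ^^ p) 1 by rewrite -(pow1n p); apply: cong_pow.
have : cong q (((a * c) ^^ E) ^^ p) ((-1) ^^ p * 1).
  have -> : ((a * c) ^^ E) ^^ p = (a ^^ E) ^^ p * (c ^^ p) ^^ E.
    by rewrite -!powM (mulnC p) pow_mull.
  by apply: cong_mul => //; apply: cong_pow.
have -> : (-1) ^^ p = -1.
  rewrite -(odd_double_half p) po -mul2n powD powM; rewrite (_ : (-1) ^^ 2 = 1) //.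
  by rewrite pow1n.
move=> /cong_sym H; have [k Hk] := cong_trans _ _ _ _ H acp.
have H2 : q * (- k) = 2 by lia.
have q3 : 3 <= q by lia.
case: (Z_le_gt_dec (- k) 0); nia.
Qed.


(** Reduction gives 3a^2 <= 4Q, hence a <= 7. Besides the principal form, what survives the residue
    condition is the rest of the principal genus: the forms with a = 2 have order 2 in the class
    group, those with a = 5 have order 3 for Q = 29 and order 4 for Q = 41. *)
Lemma reduced_forms (Q : nat) a b e : Q \in [:: 5; 13; 17; 29; 37; 41]%N ->
  2 * Z.abs b <= a <= e -> a * e = b * b + Z.of_nat Q ->
  a = 1 \/ cong (Z.of_nat Q) (a ^^ Q./2) (-1) \/
  a = 2 /\ (Q = 17%N /\ e = 9 \/ Q = 41%N /\ e = 21) /\ (b = 1 \/ b = -1) \/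
  a = 5 /\ (Q = 29%N /\ e = 6 /\ (b = 1 \/ b = -1) \/
            Q = 41%N /\ e = 9 /\ (b = 2 \/ b = -2)).
Proof.
move=> HQ Hb Hae.
have Q41 : 0 < Z.of_nat Q <= 41 by move: HQ; rewrite !inE => /or4P [| | |/or3P []] /eqP ->.
have a7 : 1 <= a <= 7 by nia.
have nr x : (x ^^ Q./2 + 1) mod Z.of_nat Q = 0 -> cong (Z.of_nat Q) (x ^^ Q./2) (-1).
  by move=> /Z.mod_divide H; apply: H; lia.
have Ha : a = 1 \/ a = 2 \/ a = 3 \/ a = 4 \/ a = 5 \/ a = 6 \/ a = 7 by lia.
have Hb' : b = 0 \/ b = 1 \/ b = -1 \/ b = 2 \/ b = -2 \/ b = 3 \/ b = -3 by lia.
move: HQ; rewrite !inE => /or4P [| | |/or3P []] /eqP EQ; subst Q; move: Hae nr;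
  rewrite [Z.of_nat _]/= => Hae nr;
  case: Ha => [|[|[|[|[|[|]]]]]] Ha; subst a;
  first [ by left | by right; left; apply: nr | idtac ];
  case: Hb' => [|[|[|[|[|[|]]]]]] Hb'; subst b; lia.
Qed.

(** Since p is prime to the orders 2, 3 and 4, an ideal whose p-th power is principal is principal.
    Concretely, each nonprincipal class would produce an element of norm 2 or 5, which does not
    exist for Q > 5. *)
Lemma quadratic_root (Q : nat) A c p : Q \in [:: 5; 13; 17; 29; 37; 41]%N ->
  (1 < p)%N -> odd p -> (p %% 3 != 0)%N -> 0 < c -> Z.gcd A.2 c = 1 ->
  Z.gcd (Z.of_nat Q) c = 1 -> qnorm (Z.of_nat Q) A = c ^^ p ->
  exists g B, [/\ qnorm (Z.of_nat Q) g = c, qnorm (Z.of_nat Q) B = 1 &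
    qpow (Z.of_nat Q) g p = qmul (Z.of_nat Q) B A].
Proof.
move=> HQ p2 po p3 Hc gA gQ nA.
have [pQ EQ] : prime Q /\ Q = (2 * Q./2 + 1)%N.
  by move: HQ; rewrite !inE => /or4P [| | |/or3P []] /eqP ->.
have Q0 : 0 < Z.of_nat Q by have := prime_gt1 pQ; lia.
have p0 := ltnW p2.
case: (form_of_power _ A c p Q0 Hc gA nA p0).
move=> k [a [b [e [h1 [h2 [[Hk LA] Hb Hae Ec [L1 L2]]]]]]].
set x := (_, h1) in L1; set y := (_, h2) in L2.
have nx : qnorm (Z.of_nat Q) x = c * a.
  rewrite Ec /qnorm /x; cbn [fst snd].
  have -> : Z.of_nat Q = a * e - b * b by lia.
  ring.
have gcdpow j : (j <= p)%N -> (c ^^ j | k * k + Z.of_nat Q).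
  by move=> Hj; apply: Z.divide_trans Hk; rewrite -(subnKC Hj) powD; apply: Z.divide_factor_l.
have small := small_norm_of_power (Z.of_nat Q) A c p k.
have L1' : in_ideal (c ^^ 1) k x by rewrite powS Z.mul_1_r.
have nx' : qnorm (Z.of_nat Q) x = c ^^ 1 * a by rewrite powS Z.mul_1_r.
have p5 : (4 < p)%N by case: (p) p2 po p3 => [|[|[|[|[|]]]]].
have Lxx : in_ideal (c ^^ 2) k (qmul (Z.of_nat Q) x x).
  by rewrite !powS Z.mul_1_r; apply: in_ideal_mul => //; have := gcdpow 2%N p2; rewrite !powS Z.mul_1_r.
have Lxy : in_ideal (c ^^ 2) k (qmul (Z.of_nat Q) x y).
  by rewrite !powS Z.mul_1_r; apply: in_ideal_mul => //; have := gcdpow 2%N p2; rewrite !powS Z.mul_1_r.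
have Lyy : in_ideal (c ^^ 2) k (qmul (Z.of_nat Q) y y).
  by rewrite !powS Z.mul_1_r; apply: in_ideal_mul => //; have := gcdpow 2%N p2; rewrite !powS Z.mul_1_r.
have L3 z t : in_ideal (c ^^ 2) k z -> in_ideal c k t ->
    in_ideal (c ^^ 3) k (qmul (Z.of_nat Q) t z).
  move=> Hz Ht; have := gcdpow 3%N (ltnW (ltnW p5)); rewrite powS => H3.
  exact: in_ideal_mul.
have L4 z t : in_ideal (c ^^ 3) k z -> in_ideal c k t ->
    in_ideal (c ^^ 4) k (qmul (Z.of_nat Q) t z).
  move=> Hz Ht; have := gcdpow 4%N (ltnW p5); rewrite powS => H4.
  exact: in_ideal_mul.
case: (reduced_forms _ _ _ _ HQ Hb Hae) => [|[|]].
- move=> a1; have Lx := in_ideal_pow (Z.of_nat Q) _ _ _ _ Hk L1.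
  have [] := in_ideal_quotient (Z.of_nat Q) (c ^^ p) k 1 A _ (pow_pos _ _ Hc) Hk LA nA Lx.
    by rewrite qnorm_pow nx a1 !Z.mul_1_r.
  by move=> B nB EB; exists x, B; split=> //; rewrite nx a1; ring.
- move=> Hnr; exfalso.
  apply: (nonresidue_form Q Q./2 a c p A.1 A.2 x.1 x.2) => //.
  by move: nx; rewrite /qnorm; lia.
- have comb u t z w : in_ideal u k z -> in_ideal u k w ->
      in_ideal u k (qadd (qscale t z) w).
    by move=> ? ?; apply: in_ideal_add => //; apply: in_ideal_scale.
  have no2 B : Z.of_nat Q > 5 -> qnorm (Z.of_nat Q) B = 2 \/ qnorm (Z.of_nat Q) B = 5 -> False.
    rewrite /qnorm => HQ5 HB.
    have B2 : B.2 = 0 by nia.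
    move: HB; rewrite B2 !Z.mul_0_r Z.add_0_r -(Z.abs_square B.1) => HB.
    have [H|[H|H]] : Z.abs B.1 <= 1 \/ Z.abs B.1 = 2 \/ 3 <= Z.abs B.1 by lia.
    - by have := Z.abs_nonneg B.1; nia.
    - by rewrite H in HB; lia.
    - by nia.
  pose R := Z.of_nat Q.
  pose x2 := qmul R x x; pose xy := qmul R x y; pose y2 := qmul R y y.
  case=> [[a2 [HQ' b1]]|[a5 [[EQ29 [e6 b1]]|[EQ41 [e9 b2]]]]].
  (* Here e = 2s + 1, and the combination of x^2, xy and y^2 generates the square of the ideal. *)
  + have [s nw] : exists s, qnorm (Z.of_nat Q)
        (qadd (qscale s x2) (qadd (qscale (- b) xy) y2)) = c ^^ 2.
      rewrite /x2 /xy /y2 /R /x /y !powS Z.mul_1_r Ec a2.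
      case: HQ' => -[EQ' ->]; [exists 4 | exists 10].
        have -> : Z.of_nat Q = 17 by lia.
        by case: b1 => ->; rewrite /qnorm /qadd /qscale /qmul; cbn [fst snd]; ring.
      have -> : Z.of_nat Q = 41 by lia.
      by case: b1 => ->; rewrite /qnorm /qadd /qscale /qmul; cbn [fst snd]; ring.
    set w := qadd _ _ in nw.
    have Lw : in_ideal (c ^^ 2) k w by apply: (comb) => //; apply: (comb).
    have [] := small w 2%N x 1%N 2 p./2 Hc Hk LA nA Lw nw L1'.
    - by rewrite nx' a2.
    - by rewrite -{1}(odd_double_half p) po addnC mul2n.
    by move=> B nB; exfalso; apply: (no2 B); [lia | left].
  + have Lxx2 : in_ideal (c ^^ 3) k (qmul R x x2) by apply: L3.
    have Lxxy : in_ideal (c ^^ 3) k (qmul R x xy) by apply: L3.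
    have Lyy2 : in_ideal (c ^^ 3) k (qmul R y y2) by apply: L3.
    (* [w] generates the cube of the ideal; [v], of norm 5c^2, serves for p = 2 mod 3. *)
    pose w := qadd (qscale (2 * b) (qmul R x xy)) (qadd (qscale (2 * b) (qmul R y y2)) (qmul R x x2)).
    pose v := qadd x2 y2.
    have Lw : in_ideal (c ^^ 3) k w by apply: (comb) => //; apply: (comb).
    have Lv : in_ideal (c ^^ 2) k v by apply: in_ideal_add.
    have nw : qnorm (Z.of_nat Q) w = c ^^ 3.
      rewrite /w /x2 /xy /y2 /R /x /y !powS Z.mul_1_r Ec e6 a5.
      have -> : Z.of_nat Q = 29 by lia.
      by case: b1 => ->; rewrite /qnorm /qadd /qscale /qmul; cbn [fst snd]; ring.
    have nv : qnorm (Z.of_nat Q) v = c ^^ 2 * 5.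
      rewrite /v /x2 /xy /y2 /R /x /y !powS Z.mul_1_r Ec e6 a5.
      have -> : Z.of_nat Q = 29 by lia.
      by case: b1 => ->; rewrite /qnorm /qadd /qscale /qmul; cbn [fst snd]; ring.
    have nx5 : qnorm (Z.of_nat Q) x = c ^^ 1 * 5 by rewrite nx' a5.
    have [B nB] : exists B, qnorm (Z.of_nat Q) B = 5.
      have [E3|E3] : (p %% 3 = 1 \/ p %% 3 = 2)%N by lia.
        apply: (small w 3%N x 1%N 5 (p %/ 3)) => //.
        by rewrite {1}(divn_eq p 3) E3 mulnC.
      apply: (small w 3%N v 2%N 5 (p %/ 3)) => //.
      by rewrite {1}(divn_eq p 3) E3 mulnC.
    by exfalso; apply: (no2 B); [lia | right].
  + have Lxx2 : in_ideal (c ^^ 3) k (qmul R x x2) by apply: L3.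
    have Lxxy : in_ideal (c ^^ 3) k (qmul R x xy) by apply: L3.
    have Lxyy : in_ideal (c ^^ 3) k (qmul R x y2) by apply: L3.
    have Lyyy : in_ideal (c ^^ 3) k (qmul R y y2) by apply: L3.
    have [t Et t1] : exists2 t, b = 2 * t & t = 1 \/ t = -1.
      by case: b2 => ->; [exists 1 | exists (-1)]; lia.
    (* [v], of norm 5c^3, serves for p = 3 mod 4; [w] below generates the fourth power of the
       ideal. *)
    pose v := qadd (qscale (3 * t) (qmul R x xy)) (qadd (qscale (- 1) (qmul R x y2))
      (qadd (qscale (2 * t) (qmul R y y2)) (qmul R x x2))).
    have L4a : in_ideal (c ^^ 4) k (qmul R x (qmul R x x2)) by apply: L4.
    have L4b : in_ideal (c ^^ 4) k (qmul R x (qmul R x xy)) by apply: L4.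
    have L4c : in_ideal (c ^^ 4) k (qmul R x (qmul R x y2)) by apply: L4.
    have L4d : in_ideal (c ^^ 4) k (qmul R x (qmul R y y2)) by apply: L4.
    have L4e : in_ideal (c ^^ 4) k (qmul R y (qmul R y y2)) by apply: L4.
    pose w := qadd (qscale 2 (qmul R x (qmul R x x2)))
      (qadd (qscale (- 2 * t) (qmul R x (qmul R x xy)))
      (qadd (qscale (- 2) (qmul R x (qmul R x y2)))
      (qadd (qscale (- 2) (qmul R y (qmul R y y2)))
        (qscale t (qmul R x (qmul R y y2)))))).
    have Lw : in_ideal (c ^^ 4) k w by do 4 (apply: (comb) => //); apply: in_ideal_scale.
    have Lv : in_ideal (c ^^ 3) k v by do 3 (apply: (comb) => //).
    have nw : qnorm (Z.of_nat Q) w = c ^^ 4.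
      rewrite /w /x2 /xy /y2 /R /x /y !powS Z.mul_1_r Ec e9 a5 Et.
      have -> : Z.of_nat Q = 41 by lia.
      by case: t1 => ->; rewrite /qnorm /qadd /qscale /qmul; cbn [fst snd]; ring.
    have nv : qnorm (Z.of_nat Q) v = c ^^ 3 * 5.
      rewrite /v /x2 /xy /y2 /R /x /y !powS Z.mul_1_r Ec e9 a5 Et.
      have -> : Z.of_nat Q = 41 by lia.
      by case: t1 => ->; rewrite /qnorm /qadd /qscale /qmul; cbn [fst snd]; ring.
    have nx5 : qnorm (Z.of_nat Q) x = c ^^ 1 * 5 by rewrite nx' a5.
    have [B nB] : exists B, qnorm (Z.of_nat Q) B = 5.
      have [E4|E4] : (p %% 4 = 1 \/ p %% 4 = 3)%N by lia.
        apply: (small w 4%N x 1%N 5 (p %/ 4)) => //.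
        by rewrite {1}(divn_eq p 4) E4 mulnC.
      apply: (small w 4%N v 3%N 5 (p %/ 4)) => //.
      by rewrite {1}(divn_eq p 4) E4 mulnC.
    by exfalso; apply: (no2 B); [lia | right].
Qed.

End QuadraticRoots.

(** * Stormer's theorem: x^2 + (x+1)^2 is not an odd power *)

Section Stormer.
Local Open Scope Z_scope.

Lemma coprime_bezout u v a b : u * a + v * b = 1 -> Z.gcd a b = 1.
Proof. by move=> H; apply/Zgcd_1_rel_prime/bezout_rel_prime/(Bezout_intro _ _ _ u v). Qed.

Lemma gauss_unit B : qnorm 1 B = 1 ->
  B = (1, 0) \/ B = (-1, 0) \/ B = (0, 1) \/ B = (0, -1).
Proof.
case: B => a b; rewrite /qnorm; cbn [fst snd] => H.
have Ha : -1 <= a <= 1 by nia.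
have Hb : -1 <= b <= 1 by nia.
have [Ea|[Ea|Ea]] : a = -1 \/ a = 0 \/ a = 1 by lia.
all: have [Eb|[Eb|Eb]] : b = -1 \/ b = 0 \/ b = 1 by lia.
all: subst a b; first [by lia | by tauto].
Qed.

Lemma qpow_scalar_mod N D a n : (N | a.2) ->
  (N | (qpow D a n).1 - a.1 ^^ n) /\ (N | (qpow D a n).2).
Proof.
move=> [s Hs]; elim: n => [|n [[u Hu] [v Hv]]]; first by split; exists 0.
rewrite qpowS /qmul; cbn [fst snd]; rewrite powS; split.
  exists (a.1 * u - D * s * (qpow D a n).2).
  transitivity (a.1 * ((qpow D a n).1 - a.1 ^^ n) - D * (a.2 * (qpow D a n).2)); first ring.
  by rewrite Hu Hs; ring.
exists (a.1 * v + s * (qpow D a n).1); rewrite Hv Hs; ring.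
Qed.

(** The imaginary part of (a + bi)^4 is 4ab(a^2 - b^2), so the fourth power is real modulo a + s b.
    Only the exponents 1 and 3 remain to be computed. *)
Lemma gauss_linear_factor a b s p : odd p -> s = 1 \/ s = -1 ->
  (a + s * b | (qpow 1 (a, b) p).1 + s * (-1) ^^ p./2 * (qpow 1 (a, b) p).2).
Proof.
move=> po Hs; have s2 : s * s = 1 by lia.
have H4 : (a + s * b | (qpow 1 (a, b) 4).2).
  exists (4 * a * b * (a - s * b)); cbn [qpow]; rewrite /qmul; cbn [fst snd].
  transitivity (4 * a * b * (a * a - (s * s) * (b * b))); last ring.
  by rewrite s2; cbn [fst snd]; ring.
have [[u Hu] [v Hv]] := qpow_scalar_mod _ 1 _ (p %/ 4) H4.
have [E|E] : (p %% 4 = 1 \/ p %% 4 = 3)%N by lia.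
all: have Ep := divn_eq p 4; rewrite E (mulnC _ 4%N) in Ep.
  have -> : (-1) ^^ p./2 = 1.
    have -> : p./2 = (2 * (p %/ 4))%N by lia.
    by rewrite powM (_ : (-1) ^^ 2 = 1) // pow1n.
  rewrite Ep qpowD qpowM qpow1 /qmul; set g4 := qpow 1 (a, b) 4 in Hu Hv *.
  set G := qpow 1 g4 _ in Hu Hv *; cbn [fst snd].
  exists (G.1 + s * v * a - v * b); rewrite Hv; ring.
have -> : (-1) ^^ p./2 = -1.
  have -> : p./2 = (2 * (p %/ 4) + 1)%N by lia.
  by rewrite powD powM (_ : (-1) ^^ 2 = 1) // pow1n.
rewrite Ep qpowD qpowM /qmul; set g4 := qpow 1 (a, b) 4 in Hu Hv *.
set G := qpow 1 g4 _ in Hu Hv *; set C := qpow 1 (a, b) 3; cbn [fst snd].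
have EC : C.1 - s * C.2 = (a + s * b) * (a * a - 4 * s * (a * b) + b * b).
  transitivity (a * a * a - 3 * s * (a * a * b) + a * b * b - 4 * (s * s) * (a * b * b) + s * (b * b * b)); last ring.
  by rewrite s2 /C; cbn [qpow]; rewrite /qmul; cbn [fst snd]; ring.
exists (G.1 * (a * a - 4 * s * (a * b) + b * b) - v * C.2 - s * v * C.1).
transitivity (G.1 * (C.1 - s * C.2) - G.2 * C.2 - s * G.2 * C.1); first ring.
by rewrite EC Hv; ring.
Qed.

(** M is 4 times the 2-part of n: doubling the exponent doubles M, and an odd multiple of the
    exponent keeps it. The congruence for r - t s modulo 2e is stable under both operations and
    decides a parity in the next lemma. *)
Lemma gauss_linear_real_part e t n : (2 | e) -> e <> 0 -> t = 1 \/ t = -1 -> (0 < n)%N ->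
  exists M r s, [/\ M <> 0, (4 | M), (2 * e | r - t * s - e) &
    qpow 1 (1 + t * e, e) (4 * n) = (1 + M * e * r, M * e * s)].
Proof.
move=> [f Hf] e0 Ht; have t2 : t * t = 1 by lia.
pose P m := exists M r s, [/\ M <> 0, (4 | M), (2 * e | r - t * s - e) &
    qpow 1 (1 + t * e, e) m = (1 + M * e * r, M * e * s)].
have P4 : P 4%N.
  exists 4, (t - 2 * t * (e * e) - e * e * e), (1 + 3 * t * e + 2 * (e * e)); split=> //.
    by apply: Z.divide_refl.
    exists (- 2 - 2 * t * e - f * e).
    transitivity (t - 2 * t * (e * e) - e * e * e - t - 3 * (t * t) * e - 2 * t * (e * e) - e); first ring.
    by rewrite t2 (_ : e * e * e = 2 * f * (e * e)); [ring | rewrite {1}Hf; ring].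
  cbn [qpow]; rewrite /qmul; cbn [fst snd]; congr (_, _).
    transitivity (1 + 4 * e * t + 6 * (t * t - 1) * (e * e) + 4 * (t * (t * t) - 3 * t) * (e * e * e)
       + ((t * t) * (t * t) - 6 * (t * t) + 1) * (e * e * e * e)); first ring.
    by rewrite t2; ring.
  transitivity (4 * e + 12 * t * (e * e) + 4 * (3 * (t * t) - 1) * (e * e * e)
       + 4 * ((t * t) * t - t) * (e * e * e * e)); first ring.
  by rewrite t2; ring.
have Pdouble m : P m -> P (2 * m)%N.
  move=> [M [r [s [M0 [k Hk] [l Hl] Hm]]]].
  exists (2 * M), (r + 2 * k * e * (r * r - s * s)), (s + 4 * k * e * (r * s)); split; first by lia.
  - by exists (2 * k); lia.
  - exists (l + k * (r * r - s * s) - 2 * k * t * (r * s)).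
    transitivity ((r - t * s - e) + 2 * e * (k * (r * r - s * s) - 2 * k * t * (r * s))); first ring.
    by rewrite Hl; ring.
  rewrite mulnC qpowM Hm; cbn [qpow]; rewrite /qmul; cbn [fst snd]; rewrite Hk; congr (_, _); ring.
have Podd m j : P m -> odd j -> P (m * j)%N.
  move=> [M [r [s [M0 [k Hk] [l Hl] Hm]]]] oj.
  have [x [y Hxy]] : exists x y, qpow 1 (1 + M * e * r, M * e * s) j =
      (1 + M * e * (Z.of_nat j * r + M * e * x), M * e * (Z.of_nat j * s + M * e * y)).
    elim: (j) => [|i [x [y Hxy]]]; first by exists 0, 0; cbn [qpow]; congr (_, _); ring.
    exists (x + Z.of_nat i * (r * r - s * s) + M * e * (r * x - s * y)).
    exists (y + 2 * Z.of_nat i * (r * s) + M * e * (r * y + s * x)).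
    rewrite qpowS Hxy /qmul; cbn [fst snd]; rewrite Nat2Z.inj_succ /Z.succ; congr (_, _); ring.
  exists M, (Z.of_nat j * r + M * e * x), (Z.of_nat j * s + M * e * y); split=> //.
  - by exists k.
  - have [i Hi] : exists i, Z.of_nat j = 2 * i + 1 by exists (Z.of_nat j./2); lia.
    exists ((2 * i + 1) * l + i + 2 * k * (x - t * y)).
    transitivity (Z.of_nat j * (r - t * s - e) + (Z.of_nat j - 1) * e + M * e * (x - t * y)); first ring.
    by rewrite Hl Hi Hk; ring.
  by rewrite qpowM Hm.
elim/ltn_ind: n => n IH n0.
have [on|en] := boolP (odd n); first exact: Podd.
have -> : (4 * n = 2 * (4 * n./2))%N by lia.
by apply: Pdouble; apply: IH; lia.
Qed.

(** For p = 1 mod 4 the value is 1 plus M e^2 times an odd number, with M nonzero and divisible by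
    4, so it is neither 1 nor -1. For p = 3 mod 4 it is 1 + 6te + 6e^2 + 4eK, and the parity of e
    suffices. *)
Lemma gauss_power_consecutive e t p s : (2 | e) -> e <> 0 -> t = 1 \/ t = -1 ->
  odd p -> (1 < p)%N -> s = - t * (-1) ^^ p./2 ->
  let P := qpow 1 (1 + t * e, e) p in
  P.1 + s * P.2 <> 1 /\ P.1 + s * P.2 <> -1.
Proof.
move=> He e0 Ht po p1 Hs P.
have [E|E] : (p %% 4 = 1 \/ p %% 4 = 3)%N by lia.
all: have Ep := divn_eq p 4; rewrite E (mulnC _ 4%N) in Ep.
  have {}Hs : s = - t.
    rewrite Hs (_ : p./2 = 2 * (p %/ 4))%N; last by lia.
    by rewrite powM (_ : (-1) ^^ 2 = 1) // pow1n; ring.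
  have n0 : (0 < p %/ 4)%N by lia.
  have [M [r [v [M0 [k Hk] [l Hl] HP]]]] := gauss_linear_real_part e t _ He e0 Ht n0.
  have -> : P.1 + s * P.2 = 1 + M * e * e * (1 + 2 * (l - v)).
    rewrite /P Ep qpowD HP qpow1 /qmul Hs; cbn [fst snd].
    transitivity (1 + M * e * (r - (t * t) * e * v - t * v - e * v)); first ring.
    rewrite (_ : t * t = 1); last by lia.
    transitivity (1 + M * e * ((r - t * v - e) + e - 2 * e * v)); first ring.
    by rewrite Hl; ring.
  have H0 : M * e * e * (1 + 2 * (l - v)) <> 0.
    by move=> /Z.mul_eq_0 [/Z.mul_eq_0 [/Z.mul_eq_0 [|]|]|]; lia.
  split; first by lia.
  move=> H; have H2 : 4 * (k * e * e * (1 + 2 * (l - v))) = -2 by rewrite Hk in H; lia.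
  lia.
have {}Hs : s = t.
  rewrite Hs (_ : p./2 = 2 * (p %/ 4) + 1)%N; last by lia.
  by rewrite powD powM (_ : (-1) ^^ 2 = 1) // pow1n (_ : (-1) ^^ 1 = -1) //; ring.
have t2 : t * t = 1 by lia.
have [f Hf] := He.
have H4 : (4 * e | (qpow 1 (1 + t * e, e) 4).2).
  exists (1 + 3 * t * e + 2 * (e * e)).
  cbn [qpow]; rewrite /qmul; cbn [fst snd].
  transitivity (4 * e + 12 * t * (e * e) + 4 * (3 * (t * t) - 1) * (e * e * e)
       + 4 * ((t * t) * t - t) * (e * e * e * e)); first ring.
  by rewrite t2; ring.
have R4 : cong (4 * e) (qpow 1 (1 + t * e, e) 4).1 1.
  exists (t - 2 * t * (e * e) - e * e * e).
  cbn [qpow]; rewrite /qmul; cbn [fst snd].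
  transitivity (4 * e * t + 6 * (t * t - 1) * (e * e) + 4 * (t * (t * t) - 3 * t) * (e * e * e)
       + ((t * t) * (t * t) - 6 * (t * t) + 1) * (e * e * e * e)); first ring.
  by rewrite t2; ring.
have [[u Hu] [v Hv]] := qpow_scalar_mod _ 1 _ (p %/ 4) H4.
have [w Hw] : cong (4 * e) ((qpow 1 (1 + t * e, e) 4).1 ^^ (p %/ 4)) 1.
  by have := cong_pow _ _ _ (p %/ 4) R4; rewrite pow1n.
set g4 := qpow 1 _ 4 in Hu Hv Hw; set G := qpow 1 g4 _ in Hu Hv.
have EG : G.1 = 1 + (u + w) * (4 * e) by lia.
set C := qpow 1 (1 + t * e, e) 3.
have EC : C.1 + t * C.2 = 1 + 6 * t * e + 6 * (e * e).
  rewrite /C; cbn [qpow]; rewrite /qmul; cbn [fst snd].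
  transitivity (1 + 6 * t * e + (6 * (t * t) + 3 * (t * t) - 3) * (e * e) +
     (t * (t * t) - 3 * t + 3 * t * (t * t) - t) * (e * e * e)); first ring.
  by rewrite t2; ring.
have EP : P.1 + s * P.2 = 1 + 6 * t * e + 6 * (e * e) + 4 * e *
    ((u + w) * (C.1 + t * C.2) + v * (t * C.1 - C.2)).
  rewrite -EC Hs /P Ep qpowD qpowM /qmul -/g4 -/G -/C; cbn [fst snd].
  by rewrite EG Hv; ring.
rewrite EP; set K := (u + w) * _ + _; split=> H.
  have : e * (6 * t + 6 * e + 4 * K) = 0 by lia.
  by move=> /Z.mul_eq_0 [|]; lia.
have H2 : 1 + 3 * t * e + 3 * (e * e) + 2 * e * K = 0 by lia.
by rewrite Hf in H2; lia.
Qed.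

Lemma pow_m1 n : (-1) ^^ n = 1 \/ (-1) ^^ n = -1.
Proof. by elim: n => [|n IH]; [left | rewrite powS; lia]. Qed.

Lemma pow_m1_odd n : odd n -> (-1) ^^ n = -1.
Proof.
move=> on; rewrite -(odd_double_half n) on -mul2n powD powM (_ : (-1) ^^ 2 = 1) //.
by rewrite pow1n.
Qed.

Lemma gauss_opp_pow a b p : odd p ->
  qpow 1 (- a, - b) p = (- (qpow 1 (a, b) p).1, - (qpow 1 (a, b) p).2).
Proof.
move=> po; have -> : (- a, - b) = qmul 1 (-1, 0) (a, b).
  by rewrite /qmul; cbn [fst snd]; congr (_, _); ring.
rewrite qpow_mul qpow_real pow_m1_odd // /qmul; cbn [fst snd]; congr (_, _); ring.
Qed.

Lemma gauss_i_pow a b p : odd p -> exists2 u, u = 1 \/ u = -1 &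
  qpow 1 (- b, a) p = (- u * (qpow 1 (a, b) p).2, u * (qpow 1 (a, b) p).1).
Proof.
move=> po; have -> : (- b, a) = qmul 1 (0, 1) (a, b).
  by rewrite /qmul; cbn [fst snd]; congr (_, _); ring.
exists ((-1) ^^ p./2); first exact: pow_m1.
rewrite qpow_mul; have -> : qpow 1 (0, 1) p = (0, (-1) ^^ p./2).
  rewrite -{1}(odd_double_half p) po -mul2n qpowD qpow1 qpowM.
  rewrite (_ : qpow 1 (0, 1) 2 = (-1, 0)) // qpow_real /qmul; cbn [fst snd].
  by congr (_, _); ring.
by rewrite /qmul; cbn [fst snd]; congr (_, _); ring.
Qed.

(** The linear factor a + s' b divides a unit, hence is 1 or -1; up to the sign of (a, b) this is
    the situation of [gauss_power_consecutive]. *)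
Lemma gauss_power_no_unit_form a b p s : (2 | b) -> b <> 0 -> odd p -> (1 < p)%N ->
  s = 1 \/ s = -1 ->
  let P := qpow 1 (a, b) p in P.1 + s * P.2 = 1 \/ P.1 + s * P.2 = -1 -> False.
Proof.
move=> Hb b0 po p1 Hs P HP.
pose s' := s * (-1) ^^ p./2.
have m1 := pow_m1 p./2.
have Es : s = s' * (-1) ^^ p./2 by rewrite /s'; case: m1 => ->; ring.
have Hs' : s' = 1 \/ s' = -1 by rewrite /s'; case: m1 => ->; lia.
have := gauss_linear_factor a b s' p po Hs'; rewrite -Es -/P => -[k Hk].
have Hab : a + s' * b = 1 \/ a + s' * b = -1.
  have : (a + s' * b | 1) by case: HP => E; rewrite E in Hk; [exists k | exists (- k)]; lia.
  by move=> /Z.divide_1_r; lia.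
have Ht : - s' = 1 \/ - s' = -1 by lia.
have Est : s = - - s' * (-1) ^^ p./2 by rewrite {1}Es; ring.
case: Hab => Hab.
  have := gauss_power_consecutive b (- s') p s Hb b0 Ht po p1 Est.
  by rewrite (_ : 1 + - s' * b = a); [case: HP; rewrite /P; lia | lia].
have Hb' : (2 | - b) by apply/Z.divide_opp_r.
have b0' : - b <> 0 by lia.
have := gauss_power_consecutive (- b) (- s') p s Hb' b0' Ht po p1 Est.
rewrite (_ : 1 + - s' * - b = - a); last by lia.
by rewrite gauss_opp_pow //; cbn [fst snd]; rewrite -/P; lia.
Qed.

(* Stormer's theorem on X^2 + 1 = 2 z^p, with X = 2x + 1: a root a + bi of a unit times
   x + (x+1)i satisfies a +- b = +-1, which is impossible 2-adically. *)
Lemma consecutive_squares_not_odd_power x z p : 1 <= x -> 0 < z -> odd p -> (1 < p)%N ->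
  x * x + (x + 1) * (x + 1) = z ^^ p -> False.
Proof.
move=> Hx Hz po p1 Hxz.
have gz : Z.gcd (x + 1) z = 1.
  rewrite Z.gcd_comm; apply: (coprime_dvd_l (z ^^ p)).
    by case: (p) p1 => // n _; rewrite powS; apply: Z.divide_factor_l.
  by apply: (coprime_bezout 1 (- 2 * x)); rewrite -Hxz; ring.
have nA : qnorm 1 (x, x + 1) = z ^^ p by rewrite /qnorm -Hxz; cbn [fst snd]; ring.
case: (gauss_root (x, x + 1) z p Hz gz nA (ltnW p1)) => -[a b] [B [ng nB EP]].
have [s Hs HP] : exists2 s, s = 1 \/ s = -1 &
    let P := qpow 1 (a, b) p in P.1 + s * P.2 = 1 \/ P.1 + s * P.2 = -1.
  rewrite EP /qmul; cbn [fst snd].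
  by case: (gauss_unit B nB) => [|[|[|]]] ->; cbn [fst snd];
    [exists (-1) | exists (-1) | exists 1 | exists 1]; lia.
move: ng; rewrite /qnorm; cbn [fst snd] => ng.
have z2 : 1 < z.
  case: (Z_le_gt_dec z 1) => Hz1; last by lia.
  have E1 : z = 1 by lia.
  by move: Hxz; rewrite E1 pow1n; nia.
have oz : ~ (2 | z).
  move=> H2; have [k Hk] : (2 | z ^^ p).
    by case: (p) p1 => // n _; rewrite powS; apply: Z.divide_mul_l.
  by lia.
(* If d = 0, the power is real, so it is 1 or -1, and its norm x^2 + (x+1)^2 would be 1. *)
have nz c d t : c * c + d * d = z ->
    (let P := qpow 1 (c, d) p in P.1 + t * P.2 = 1 \/ P.1 + t * P.2 = -1) -> d <> 0.
  move=> ncd Hcd d0; have := qnorm_pow 1 (c, d) p; move: Hcd ncd; rewrite d0 qpow_real.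
  rewrite /qnorm; cbn [fst snd]; set C := c ^^ p => Hcd ncd.
  by rewrite (_ : c * c + 1 * (0 * 0) = z) -?Hxz; last (by lia); case: Hcd; nia.
have [[k Hk]|[k Hk]] : (exists k, b = 2 * k) \/ (exists k, b = 2 * k + 1).
  by case: (Z.Even_or_Odd b) => -[k ?]; [left | right]; exists k.
  apply: (gauss_power_no_unit_form a b p s) => //; first by exists k; lia.
  by apply: (nz a b s) => //; lia.
(* If b is odd then a is even, because z is odd; multiplication of the root by i exchanges the two
   parts. *)
have [u Hu EPi] := gauss_i_pow a b p po.
have HPi : let P := qpow 1 (- b, a) p in P.1 + - s * P.2 = 1 \/ P.1 + - s * P.2 = -1.
  by rewrite EPi; cbn [fst snd]; case: Hu => ->; case: HP => HP; move: HP; case: Hs => ->; lia.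
have a0 : a <> 0 by apply: (nz (- b) a (- s)) => //; lia.
apply: (gauss_power_no_unit_form (- b) a p (- s)) => //; last by lia.
have [[l Hl]|[l Hl]] : (exists l, a = 2 * l) \/ (exists l, a = 2 * l + 1).
  by case: (Z.Even_or_Odd a) => -[l ?]; [left | right]; exists l.
  by exists l; lia.
exfalso; apply: oz; exists (2 * (l * l + l + k * k + k) + 1); lia.
Qed.

End Stormer.

(** * The sums F_m and the common divisors of their factors *)

Section PowerSums.
Local Open Scope Z_scope.

(** This is the expansion of the quotient W at a = -b, to second order in a + b. It is multiplied by
    b because its second term contains b^(2j-1), which is not integral for j = 0. *)
Lemma odd_power_sum a b j : exists W u,
  a ^^ (2 * j + 1) + b ^^ (2 * j + 1) = (a + b) * W /\
  b * W = (2 * Z.of_nat j + 1) * b ^^ (2 * j + 1)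
    - Z.of_nat j * (2 * Z.of_nat j + 1) * (a + b) * b ^^ (2 * j) + (a + b) * (a + b) * u.
Proof.
elim: j => [|j [W [u [E1 E2]]]].
  by exists 1, 0; rewrite muln0 add0n !powS !Z.pow_0_r; split; ring.
exists (a * a * W + b ^^ (2 * j + 1) * (b - a)).
exists ((b * b - 2 * b * (a + b)) * u + b * W + 2 * Z.of_nat j * (2 * Z.of_nat j + 1) * b ^^ (2 * j + 1)).
have -> : (2 * j.+1 + 1 = (2 * j + 1).+2)%N by lia.
have -> : (2 * j.+1 = (2 * j + 1).+1)%N by lia.
rewrite !powS Nat2Z.inj_succ /Z.succ; set J := Z.of_nat j in E2 *.
have E3 : b ^^ (2 * j + 1) = b * b ^^ (2 * j) by rewrite addn1 powS.
set P := a ^^ (2 * j + 1) in E1 *; set T := b ^^ (2 * j) in E2 E3 *.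
set U := b ^^ (2 * j + 1) in E1 E2 E3 *; split.
  transitivity (a * a * (P + U) + (b * b - a * a) * U); first ring.
  by rewrite E1; ring.
transitivity (a * a * (b * W) + b * U * (b - a)); first ring.
have Ea : a * a = b * b - 2 * b * (a + b) + (a + b) * (a + b) by ring.
transitivity ((b * b - 2 * b * (a + b)) * (b * W) + (a + b) * (a + b) * (b * W) + b * U * (b - a)).
  by rewrite Ea; ring.
by rewrite {1}E2 E3; ring.
Qed.

Lemma gcd_power_sum a b W k : 0 < a -> 0 < b -> Z.gcd a b = 1 -> odd k ->
  a ^^ k + b ^^ k = (a + b) * W -> (Z.gcd (a + b) W | Z.of_nat k).
Proof.
move=> Ha Hb gab ok EW.
have [W' [u [E1 E2]]] := odd_power_sum a b k./2.
have Ek : k = (2 * k./2 + 1)%N by rewrite -{1}(odd_double_half k) ok mul2n addnC.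
rewrite -Ek in E1 E2.
have EWW : W' = W by apply: (Z.mul_reg_l _ _ (a + b)); lia.
rewrite EWW in E2.
set g := Z.gcd _ _.
have g1 : (g | a + b) by apply: Z.gcd_divide_l.
have g2 : (g | W) by apply: Z.gcd_divide_r.
have gb : Z.gcd g (b ^^ k) = 1.
  apply: coprime_pow_r; apply: (coprime_dvd_l (a + b)) => //.
  by rewrite Z.gcd_comm Z.gcd_add_diag_r Z.gcd_comm.
apply: (Z.gauss _ (b ^^ k)) => //.
have -> : b ^^ k * Z.of_nat k = b * W + (a + b) * (Z.of_nat k./2 * (2 * Z.of_nat k./2 + 1) * b ^^ (2 * k./2) - (a + b) * u).
  rewrite E2 {2}Ek; lia.
by apply: Z.divide_add_r; [apply: Z.divide_mul_r | apply: Z.divide_mul_l].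
Qed.

(** When q divides both a + b and k, the second term of the expansion vanishes modulo q^2 as well.
    For k = q this shows that q divides the quotient exactly once. *)
Lemma power_sum_quotient_mod a b W k q : 0 < a -> 0 < b -> Z.gcd q b = 1 -> odd k ->
  a ^^ k + b ^^ k = (a + b) * W -> (q | a + b) -> (q | Z.of_nat k) ->
  exists2 v, Z.gcd q v = 1 & cong (q * q) W (Z.of_nat k * v).
Proof.
move=> Ha Hb gqb ok EW [s Hs] [t Ht].
have [W' [u [E1 E2]]] := odd_power_sum a b k./2.
have Ek : k = (2 * k./2 + 1)%N by rewrite -{1}(odd_double_half k) ok mul2n addnC.
rewrite -Ek in E1 E2.
have EWW : W' = W by apply: (Z.mul_reg_l _ _ (a + b)); lia.
rewrite EWW in E2.
exists (b ^^ (2 * k./2)); first exact: coprime_pow_r.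
apply: (cong_cancel _ b).
  by rewrite Z.gcd_comm; apply: coprime_mul; rewrite Z.gcd_comm.
have Eb : b ^^ k = b * b ^^ (2 * k./2) by rewrite {1}Ek addn1 powS.
exists (s * s * u - Z.of_nat k./2 * t * s * b ^^ (2 * k./2)).
rewrite E2 Eb Hs.
have -> : 2 * Z.of_nat k./2 + 1 = t * q by lia.
rewrite Ht; ring.
Qed.

Lemma coprime_succ_squares x j k : Z.gcd ((x * x) ^^ j) (((x + 1) * (x + 1)) ^^ k) = 1.
Proof.
apply: coprime_pow; have H : Z.gcd x (x + 1) = 1 by apply: (coprime_bezout (-1) 1); ring.
have H2 : Z.gcd x ((x + 1) * (x + 1)) = 1 by apply: coprime_mul.
by rewrite Z.gcd_comm; apply: coprime_mul; rewrite Z.gcd_comm.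
Qed.

Lemma prime_3mod4_sum_squares r s t : prime r -> (r %% 4 = 3)%N ->
  (Z.of_nat r | s * s + t * t) -> (Z.of_nat r | s).
Proof.
move=> pr r3 [k Hk].
case: (Znumtheory.Zdivide_dec (Z.of_nat r) s) => // Hs; exfalso.
have Ht : ~ (Z.of_nat r | t).
  move=> Ht; apply: Hs; suff : (Z.of_nat r | s * s) by move/(prime_dvd_mul _ _ _ pr) => [].
  have -> : s * s = k * Z.of_nat r - t * t by lia.
  by apply: Z.divide_sub_r; [apply: Z.divide_factor_r | apply: Z.divide_mul_l].
have Er : (r.-1 = 2 * r./2)%N by lia.
have or : odd r./2 by lia.
have Fs := fermat_Z r s pr Hs; have Ft := fermat_Z r t pr Ht.
have sq z : z ^^ 2 = z * z by rewrite !powS Z.mul_1_r.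
have C : cong (Z.of_nat r) (s ^^ r.-1) ((-1) ^^ r./2 * t ^^ r.-1).
  rewrite Er !powM !sq -pow_mull; apply: cong_pow.
  by exists k; lia.
rewrite pow_m1_odd // in C.
have C2 : cong (Z.of_nat r) 1 (-1 * 1).
  apply: cong_trans (cong_sym _ _ _ Fs) _; apply: cong_trans C _.
  by apply: cong_mul => //; apply: cong_refl.
case: C2 => l Hl; have r3' : 3 <= Z.of_nat r by lia.
by case: (Z_le_gt_dec l 0); nia.
Qed.

(** F_m is written with m-th powers of squares so that, for odd k, F_(dk) is a sum a^k + b^k with a
    + b = F_d. *)
Definition power_sum (m : nat) (x : Z) : Z := (x * x) ^^ m + ((x + 1) * (x + 1)) ^^ m.

Lemma power_sum1 x : power_sum 1 x = x * x + (x + 1) * (x + 1).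
Proof. by rewrite /power_sum !powS !Z.mul_1_r. Qed.

Lemma power_sum_gt0 m x : 1 <= x -> 0 < power_sum m x.
Proof.
move=> Hx; have H1 : 0 < (x * x) ^^ m by apply: pow_pos; nia.
have H2 : 0 < ((x + 1) * (x + 1)) ^^ m by apply: pow_pos; nia.
rewrite /power_sum; lia.
Qed.

Lemma power_sum_prime_3mod4 r m x : prime r -> (r %% 4 = 3)%N -> 1 <= x ->
  ~ (Z.of_nat r | power_sum m x).
Proof.
move=> pr r3 Hx; rewrite /power_sum !pow_mull => H.
have H1 := prime_3mod4_sum_squares r _ _ pr r3 H.
have H2 : (Z.of_nat r | (x + 1) ^^ m).
  by apply: (prime_3mod4_sum_squares r _ (x ^^ m) pr r3); rewrite Z.add_comm.
have {}H1 := prime_dvd_pow _ _ _ pr H1; have {}H2 := prime_dvd_pow _ _ _ pr H2.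
have : (Z.of_nat r | (x + 1) - x) by apply: Z.divide_sub_r.
have -> : x + 1 - x = 1 by ring.
by move=> /Z.divide_1_r_nonneg; have := prime_gt1 pr; lia.
Qed.

Lemma power_sum_factor d k x : odd k -> 1 <= x ->
  exists2 W, 0 < W & power_sum (d * k) x = power_sum d x * W /\
    (Z.gcd (power_sum d x) W | Z.of_nat k).
Proof.
move=> ok Hx; rewrite /power_sum !powM.
set a := (x * x) ^^ d; set b := ((x + 1) * (x + 1)) ^^ d.
have Ha : 0 < a by apply: pow_pos; nia.
have Hb : 0 < b by apply: pow_pos; nia.
have [W [u [E1 _]]] := odd_power_sum a b k./2.
have Ek : k = (2 * k./2 + 1)%N by rewrite -{1}(odd_double_half k) ok mul2n addnC.
rewrite -Ek in E1; exists W.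
  by have := pow_pos a k Ha; have := pow_pos b k Hb; nia.
split=> //; apply: (gcd_power_sum a b) => //; exact: coprime_succ_squares.
Qed.

(** The gcd divides k, whose prime factors are all 3 mod 4, and no such prime divides F_d. *)
Lemma coprime_of_no_prime_3mod4 d W k x : 1 <= x ->
  (k \in [:: 1; 3; 7; 9; 11])%N -> (Z.gcd (power_sum d x) W | Z.of_nat k) ->
  Z.gcd (power_sum d x) W = 1.
Proof.
move=> Hx Hk Hg.
have not_dvd r : prime r -> (r %% 4 = 3)%N -> ~ (Z.of_nat r | Z.gcd (power_sum d x) W).
  move=> pr r3 H; apply: (power_sum_prime_3mod4 r d x pr r3 Hx).
  by apply: Z.divide_trans H _; apply: Z.gcd_divide_l.
have n3 := not_dvd 3%N erefl erefl.
have n7 := not_dvd 7%N erefl erefl.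
have n11 := not_dvd 11%N erefl erefl.
have P := Z.gcd_nonneg (power_sum d x) W.
set g := Z.gcd _ _ in Hg n3 n7 n11 P *.
case: Hg => l Hl.
have k11 : 0 < Z.of_nat k <= 11 by move: Hk; rewrite !inE => /or4P [| | |/orP []] /eqP ->.
have g11 : 0 <= g <= 11.
  have Hgk : (g | Z.of_nat k) by exists l.
  by have := Z.divide_pos_le _ _ (proj1 k11) Hgk; lia.
have : g = 0 \/ g = 1 \/ g = 2 \/ g = 3 \/ g = 4 \/ g = 5 \/ g = 6 \/ g = 7 \/ g = 8
  \/ g = 9 \/ g = 10 \/ g = 11 by lia.
have D r c : g = c * Z.of_nat r -> (Z.of_nat r | g) by move=> ->; exists c.
move: Hk; rewrite !inE => /or4P [| | |/orP []] /eqP Ek; subst k.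
all: move=> [|[|[|[|[|[|[|[|[|[|[|]]]]]]]]]]] Eg; rewrite Eg in Hl; try lia.
- by case: n3; apply: (D _ 1).
- by case: n7; apply: (D _ 1).
- by case: n3; apply: (D _ 1).
- by case: n3; apply: (D _ 3).
- by case: n11; apply: (D _ 1).
Qed.

Lemma power_sum_reduce d k x y n : 1 <= x -> 0 < y -> (0 < n)%N ->
  (k \in [:: 1; 3; 7; 9; 11])%N -> power_sum (d * k) x = y ^^ n ->
  exists2 y', 0 < y' & power_sum d x = y' ^^ n.
Proof.
move=> Hx Hy Hn Hk E.
have ok : odd k by move: Hk; rewrite !inE => /or4P [| | |/orP []] /eqP ->.
have [W W0 [EW Hg]] := power_sum_factor d k x ok Hx.
apply: (coprime_pow_factor _ W y) => //; last by rewrite -EW.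
  exact: power_sum_gt0.
exact: coprime_of_no_prime_3mod4 Hk Hg.
Qed.

End PowerSums.

(** * The two ways in which F_m can be a perfect power *)

Section Dichotomy.
Local Open Scope Z_scope.

Lemma power_sum_quotient q d x : prime q -> odd q -> 1 <= x ->
  (Z.of_nat q | power_sum d x) -> exists R, [/\ 0 < R,
    power_sum (d * q) x = power_sum d x * (Z.of_nat q * R),
    Z.gcd (Z.of_nat q) R = 1 & Z.gcd (power_sum d x) R = 1].
Proof.
move=> pq oq Hx qS; have q1 := prime_gt1 pq.
have [W W0 [EW Hg]] := power_sum_factor d q x oq Hx.
have Ha : 0 < (x * x) ^^ d by apply: pow_pos; nia.
have Hb : 0 < ((x + 1) * (x + 1)) ^^ d by apply: pow_pos; nia.
have gqb : Z.gcd (Z.of_nat q) (((x + 1) * (x + 1)) ^^ d) = 1.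
  apply: prime_coprime_Z => // H.
  have : (Z.of_nat q | Z.gcd ((x * x) ^^ d) (((x + 1) * (x + 1)) ^^ d)).
    apply: Z.gcd_greatest => //.
    have -> : (x * x) ^^ d = power_sum d x - ((x + 1) * (x + 1)) ^^ d by rewrite /power_sum; ring.
    exact: Z.divide_sub_r.
  by rewrite coprime_succ_squares => /Z.divide_1_r_nonneg; lia.
have EW' := EW; rewrite /power_sum !powM in EW'.
have [v gv [k Hk]] := power_sum_quotient_mod _ _ _ _ _ Ha Hb gqb oq EW' qS (Z.divide_refl _).
exists (v + Z.of_nat q * k).
have ER : W = Z.of_nat q * (v + Z.of_nat q * k) by lia.
have gR : Z.gcd (Z.of_nat q) (v + Z.of_nat q * k) = 1.
  by rewrite Z.mul_comm Z.gcd_add_mult_diag_r.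
split=> //; first by nia.
  by rewrite EW ER.
set g := Z.gcd _ _.
have g1 : (g | Z.of_nat q).
  apply: Z.divide_trans Hg; apply: Z.gcd_greatest; first exact: Z.gcd_divide_l.
  by rewrite ER; apply: Z.divide_mul_r; apply: Z.gcd_divide_r.
have : (g | 1) by rewrite -gR; apply: Z.gcd_greatest => //; apply: Z.gcd_divide_r.
by move=> /Z.divide_1_r_nonneg; apply; apply: Z.gcd_nonneg.
Qed.

(** For m = 25 there are three coprime factors 25 S, R and R', where 5R and 5R' are the quotients
    F_5 / S and F_25 / F_5. Only the first two are recorded, so q = 5 indexes the quotient and e = 2
    the power of q that accompanies S. *)
Definition split_power_sum (n m : nat) (x : Z) : Prop :=
  (exists z t W, [/\ 0 < z, 0 < t, power_sum 1 x = z ^^ n,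
     power_sum m x = power_sum 1 x * W & W = t ^^ n]) \/
  (exists (q e : nat) z c R, [/\ q \in [:: 5; 13; 17; 29; 37; 41]%N,
     m = q /\ e = 1%N \/ m = 25%N /\ q = 5%N /\ e = 2%N,
     0 < z /\ 0 < c, (Z.of_nat q | power_sum 1 x) /\ Z.gcd (Z.of_nat q) R = 1 &
     [/\ power_sum 1 x * Z.of_nat q ^^ e = z ^^ n, R = c ^^ n &
         power_sum q x = power_sum 1 x * (Z.of_nat q * R)]]).

Lemma power_sum_split_coprime n m x y W : (0 < n)%N -> 1 <= x -> 0 < y -> 0 < W ->
  power_sum m x = y ^^ n -> power_sum m x = power_sum 1 x * W ->
  Z.gcd (power_sum 1 x) W = 1 -> split_power_sum n m x.
Proof.
move=> Hn Hx Hy HW Ey EW g; left.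
have S0 := power_sum_gt0 1 x Hx.
have [z z0 Ez] := coprime_pow_factor _ W y n S0 Hy Hn g (etrans (esym EW) Ey).
have g' : Z.gcd W (power_sum 1 x) = 1 by rewrite Z.gcd_comm.
have EW' : W * power_sum 1 x = y ^^ n by rewrite -Ey EW; ring.
have [t t0 Et] := coprime_pow_factor W _ y n HW Hy Hn g' EW'.
by exists z, t, W.
Qed.

Lemma gcd_mul1 a b c : Z.gcd a c = 1 -> Z.gcd b c = 1 -> Z.gcd (a * b) c = 1.
Proof.
by move=> H1 H2; rewrite Z.gcd_comm; apply: coprime_mul; rewrite Z.gcd_comm.
Qed.

Lemma power_sum_split_prime n m x y : (0 < n)%N -> 1 <= x -> 0 < y -> prime m ->
  (m \in [:: 5; 13; 17; 29; 37; 41]%N) || (m %% 4 == 3)%N ->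
  power_sum m x = y ^^ n -> split_power_sum n m x.
Proof.
move=> Hn Hx Hy pm Hm Ey; have m1 := prime_gt1 pm.
have om : odd m.
  by case/orP: Hm => [|/eqP]; [rewrite !inE => /or4P [| | |/or3P []] /eqP -> | lia].
have S0 := power_sum_gt0 1 x Hx.
case: (Znumtheory.Zdivide_dec (Z.of_nat m) (power_sum 1 x)) => HS; last first.
  have [W W0 [EW Hg]] := power_sum_factor 1 m x om Hx.
  rewrite mul1n in EW; apply: (power_sum_split_coprime n m x y W) => //.
  have gm : Z.gcd (Z.of_nat m) (Z.gcd (power_sum 1 x) W) = 1.
    apply: prime_coprime_Z => // H; apply: HS; apply: Z.divide_trans H _.
    exact: Z.gcd_divide_l.
  set g := Z.gcd _ _ in Hg gm *.
  have : (g | 1) by rewrite -gm; apply: Z.gcd_greatest => //; apply: Z.divide_refl.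
  by move=> /Z.divide_1_r_nonneg; apply; apply: Z.gcd_nonneg.
case/orP: Hm => [Hm|/eqP m3]; last by case: (power_sum_prime_3mod4 m 1 x pm m3 Hx).
have [R [R0 ER gR gSR]] := power_sum_quotient m 1 x pm om Hx HS.
rewrite mul1n in ER.
have gmS : Z.gcd (power_sum 1 x * Z.of_nat m) R = 1 by apply: gcd_mul1.
have E1 : power_sum 1 x * Z.of_nat m * R = y ^^ n by rewrite -Ey ER; ring.
have P1 : 0 < power_sum 1 x * Z.of_nat m by nia.
have [z z0 Ez] := coprime_pow_factor _ _ _ _ P1 Hy Hn gmS E1.
have gmS' : Z.gcd R (power_sum 1 x * Z.of_nat m) = 1 by rewrite Z.gcd_comm.
have E2 : R * (power_sum 1 x * Z.of_nat m) = y ^^ n by rewrite -E1; ring.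
have [c c0 Ec] := coprime_pow_factor _ _ _ _ R0 Hy Hn gmS' E2.
right; exists m, 1%N, z, c, R; split=> //; first by left.
by split=> //; rewrite powS Z.mul_1_r.
Qed.

Lemma power_sum_split_25 n x y : (0 < n)%N -> 1 <= x -> 0 < y ->
  power_sum 25 x = y ^^ n -> split_power_sum n 25 x.
Proof.
move=> Hn Hx Hy Ey; have S0 := power_sum_gt0 1 x Hx.
have p5 : prime 5 by [].
case: (Znumtheory.Zdivide_dec (Z.of_nat 5) (power_sum 1 x)) => HS; last first.
  have [W W0 [EW Hg]] := power_sum_factor 1 25 x erefl Hx.
  rewrite mul1n in EW; apply: (power_sum_split_coprime n 25 x y W) => //.
  have gm : Z.gcd (Z.of_nat 5) (Z.gcd (power_sum 1 x) W) = 1.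
    apply: prime_coprime_Z => // H; apply: HS; apply: Z.divide_trans H _.
    exact: Z.gcd_divide_l.
  set g := Z.gcd _ _ in Hg gm *.
  have g25 : Z.gcd (Z.of_nat 25) g = 1 by apply: (gcd_mul1 5 5).
  have : (g | 1) by rewrite -g25; apply: Z.gcd_greatest => //; apply: Z.divide_refl.
  by move=> /Z.divide_1_r_nonneg; apply; apply: Z.gcd_nonneg.
have [R [R0 ER gR gSR]] := power_sum_quotient 5 1 x p5 erefl Hx HS.
rewrite mul1n in ER.
have HF : (Z.of_nat 5 | power_sum 5 x).
  by rewrite ER; apply: Z.divide_mul_l.
have [R' [R'0 ER' gR' gFR']] := power_sum_quotient 5 5 x p5 erefl Hx HF.
rewrite [(5 * 5)%N]/= in ER'.
have gSR' : Z.gcd (power_sum 1 x) R' = 1.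
  by apply: coprime_dvd_l gFR'; rewrite ER; apply: Z.divide_factor_l.
have gRR' : Z.gcd R R' = 1.
  by apply: coprime_dvd_l gFR'; rewrite ER; do 2!apply: Z.divide_mul_r; apply: Z.divide_refl.
have E1 : power_sum 1 x * Z.of_nat 5 ^^ 2 * (R * R') = y ^^ n.
  by rewrite -Ey ER' ER !powS Z.pow_0_r; ring.
have P1 : 0 < power_sum 1 x * Z.of_nat 5 ^^ 2 by rewrite !powS Z.pow_0_r; lia.
have g5 r : Z.gcd (Z.of_nat 5) r = 1 -> Z.gcd (Z.of_nat 5 ^^ 2) r = 1.
  by move=> H; rewrite Z.gcd_comm; apply: coprime_pow_r; rewrite Z.gcd_comm.
have g1 : Z.gcd (power_sum 1 x * Z.of_nat 5 ^^ 2) (R * R') = 1.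
  by apply: coprime_mul; apply: gcd_mul1 => //; apply: g5.
have [z z0 Ez] := coprime_pow_factor _ _ _ _ P1 Hy Hn g1 E1.
have E2 : R * (power_sum 1 x * Z.of_nat 5 ^^ 2 * R') = y ^^ n by rewrite -E1; ring.
have g2 : Z.gcd R (power_sum 1 x * Z.of_nat 5 ^^ 2 * R') = 1.
  by apply: coprime_mul => //; rewrite Z.gcd_comm; apply: gcd_mul1 => //; apply: g5.
have [c c0 Ec] := coprime_pow_factor _ _ _ _ R0 Hy Hn g2 E2.
right; exists 5%N, 2%N, z, c, R; split=> //; first by right.
Qed.

End Dichotomy.

(** * Polynomials in w = x(x+1) as coefficient lists, constant term first *)

Section IntegerPolynomials.
Local Open Scope Z_scope.

Fixpoint peval (p : seq Z) (w : Z) : Z := if p is a :: p' then a + w * peval p' w else 0.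
Fixpoint padd (p q : seq Z) : seq Z :=
  match p, q with
  | [::], _ => q | _, [::] => p | a :: p', b :: q' => (a + b) :: padd p' q'
  end.
Definition pscale (c : Z) (p : seq Z) : seq Z := [seq c * a | a <- p].
Fixpoint pmul (p q : seq Z) : seq Z :=
  if p is a :: p' then padd (pscale a q) (0 :: pmul p' q) else [::].

Lemma peval_add p q w : peval (padd p q) w = peval p w + peval q w.
Proof. by elim: p q => [|a p IH] [|b q] //=; rewrite ?IH; ring. Qed.

Lemma peval_scale c p w : peval (pscale c p) w = c * peval p w.
Proof. by elim: p => [|a p IH] /=; rewrite ?IH; ring. Qed.

Lemma peval_mul p q w : peval (pmul p q) w = peval p w * peval q w.
Proof. by elim: p => [|a p IH] //=; rewrite peval_add peval_scale /= IH; ring. Qed.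

Lemma peval_cong N p w w' : cong N w w' -> cong N (peval p w) (peval p w').
Proof.
move=> H; elim: p => [|a p IH]; first exact: cong_refl.
by apply: cong_add; [apply: cong_refl | apply: cong_mul].
Qed.

(* Horner lower bound, valid on [B, +oo). *)
Fixpoint plower (p : seq Z) (B : Z) : option Z :=
  if p is a :: p' then
    if plower p' B is Some c then if 0 <=? c then Some (a + B * c) else None else None
  else Some 0.

Lemma plowerP p B c w : 0 <= B <= w -> plower p B = Some c -> c <= peval p w.
Proof.
move=> HB; elim: p c => [|a p IH] c /=; first by case=> <-; lia.
case: (plower p B) IH => // d IH; case: Z.leb_spec => // d0 [<-].
have := IH d erefl; nia.
Qed.

Definition ppos (p : seq Z) (B : Z) : bool := if plower p B is Some c then 0 <? c else false.

Lemma pposP p B w : 0 <= B <= w -> ppos p B -> 0 < peval p w.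
Proof.
move=> HB; rewrite /ppos; case E: (plower p B) => [c|] // /Z.ltb_spec0 c0.
by have := plowerP _ _ _ _ HB E; lia.
Qed.

(* [sum_quotients j] holds, as polynomials in w = x(x+1), the quotients of
   x^(2m) + (x+1)^(2m) by x^2 + (x+1)^2 = 2w + 1 for m = 2j+1 and m = 2j+3. *)
Fixpoint sum_quotients (j : nat) : seq Z * seq Z :=
  if j is j'.+1 then let: (p, q) := sum_quotients j' in
    (q, padd (pmul [:: 1; 4; 2] q) (pscale (-1) (0 :: 0 :: 0 :: 0 :: p)))
  else ([:: 1], [:: 1; 4; 1]).
Definition sum_quotient (m : nat) : seq Z := (sum_quotients m./2).1.

(** The recurrence is that of the power sums of x^4 and (x+1)^4, whose sum is 1 + 4w + 2w^2 and
    whose product is w^4. *)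
Lemma sum_quotientsE j x : let w := x * (x + 1) in
  power_sum (2 * j + 1) x = power_sum 1 x * peval (sum_quotients j).1 w /\
  power_sum (2 * j + 3) x = power_sum 1 x * peval (sum_quotients j).2 w.
Proof.
move=> w; elim: j => [|j [E1 E2]].
  rewrite /power_sum (_ : 2 * 0 + 1 = 1)%N // (_ : 2 * 0 + 3 = 3)%N // !powS !Z.pow_0_r.
  cbn [peval sum_quotients fst snd]; split; rewrite /w; ring.
cbn [sum_quotients]; case: (sum_quotients j) E1 E2 => p q; cbn [fst snd] => E1 E2.
have -> : (2 * j.+1 + 1 = 2 * j + 3)%N by lia.
split=> //; rewrite peval_add peval_mul peval_scale.
have -> : (2 * j.+1 + 3 = (2 * j + 1).+4)%N by lia.
have E3 : (2 * j + 3 = (2 * j + 1).+2)%N by lia.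
rewrite E3 in E2; move: E1 E2; rewrite /power_sum !powS !Z.pow_0_r.
set a := (x * x) ^^ _; set b := ((x + 1) * (x + 1)) ^^ _ => E1 E2; cbn [peval].
set P := peval p w in E1 *; set Q := peval q w in E2 *.
transitivity ((1 + 4 * w + 2 * (w * w)) * (x * x * (x * x * a) + (x + 1) * (x + 1) * ((x + 1) * (x + 1) * b))
  - w * w * (w * w) * (a + b)); first by rewrite /w; ring.
by rewrite E1 E2 /w; ring.
Qed.

Lemma sum_quotientE m x : odd m ->
  power_sum m x = power_sum 1 x * peval (sum_quotient m) (x * (x + 1)).
Proof.
move=> om; have [<- _] := sum_quotientsE m./2 x.
by congr power_sum; rewrite -{1}(odd_double_half m) om mul2n addnC.
Qed.

End IntegerPolynomials.

(** * Exponent 4 in the coprime case: Runge's method and a Pell equation *)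

Section FourthPowers.
Local Open Scope Z_scope.

(* Coefficients, from the top, of the polynomial part of the square root of the
   monic polynomial with coefficients [c] from the top; [h] holds those already
   known except the leading one, last first. *)
Fixpoint sqrt_coefs (n : nat) (c h : seq Z) : seq Z :=
  if n is n'.+1 then
    if c is a :: c' then
      sqrt_coefs n' c' ((a - foldr Z.add 0 [seq u.1 * u.2 | u <- zip h (rev h)]) / 2 :: h)
    else h
  else h.

(** For p of degree d this is b^d p(v / b), which is integral in v = b w. *)
Fixpoint pstretch (b : Z) (p : seq Z) : seq Z :=
  if p is a :: p' then b ^^ size p' * a :: pstretch b p' else [::].

Lemma peval_stretch b p w : b * peval (pstretch b p) (b * w) = b ^^ size p * peval p w.
Proof.
elim: p => [|a p IH]; first by cbn [peval pstretch]; ring.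
cbn [peval pstretch size]; rewrite powS.
transitivity (b * b ^^ size p * a + b * w * (b * peval (pstretch b p) (b * w))); first ring.
by rewrite IH; ring.
Qed.

(* With v = 4w the square root of 4^(m-1) W has integral coefficients. *)
Definition runge_check (m : nat) (B : Z) : bool :=
  let c := pstretch 4 (sum_quotient m) in
  let h := rcons (sqrt_coefs m./2 (behead (rev c)) [::]) 1 in
  let r := padd c (pscale (-1) (pmul h h)) in
  let h2 := padd (pscale 2 h) [:: -1] in
  [&& size (sum_quotient m) == m, ppos h B, ppos (padd h2 r) B,
    ppos (padd h2 (pscale (-1) r)) B & ppos r B || ppos (pscale (-1) r) B].

(** With c = h^2 + r, the checks say that r is nonzero and |r| < 2h - 1 beyond B. Then c lies
    strictly between (h-1)^2 and (h+1)^2 without being h^2, so it is not a square; but it is 4^(m-1)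
    t^2. *)
Lemma runge_checkP m B w t : odd m -> 0 <= B -> runge_check m B ->
  peval (sum_quotient m) w = t * t -> 4 * w < B.
Proof.
move=> om B0 /and5P [/eqP sz]; set c := pstretch _ _; set h := rcons _ _.
set r := padd c _; set h2 := padd (pscale 2 h) _ => h0 hr hr' rn0 Ew.
case: (Z_lt_ge_dec (4 * w) B) => // Hw; exfalso.
have HB : 0 <= B <= 4 * w by lia.
have {}h0 := pposP _ _ _ HB h0; have {}hr := pposP _ _ _ HB hr.
have {}hr' := pposP _ _ _ HB hr'.
have {}rn0 : peval r (4 * w) <> 0.
  by case/orP: rn0 => /(pposP _ _ _ HB); rewrite ?peval_scale; lia.
have Er : peval r (4 * w) = peval c (4 * w) - peval h (4 * w) * peval h (4 * w).
  by rewrite /r peval_add peval_scale peval_mul; ring.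
have Eh2 : peval h2 (4 * w) = 2 * peval h (4 * w) - 1.
  by rewrite /h2 peval_add peval_scale; cbn [peval]; ring.
have Ec : peval c (4 * w) = (4 ^^ m./2 * t) * (4 ^^ m./2 * t).
  apply: (Z.mul_reg_l _ _ 4) => //; rewrite /c peval_stretch sz Ew.
  have -> : 4 ^^ m = 4 * (4 ^^ m./2 * 4 ^^ m./2).
    by rewrite -powD -powS addnn -{1}(odd_double_half m) om.
  ring.
move: hr hr' rn0; rewrite (peval_add h2 r) (peval_add h2 (pscale _ r)) (peval_scale _ r) Eh2 Er Ec.
move=> hr hr'.
set H := peval h _ in h0 hr hr' *; set s := 4 ^^ _ * t in hr hr' *.
rewrite -(Z.abs_square s) in hr hr' *; have u0 := Z.abs_nonneg s.
set u := Z.abs s in hr hr' u0 *; move=> rn0.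
have [L|[L|L]] : u <= H - 1 \/ u = H \/ H + 1 <= u by lia.
- by nia.
- by rewrite L in rn0; lia.
- by nia.
Qed.

(** The positive solutions of X^2 - 2Y^2 = -1, applied with X = 2x + 1 and Y = z^2. *)
Fixpoint pell (n : nat) : Z * Z :=
  if n is n'.+1 then let: (X, Y) := pell n' in (3 * X + 4 * Y, 2 * X + 3 * Y) else (1, 1).

Lemma pell_pos n : 0 < (pell n).1 /\ 0 < (pell n).2 /\
  (pell n).1 * (pell n).1 + 1 = 2 * ((pell n).2 * (pell n).2).
Proof. by elim: n => [|n] //; cbn [pell]; case: (pell n) => X Y; cbn [fst snd]; lia. Qed.

Lemma pell_complete n X Y : 0 < X -> 0 < Y -> X * X + 1 = 2 * (Y * Y) ->
  X < (pell n).1 -> exists2 j, (j < n)%N & (X, Y) = pell j.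
Proof.
elim: n X Y => [|n IH] X Y X0 Y0 E; first by cbn [pell fst]; lia.
have [P1 [P2 P3]] := pell_pos n; move=> HX.
have [X1|X1] := Z.eq_dec X 1.
  by exists 0%N => //; cbn [pell]; rewrite X1 in E *; congr (_, _); nia.
have HX' : 0 < 3 * X - 4 * Y by nia.
have HY' : 0 < 3 * Y - 2 * X by nia.
have E' : (3 * X - 4 * Y) * (3 * X - 4 * Y) + 1 = 2 * ((3 * Y - 2 * X) * (3 * Y - 2 * X)) by lia.
have [|j jn Ej] := IH _ _ HX' HY' E'.
  move: HX P1 P2 P3; cbn [pell]; case: (pell n) => A C; cbn [fst snd] => HX P1 P2 P3.
  case: (Z_lt_ge_dec (3 * X - 4 * Y) A) => // HA; exfalso.
  have HC : C <= 3 * Y - 2 * X by nia.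
  lia.
exists j.+1 => //; cbn [pell]; rewrite -Ej; congr (_, _); ring.
Qed.

Definition runge_moduli : seq nat := [:: 3; 5; 7; 11; 13; 17; 19; 23; 25; 29; 31; 37; 41; 43; 47]%N.

Definition not_square (n : Z) : bool := negb (Z.sqrt n * Z.sqrt n =? n).

Lemma not_squareP n t : not_square n -> n <> t * t.
Proof.
move=> /negP H E; apply: H; apply/Z.eqb_spec.
by rewrite E -(Z.abs_square t) Z.sqrt_square //; apply: Z.abs_nonneg.
Qed.

Lemma runge_checks : all (fun m => odd m && runge_check m (2 ^ 280) &&
  not_square (peval (sum_quotient m) 14280)) runge_moduli.
Proof. by vm_compute. Qed.

(** Since 4w = X^2 - 1, the solutions from [pell 56] on exceed the Runge bound 2^280; among the
    earlier ones Y is a square only for Y = 1 and Y = 169. *)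
Lemma pell_checks :
  all (fun j => let Y := (pell j).2 in [|| Y =? 1, Y =? 169 | not_square Y]) (iota 0 56) &&
  (2 ^ 280 <? (pell 56).1 * (pell 56).1 - 1).
Proof. by vm_compute. Qed.

(* 239^2 + 1 = 2 13^4 is the only other fourth power, and w = 14280 there. *)
Lemma power_sum_not_fourth_power m x z t W : m \in runge_moduli -> 1 <= x ->
  power_sum 1 x = z ^^ 4 -> power_sum m x = power_sum 1 x * W -> W = t ^^ 4 -> False.
Proof.
move=> Hm Hx Ez EW Et.
move/allP: runge_checks => /(_ m Hm) /andP [/andP [om Hr] Hs].
have S0 := power_sum_gt0 1 x Hx.
have Ew : peval (sum_quotient m) (x * (x + 1)) = W.
  by apply: (Z.mul_reg_l _ _ (power_sum 1 x)); [lia | rewrite -sum_quotientE].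
have p4 u : u ^^ 4 = (u * u) * (u * u) by rewrite !powS Z.pow_0_r; ring.
have Ew' : peval (sum_quotient m) (x * (x + 1)) = (t * t) * (t * t) by rewrite Ew Et p4.
have Hw := runge_checkP m (2 ^ 280) _ _ om _ Hr Ew'.
have /andP [/allP Hp /Z.ltb_spec0 HP] := pell_checks.
have [P1 [P2 P3]] := pell_pos 56.
have [] := pell_complete 56 (2 * x + 1) (z * z).
- lia.
- by rewrite power_sum1 p4 in Ez; nia.
- by rewrite power_sum1 p4 in Ez; lia.
- have := Hw _; set A := (pell 56).1 in P1 HP *; set B := 2 ^ 280 in HP *.
  have B0 : 0 <= B by [].
  move=> /(_ B0) {B0 Hr}; move: A B P1 HP {P2 P3} => A B P1 HP HB.
  case: (Z_lt_ge_dec (2 * x + 1) A) => HA; first by [].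
  exfalso.
  have : A * A <= (2 * x + 1) * (2 * x + 1) by apply: Z.mul_le_mono_nonneg; lia.
  lia.
move=> j j56 Ej; have : j \in iota 0 56 by rewrite mem_iota.
move=> /Hp; rewrite -Ej; cbn [snd] => /or3P [/Z.eqb_spec H|/Z.eqb_spec H|/not_squareP H].
- by rewrite power_sum1 p4 H in Ez; nia.
- have Ex : x = 119 by rewrite power_sum1 p4 H in Ez; nia.
  have Ex2 : x * (x + 1) = 14280 by rewrite Ex.
  by rewrite Ex2 in Ew'; apply: (not_squareP _ _ Hs Ew').
- exact: (H z).
Qed.

End FourthPowers.

(** * Primality of l = hp + 1 and the p-th power residues modulo l *)

Section Residues.
Local Open Scope Z_scope.

Lemma cong_pow_gcd N b i j : Z.gcd N b = 1 -> cong N (b ^^ i) 1 -> cong N (b ^^ j) 1 ->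
  cong N (b ^^ gcdn i j) 1.
Proof.
move=> gb Hi Hj; have [->|i0] := posnP i; first by rewrite gcd0n.
case: (egcdnP j i0) => km kn E _.
have Hik : cong N (b ^^ (km * i)) 1 by rewrite mulnC powM -(pow1n km); apply: cong_pow.
have Hjk : cong N (b ^^ (kn * j)) 1 by rewrite mulnC powM -(pow1n kn); apply: cong_pow.
apply: (cong_cancel _ (b ^^ (kn * j))); first exact: coprime_pow_r.
rewrite -powD -E; apply: cong_trans Hik _; rewrite Z.mul_1_r; exact: cong_sym.
Qed.

(** If l = hp + 1 were composite, its least prime factor r would satisfy r <= p, because h <= p + 1.
    Then p is prime to r - 1, so b^(hp) = 1 and Fermat's theorem give b^h = 1 modulo r, against the
    gcd. *)
Lemma pocklington p h b : prime p -> (h <= p.+1)%N -> (0 < h)%N ->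
  let N := Z.of_nat (h * p + 1) in
  cong N (b ^^ (h * p)) 1 -> Z.gcd (b ^^ h - 1) N = 1 -> prime (h * p + 1).
Proof.
move=> pp hp h0 N Hb Hg; have p1 := prime_gt1 pp.
apply/negPn/negP => /negP Hl.
set l := (h * p + 1)%N in N Hb Hg Hl.
have l1 : (1 < l)%N by rewrite /l; nia.
set r := pdiv l; have pr : prime r by apply: pdiv_prime.
have rl : (r %| l)%N by apply: pdiv_dvd.
have r2 : (r ^ 2 <= l)%N by rewrite leqNgt; apply/negP => H; case: Hl; apply: ltn_pdiv2_prime H; apply: ltnW.
have rp : (r <= p)%N by rewrite leqNgt; apply/negP => H; move: r2; rewrite /l; nia.
have rN : (Z.of_nat r | N).
  by case/dvdnP: rl => k Hk; exists (Z.of_nat k); rewrite /N Hk; lia.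
have Hbr := cong_dvd _ _ _ _ rN Hb.
have r1 := prime_gt1 pr.
have nb : ~ (Z.of_nat r | b).
  move=> Hd; have : (Z.of_nat r | 1).
    have hp0 : (0 < h * p)%N by nia.
    have -> : 1 = b ^^ (h * p) - (b ^^ (h * p) - 1) by ring.
    apply: Z.divide_sub_r => //.
    by case: (h * p)%N hp0 => // n _; rewrite powS; apply: Z.divide_mul_l.
  by move=> /Z.divide_1_r_nonneg; lia.
have nbh : ~ (Z.of_nat r | b ^^ h) by move=> /(prime_dvd_pow _ _ _ pr).
have F := fermat_Z r _ pr nbh.
have gb := prime_coprime_Z _ _ pr nbh.
rewrite powM in Hbr.
have := cong_pow_gcd _ _ _ _ gb Hbr F.
have -> : gcdn p r.-1 = 1%N.
  by apply/eqP; rewrite -/(coprime p r.-1) prime_coprime // gtnNdvd //; lia.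
rewrite powS Z.mul_1_r => H1.
have : (Z.of_nat r | 1) by rewrite -Hg; apply: Z.gcd_greatest.
by move=> /Z.divide_1_r_nonneg; lia.
Qed.

Definition powers (l w : Z) (h : nat) : seq Z := traject (fun r => (r * w) mod l) 1 h.

Lemma powersP l w h i : 0 < l -> (i < h)%N -> cong l (nth 1 (powers l w h) i) (w ^^ i).
Proof.
move=> l0 ih; rewrite /powers nth_traject //; elim: i {ih} => [|i IH]; first exact: cong_refl.
rewrite iterS powS Z.mul_comm; apply: cong_trans (cong_mod _ _ l0) _.
by apply: cong_mul => //; apply: cong_refl.
Qed.

Lemma powers_mod l w h r : 1 < l -> r \in powers l w h -> 0 <= r < l.
Proof.
move=> l1 /trajectP [[|i] _ ->]; first by rewrite /=; lia.
by rewrite iterS; apply: Z.mod_pos_bound; lia.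
Qed.

(** Over the field of l elements X^h - 1 has at most h roots, and the distinct powers of w already
    provide h of them. *)
Lemma unity_root_powers l w h t : prime l -> (0 < h)%N -> uniq (powers (Z.of_nat l) w h) ->
  cong (Z.of_nat l) (w ^^ h) 1 -> cong (Z.of_nat l) (t ^^ h) 1 ->
  exists2 r, r \in powers (Z.of_nat l) w h & cong (Z.of_nat l) t r.
Proof.
move=> pl h0 uq Hw Ht; have l1 := prime_gt1 pl.
pose phi (z : Z) : 'F_l := ((int_of_Z z)%:~R)%R.
have phi_cong x y : phi x = phi y <-> cong (Z.of_nat l) x y.
  have H := pchar_Fp pl; rewrite /cong /phi.
  have -> : ((int_of_Z x)%:~R = (int_of_Z y)%:~R :> 'F_l)%R <->
      (((int_of_Z x - int_of_Z y)%R)%:~R == 0 :> 'F_l)%R.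
    by rewrite GRing.rmorphB /= GRing.subr_eq0; split=> [->|/eqP].
  rewrite -(dvdz_pcharf H); split=> [/dvdzP [q Hq]|[q Hq]].
    by exists (Z_of_int q); lia.
  by apply/dvdzP; exists (int_of_Z q); lia.
have phiX x n : phi (x ^^ n) = ((phi x) ^+ n)%R.
  elim: n => [|n IH]; first by rewrite GRing.expr0.
  by rewrite powS GRing.exprS -IH /phi -intrM; congr (_%:~R)%R; lia.
have phi1 : phi 1 = 1%R by [].
have Hr : all h.-unity_root%R [seq phi r | r <- powers (Z.of_nat l) w h].
  apply/allP => _ /mapP [r Hr ->]; rewrite unity_rootE -phiX -phi1; apply/eqP/phi_cong.
  have E := nth_index 1 Hr; rewrite -index_mem size_traject in Hr.
  rewrite -E; set i := index _ _ in Hr *.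
  apply: cong_trans (cong_pow _ _ _ h (powersP _ _ _ _ _ Hr)) _; first by lia.
  by rewrite -powM mulnC powM -(pow1n i); apply: cong_pow.
have Hu : uniq [seq phi r | r <- powers (Z.of_nat l) w h].
  rewrite map_inj_in_uniq // => a b Ha Hb /phi_cong [k Hk].
  have L1 : 1 < Z.of_nat l by lia.
  have := powers_mod _ _ _ _ L1 Ha; have := powers_mod _ _ _ _ L1 Hb.
  have [K|[K|K]] : k <= -1 \/ k = 0 \/ 1 <= k by lia.
  - by nia.
  - by rewrite K in Hk; lia.
  - by nia.
have Hs : size [seq phi r | r <- powers (Z.of_nat l) w h] = h by rewrite size_map size_traject.
have : phi t \in [seq phi r | r <- powers (Z.of_nat l) w h].
  rewrite -(mem_unity_roots h0 Hr Hu Hs) -topredE /=.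
  by rewrite unity_rootE -phiX -phi1; apply/eqP/phi_cong.
by case/mapP=> r Hr' /phi_cong E; exists r.
Qed.

Lemma power_residue l p h w z : prime l -> l = (h * p + 1)%N -> (0 < h)%N -> (0 < p)%N ->
  uniq (powers (Z.of_nat l) w h) -> cong (Z.of_nat l) (w ^^ h) 1 ->
  exists2 r, r \in 0 :: powers (Z.of_nat l) w h & cong (Z.of_nat l) (z ^^ p) r.
Proof.
move=> pl El h0 p0 uq Hw.
case: (Znumtheory.Zdivide_dec (Z.of_nat l) z) => Hz.
  exists 0; rewrite ?inE ?eqxx //; apply/cong0P.
  by case: (p) p0 => // n _; rewrite powS; apply: Z.divide_mul_l.
have Hzh : cong (Z.of_nat l) ((z ^^ p) ^^ h) 1.
  by rewrite -powM mulnC; have := fermat_Z l z pl Hz; rewrite {2}El addn1.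
have [r Hr E] := unity_root_powers l w h (z ^^ p) pl h0 uq Hw Hzh.
by exists r => //; rewrite inE Hr orbT.
Qed.

End Residues.

(** * Lifting congruences to prime powers; powers of a Gaussian integer modulo its norm *)

Section PowerDescent.
Local Open Scope Z_scope.

Lemma pow_first_order b d n : exists u,
  (b + d) ^^ n.+1 = b ^^ n.+1 + Z.of_nat n.+1 * d * b ^^ n + d * d * u.
Proof.
elim: n => [|n [u IH]].
  by exists 0; rewrite !powS !Z.pow_0_r (_ : Z.of_nat 1 = 1) //; ring.
exists (Z.of_nat n.+1 * b ^^ n + (b + d) * u).
rewrite powS IH (powS b n.+1) !(powS b n); have -> : Z.of_nat n.+2 = Z.of_nat n.+1 + 1 by lia.
ring.
Qed.

Lemma cong_lift N p a b : (0 < p)%N -> (Z.of_nat p | N) -> cong N a b ->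
  cong (Z.of_nat p * N) (a ^^ p) (b ^^ p).
Proof.
case: p => // n _ [l Hl] [k Hk]; have [u Hu] := pow_first_order b (k * N) n.
exists (k * b ^^ n + k * k * l * u); have -> : a = b + k * N by lia.
have E : N * N = l * Z.of_nat n.+1 * N by rewrite {1}Hl.
rewrite Hu; transitivity (Z.of_nat n.+1 * k * N * b ^^ n + k * k * u * (N * N)); first ring.
by rewrite E; ring.
Qed.

Lemma cong_lift_iter q a b e : (0 < q)%N -> cong (Z.of_nat q) a b ->
  cong (Z.of_nat q ^^ e.+1) (a ^^ (q ^ e)%N) (b ^^ (q ^ e)%N).
Proof.
move=> q0 H; elim: e => [|e IH]; first by rewrite expn0 !powS Z.pow_0_r !Z.mul_1_r.
rewrite expnSr !powM powS; apply: cong_lift => //; rewrite powS; exact: Z.divide_factor_l.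
Qed.

Lemma euler_Z q a e : prime q -> ~ (Z.of_nat q | a) ->
  cong (Z.of_nat q ^^ e.+1) ((a ^^ q.-1) ^^ (q ^ e)%N) 1.
Proof.
move=> pq Ha; rewrite -(pow1n (q ^ e)%N); apply: cong_lift_iter.
  exact: prime_gt0.
exact: fermat_Z.
Qed.

Lemma fermat_iter q a e : prime q -> cong (Z.of_nat q) (a ^^ (q ^ e)%N) a.
Proof.
move=> pq; elim: e => [|e IH]; first by rewrite expn0 powS Z.mul_1_r; apply: cong_refl.
rewrite expnSr powM.
have F b : cong (Z.of_nat q) (b ^^ q) b.
  have -> : b ^^ q = b * b ^^ q.-1 by rewrite -powS (prednK (prime_gt0 pq)).
  case: (Znumtheory.Zdivide_dec (Z.of_nat q) b) => Hb.
    case: Hb => k Hk; exists (k * (b ^^ q.-1 - 1)); set T := b ^^ q.-1.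
    by transitivity (b * (T - 1)); [ring | rewrite Hk; ring].
  have := cong_mul _ _ _ _ _ (cong_refl _ b) (fermat_Z q b pq Hb).
  by rewrite Z.mul_1_r.
exact: cong_trans (F _) IH.
Qed.

(** Modulo its norm, g satisfies g^2 = 2 g.1 g, because its trace is 2 g.1; hence g^(n+1) = (2
    g.1)^n g. *)
Lemma qpow_norm_mod N D g n : (N | qnorm D g) ->
  cong N (qpow D g n.+1).1 ((2 * g.1) ^^ n * g.1) /\
  cong N (qpow D g n.+1).2 ((2 * g.1) ^^ n * g.2).
Proof.
move=> [k Hk]; elim: n => [|n [[u Hu] [v Hv]]].
  rewrite qpow1 Z.pow_0_r !Z.mul_1_l; split; exact: cong_refl.
rewrite qpowS /qmul; cbn [fst snd]; rewrite !powS; move: Hk; rewrite /qnorm => Hk.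
set P := qpow D g n.+1 in Hu Hv *; set L := (2 * g.1) ^^ n in Hu Hv *.
split.
  exists (g.1 * u - D * g.2 * v - L * k).
  transitivity (g.1 * (P.1 - L * g.1) - D * g.2 * (P.2 - L * g.2)
    - L * (g.1 * g.1 + D * (g.2 * g.2))); first ring.
  by rewrite Hu Hv Hk; ring.
exists (g.1 * v + g.2 * u).
transitivity (g.1 * (P.2 - L * g.2) + g.2 * (P.1 - L * g.1)); first ring.
by rewrite Hu Hv; ring.
Qed.

(** For an odd exponent p, the cofactor of u in the real part is p v^(p-1) modulo u, up to sign.
    This makes u and its cofactor coprime away from p. *)
Lemma gauss_pow_real_part u v j : exists2 s, s = 1 \/ s = -1 & exists A B,
  qpow 1 (u, v) (2 * j + 1) = (u * (s * (2 * Z.of_nat j + 1) * v ^^ (2 * j) + u * A),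
    s * v ^^ (2 * j + 1) + u * B) /\ (u | B).
Proof.
elim: j => [|j [s Hs [A [B [E [k Hk]]]]]].
  exists 1; first by left.
  exists 0, 0; rewrite muln0 add0n qpow1 powS !Z.pow_0_r; split; last by exists 0.
  by congr (_, _); ring.
exists (- s); first by lia.
have -> : (2 * j.+1 + 1 = 2 + (2 * j + 1))%N by lia.
have -> : (2 * j.+1 = (2 * j).+2)%N by lia.
rewrite qpowD E; cbn [qpow]; rewrite /qmul; cbn [fst snd].
have -> : (2 + (2 * j + 1) = (2 * j).+3)%N by lia.
have -> : (2 * j + 1 = (2 * j).+1)%N by lia.
rewrite !powS Nat2Z.inj_succ /Z.succ; set J := Z.of_nat j; set V := v ^^ (2 * j).
exists (u * (s * (2 * J + 1) * V + u * A) - v * v * A - 2 * v * k * u).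
exists (u * (s * v * V + u * B) - v * v * B + 2 * v * u * (s * (2 * J + 1) * V + u * A)).
split; last by rewrite Hk; exists (s * v * V + u * (k * u) - v * v * k + 2 * v * (s * (2 * J + 1) * V + u * A)); ring.
by rewrite Hk; congr (_, _); ring.
Qed.

Lemma gauss_pow_imag_part u v j : exists A B,
  qpow 1 (u, v) (2 * j + 1) = (u ^^ (2 * j + 1) + v * B,
    v * ((2 * Z.of_nat j + 1) * u ^^ (2 * j) + v * A)) /\ (v | B).
Proof.
elim: j => [|j [A [B [E [k Hk]]]]].
  exists 0, 0; rewrite muln0 add0n qpow1 powS !Z.pow_0_r; split; last by exists 0.
  by congr (_, _); ring.
have -> : (2 * j.+1 + 1 = 2 + (2 * j + 1))%N by lia.
have -> : (2 * j.+1 = (2 * j).+2)%N by lia.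
rewrite qpowD E; cbn [qpow]; rewrite /qmul; cbn [fst snd].
have -> : (2 + (2 * j + 1) = (2 * j).+3)%N by lia.
have -> : (2 * j + 1 = (2 * j).+1)%N by lia.
rewrite !powS Nat2Z.inj_succ /Z.succ; set J := Z.of_nat j; set U := u ^^ (2 * j).
exists (- v * ((2 * J + 1) * U + v * A) + u * u * A + 2 * u * k * v).
exists (- v * (u * U + v * B) + u * u * B - 2 * u * v * ((2 * J + 1) * U + v * A)).
split; last by rewrite Hk; exists (- (u * U + v * (k * v)) + u * u * k - 2 * u * ((2 * J + 1) * U + v * A)); ring.
by rewrite Hk; congr (_, _); ring.
Qed.

End PowerDescent.

(** * If p does not divide w, a power of 2 is 1 modulo q^(e+1) *)

Section ExponentConstraints.
Local Open Scope Z_scope.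

Lemma coprime_sum_squares a b : Z.gcd a b = 1 -> Z.gcd b (a * a + b * b) = 1.
Proof.
move=> H; rewrite Z.gcd_add_mult_diag_r; apply: coprime_mul; by rewrite Z.gcd_comm.
Qed.

Lemma power_sum_squares m x :
  power_sum m x = x ^^ m * x ^^ m + (x + 1) ^^ m * (x + 1) ^^ m.
Proof. by rewrite /power_sum !pow_mull. Qed.

Lemma coprime_succ_pow m x : Z.gcd (x ^^ m) ((x + 1) ^^ m) = 1.
Proof. by apply: coprime_pow; apply: (coprime_bezout (-1) 1); ring. Qed.

Lemma power_sum_gauss_root m x y p : 1 <= x -> 0 < y -> (0 < p)%N ->
  power_sum m x = y ^^ p -> exists g B, [/\ qnorm 1 g = y, qnorm 1 B = 1 &
    qpow 1 g p = qmul 1 B (x ^^ m, (x + 1) ^^ m)].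
Proof.
move=> Hx Hy Hp E; apply: gauss_root => //; cbn [fst snd].
  have : Z.gcd ((x + 1) ^^ m) (y ^^ p) = 1.
    by rewrite -E power_sum_squares; apply/coprime_sum_squares/coprime_succ_pow.
  rewrite Z.gcd_comm => H; rewrite Z.gcd_comm; apply: coprime_dvd_l H.
  by case: (p) Hp => // n _; rewrite powS; apply: Z.divide_factor_l.
by rewrite -E power_sum_squares /qnorm; cbn [fst snd]; ring.
Qed.

Lemma gauss_unit_mul B a b : qnorm 1 B = 1 -> exists s t, [/\ s = 1 \/ s = -1, t = 1 \/ t = -1 &
  qmul 1 B (a, b) = (s * a, t * b) \/ qmul 1 B (a, b) = (s * b, t * a)].
Proof.
move=> /gauss_unit [|[|[|]]] ->; rewrite /qmul; cbn [fst snd].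
- by exists 1, 1; split; [left|left|left; congr (_, _); ring].
- by exists (-1), (-1); split; [right|right|left; congr (_, _); ring].
- by exists (-1), 1; split; [right|left|right; congr (_, _); ring].
- by exists 1, (-1); split; [left|right|right; congr (_, _); ring].
Qed.

(** As p does not divide X, u is prime to p and hence to [A], which is pV modulo u up to sign. Their
    product is an m-th power up to sign, so u is one too. *)
Lemma abs_pow_factor u A X m s p k V : prime p -> (0 < m)%N -> 0 < X -> s = 1 \/ s = -1 ->
  u * A = s * X ^^ m -> Z.gcd u V = 1 -> ~ (Z.of_nat p | X) ->
  (u | A - k * Z.of_nat p * V) -> k = 1 \/ k = -1 ->
  exists r t, (t = 1 \/ t = -1) /\ u = t * r ^^ m.
Proof.
move=> pp m0 X0 Hs E gV npX Hu Hk.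
have XP := pow_pos X m X0.
have u0 : u <> 0 by move=> u0; rewrite u0 in E; case: Hs => Es; rewrite Es in E; lia.
have gp : Z.gcd u (Z.of_nat p) = 1.
  rewrite Z.gcd_comm; apply: prime_coprime_Z => // Hd; apply: npX.
  apply: (prime_dvd_pow _ _ m pp).
  have -> : X ^^ m = s * (u * A) by rewrite E; case: Hs => ->; ring.
  by apply: Z.divide_mul_r; apply: Z.divide_mul_l.
have gA : Z.gcd u A = 1.
  case: Hu => l Hl; have -> : A = k * Z.of_nat p * V + l * u by lia.
  rewrite Z.gcd_add_mult_diag_r -Z.mul_assoc; case: Hk => ->.
    by rewrite Z.mul_1_l; apply: coprime_mul.
  have -> : -1 * (Z.of_nat p * V) = - (Z.of_nat p * V) by ring.
  by rewrite Z.gcd_opp_r; apply: coprime_mul.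
have Habs : Z.abs u * Z.abs A = X ^^ m.
  by rewrite -Z.abs_mul E Z.abs_mul (Z.abs_eq (X ^^ m)); [case: Hs => ->; lia | lia].
have gabs : Z.gcd (Z.abs u) (Z.abs A) = 1 by rewrite Z.gcd_abs_l Z.gcd_abs_r.
have [r _ Er] := coprime_pow_factor _ _ _ _ (proj2 (Z.abs_pos u) u0) X0 m0 gabs Habs.
exists r; case: (Z_le_gt_dec 0 u) => Eu; first by exists 1; split; [left | lia].
by exists (-1); split; [right | lia].
Qed.

(** The parts of the root u + vi are r1^m and r2^m up to sign, with m = q^e. From q | y = r1^(2m) +
    r2^(2m) one gets r1^2 = -r2^2 modulo q, and raising to the power m lifts this to q^(e+1) | y.
    Modulo this divisor of the norm the p-th power of u + vi is (2u)^(p-1) times itself. Comparing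
    real parts and raising to the power q - 1 turns every m-th power prime to q into 1, which leaves
    the power of 2. *)
Lemma two_power_cong q e p x y : prime q -> odd q -> prime p -> odd p -> 1 <= x -> 0 < y ->
  (Z.of_nat q | power_sum 1 x) -> power_sum (q ^ e) x = y ^^ p ->
  ~ (Z.of_nat p | x * (x + 1)) ->
  cong (Z.of_nat q ^^ e.+1) ((2 ^^ q.-1) ^^ p.-1) 1.
Proof.
move=> pq oq pp po Hx Hy qS Ey npw.
have Eq : q.-1 = (2 * q./2)%N by clear -oq pq; have := prime_gt1 pq; lia.
set m := (q ^ e)%N in Ey.
have m0 : (0 < m)%N by rewrite expn_gt0 prime_gt0.
have p0 := prime_gt0 pp.
have [[u v] [B [ng nB EP]]] := power_sum_gauss_root m x y p Hx Hy p0 Ey.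
have [s [t [Hs Ht HX]]] := gauss_unit_mul B (x ^^ m) ((x + 1) ^^ m) nB.
rewrite -EP in HX.
have npx : ~ (Z.of_nat p | x) by move=> H; apply: npw; apply: Z.divide_mul_l.
have npx1 : ~ (Z.of_nat p | x + 1) by move=> H; apply: npw; apply: Z.divide_mul_r.
have nqX : ~ (Z.of_nat q | x) /\ ~ (Z.of_nat q | x + 1).
  have G := coprime_succ_squares x 1 1; rewrite !powS !Z.mul_1_r in G.
  rewrite power_sum1 in qS.
  have q1 : ~ (Z.of_nat q | 1) by move=> /Z.divide_1_r_nonneg; have := prime_gt1 pq; lia.
  split=> H; apply: q1; rewrite -G; apply: Z.gcd_greatest.
  - exact: Z.divide_mul_l.
  - have -> : (x + 1) * (x + 1) = x * x + (x + 1) * (x + 1) - x * x by ring.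
    by apply: Z.divide_sub_r => //; apply: Z.divide_mul_l.
  - have -> : x * x = x * x + (x + 1) * (x + 1) - (x + 1) * (x + 1) by ring.
    by apply: Z.divide_sub_r => //; apply: Z.divide_mul_l.
  - exact: Z.divide_mul_l.
have [X [X' [HX1 HX'1 [npX npX' nqX1 gX EPX]]]] : exists X X', [/\ 0 < X, 0 < X' &
    [/\ ~ (Z.of_nat p | X), ~ (Z.of_nat p | X'), ~ (Z.of_nat q | X),
       Z.gcd (X ^^ m) (X' ^^ m) = 1 &
       qpow 1 (u, v) p = (s * X ^^ m, t * X' ^^ m)]].
  have G := coprime_succ_pow m x; have G' := G; rewrite Z.gcd_comm in G'.
  by case: nqX HX => n1 n2 [E|E]; [exists x, (x + 1) | exists (x + 1), x]; split=> //; lia.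
have Ep : p = (2 * p./2 + 1)%N by lia.
have EpZ : 2 * Z.of_nat p./2 + 1 = Z.of_nat p by lia.
have [s1 Hs1 [A1 [B1 [E1 _]]]] := gauss_pow_real_part u v p./2.
have [A2 [B2 [E2 _]]] := gauss_pow_imag_part u v p./2.
rewrite -Ep EPX EpZ in E1; rewrite -Ep EPX EpZ in E2.
case: E1 => E1 _; case: E2 => _ E2.
have guv : Z.gcd u v = 1.
  have H : (Z.gcd u v | 1).
    rewrite -gX; apply: Z.gcd_greatest.
      have -> : X ^^ m = s * (s * X ^^ m) by case: Hs => ->; ring.
      by rewrite E1; apply: Z.divide_mul_r; apply: Z.divide_mul_l; apply: Z.gcd_divide_l.
    have -> : X' ^^ m = t * (t * X' ^^ m) by case: Ht => ->; ring.
    by rewrite E2; apply: Z.divide_mul_r; apply: Z.divide_mul_l; apply: Z.gcd_divide_r.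
  exact: Z.divide_1_r_nonneg (Z.gcd_nonneg _ _) H.
have gvu : Z.gcd v u = 1 by rewrite Z.gcd_comm.
have [r1 [t1 [Ht1 Eu]]] : exists r t, (t = 1 \/ t = -1) /\ u = t * r ^^ m.
  apply: (abs_pow_factor u _ X m s p s1 (v ^^ (2 * p./2)) pp m0 HX1 Hs (esym E1)) => //.
    exact: coprime_pow_r.
  by exists A1; ring.
have [r2 [t2 [Ht2 Ev]]] : exists r t, (t = 1 \/ t = -1) /\ v = t * r ^^ m.
  apply: (abs_pow_factor v _ X' m t p 1 (u ^^ (2 * p./2)) pp m0 HX'1 Ht (esym E2)) => //.
  - exact: coprime_pow_r.
  - by exists A2; ring.
  - by left.
move: ng; rewrite /qnorm; cbn [fst snd] => ng.
have om : odd m by rewrite oddX oq orbT.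
have qy : (Z.of_nat q | y).
  apply: (prime_dvd_pow _ _ p pq); rewrite -Ey.
  have [W _ [EW _]] := power_sum_factor 1 m x om Hx.
  by rewrite mul1n in EW; rewrite EW; apply: Z.divide_mul_l.
have Ey2 : y = (r1 * r1) ^^ m + (r2 * r2) ^^ m.
  by rewrite -ng Eu Ev !pow_mull; case: Ht1 => ->; case: Ht2 => ->; ring.
have oppm b : (- b) ^^ m = - b ^^ m.
  by have -> : - b = -1 * b by [ring]; rewrite pow_mull pow_m1_odd //; ring.
have Hab : cong (Z.of_nat q) (r1 * r1) (- (r2 * r2)).
  apply: cong_trans (cong_sym _ _ _ (fermat_iter q _ e pq)) _.
  apply: cong_trans _ (fermat_iter q _ e pq); rewrite -/m oppm.
  by case: qy => k Hk; exists k; rewrite -Hk Ey2; ring.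
have HN : (Z.of_nat q ^^ e.+1 | y).
  have [k Hk] := cong_lift_iter q _ _ e (prime_gt0 pq) Hab.
  by exists k; rewrite -Hk -/m oppm Ey2; ring.
have HN' : (Z.of_nat q ^^ e.+1 | qnorm 1 (u, v)).
  by move: HN; rewrite -ng /qnorm; cbn [fst snd].
have [HP _] := qpow_norm_mod _ 1 (u, v) p.-1 HN'.
rewrite (prednK p0) EPX in HP; cbn [fst snd] in HP.
have unit_pow b : b = 1 \/ b = -1 -> b ^^ q.-1 = 1.
  by rewrite Eq powM => -[] ->; rewrite !powS Z.pow_0_r !Z.mul_1_r ?pow1n.
have nqr : ~ (Z.of_nat q | r1).
  move=> H; have Hu : (Z.of_nat q | u).
    by rewrite Eu -(prednK m0) powS; apply: Z.divide_mul_r; apply: Z.divide_mul_l.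
  have Hv : (Z.of_nat q | v).
    suff : (Z.of_nat q | v * v) by move/(prime_dvd_mul _ _ _ pq) => [].
    have -> : v * v = y - u * u by rewrite -ng; ring.
    by apply: Z.divide_sub_r => //; apply: Z.divide_mul_l.
  have : (Z.of_nat q | 1) by rewrite -guv; apply: Z.gcd_greatest.
  by move=> /Z.divide_1_r_nonneg H1; move: (H1 (Nat2Z.is_nonneg q)); have := prime_gt1 pq; clear; lia.
have HP2 := cong_pow _ _ _ q.-1 HP.
have EX : (s * X ^^ m) ^^ q.-1 = (X ^^ q.-1) ^^ m.
  by rewrite pow_mull unit_pow // -!powM (mulnC m) Z.mul_1_l.
have EU : ((2 * u) ^^ p.-1 * u) ^^ q.-1 = (2 ^^ q.-1) ^^ p.-1 * ((r1 ^^ q.-1) ^^ m) ^^ p.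
  have -> : (2 * u) ^^ p.-1 * u = 2 ^^ p.-1 * u ^^ p.
    have -> : u ^^ p = u * u ^^ p.-1 by rewrite -powS (prednK p0).
    by rewrite pow_mull; ring.
  rewrite pow_mull; congr (_ * _); first by rewrite -!powM mulnC.
  by rewrite -(powM u) mulnC powM Eu pow_mull unit_pow // Z.mul_1_l -(powM r1) (mulnC m) powM.
rewrite EX EU in HP2.
apply: cong_sym; apply: cong_trans (cong_sym _ _ _ (euler_Z q X e pq nqX1)) _.
apply: cong_trans HP2 _; rewrite -{2}(Z.mul_1_r ((2 ^^ q.-1) ^^ p.-1)).
apply: cong_mul; first exact: cong_refl.
by rewrite -(pow1n p); apply: cong_pow; apply: euler_Z.
Qed.

End ExponentConstraints.

(** * The case p | w, and exclusion of single exponents modulo l = hp + 1 *)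

Section Sieve.
Local Open Scope Z_scope.

(* The factor 1 + e(q-1) comes from eliminating x between q^e S = z^p and
   q c^p = S^(q-1) mod p^2. *)
Lemma wieferich_cong q e p x z c R W2 : prime q -> prime p ->
  (Z.of_nat q | power_sum 1 x) -> power_sum 1 x * Z.of_nat q ^^ e = z ^^ p ->
  sum_quotient q = [:: 1, 2 * Z.of_nat q.-1 & W2] ->
  peval (sum_quotient q) (x * (x + 1)) = Z.of_nat q * R -> R = c ^^ p ->
  (Z.of_nat p | x * (x + 1)) ->
  cong (Z.of_nat p * Z.of_nat p) ((Z.of_nat q ^^ (1 + e * q.-1)) ^^ p.-1) 1.
Proof.
move=> pq pp qS Ez EW ER Ec [k Hk].
have p1 := prime_gt1 pp; have q1 := prime_gt1 pq; have p0 := prime_gt0 pp.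
set P := Z.of_nat p; set q' := Z.of_nat q in qS Ez ER Hk EW *.
set S := power_sum 1 x in qS Ez.
have ES : S = 1 + 2 * (k * P) by rewrite /S power_sum1 /P -Hk; ring.
have npS : ~ (P | S).
  move=> [l Hl]; have : (P | 1) by exists (l - 2 * k); rewrite ES in Hl; lia.
  by move=> /Z.divide_1_r_nonneg; lia.
have npq : ~ (P | q').
  move=> H; have H2 : (p %| q)%N by case: H => l Hl; apply/dvdnP; exists (Z.to_nat l); nia.
  by move: H2; rewrite dvdn_prime2 // => /eqP Epq; apply: npS; rewrite /P Epq.
have np1 a n : ~ (P | a) -> ~ (P | a ^^ n) by move=> H /(prime_dvd_pow _ _ _ pp).
have npz : ~ (P | z).
  move=> H; have : (P | S * q' ^^ e).
    by rewrite Ez -(prednK p0) powS; apply: Z.divide_mul_l.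
  by move/(prime_dvd_mul _ _ _ pp) => [|]; [exact: npS | exact: np1].
have EWc : cong (P * P) (q' * R) (S ^^ q.-1).
  rewrite -ER EW Hk; cbn [peval]; set T := peval W2 _.
  have Eq : q.-1 = q.-2.+1 by lia.
  have [u Hu] := pow_first_order 1 (2 * (k * P)) q.-2.
  rewrite ES Eq Hu !pow1n -Eq.
  by exists (k * k * T - 4 * k * k * u); rewrite -/P; ring.
have npc : ~ (P | c).
  move=> H; apply: (np1 S q.-1 npS); apply/cong0P.
  apply: cong_trans (cong_sym _ _ _ (cong_dvd _ _ _ _ _ EWc)) _.
    by apply: Z.divide_factor_l.
  apply/cong0P; apply: Z.divide_mul_r; rewrite Ec -(prednK p0) powS; exact: Z.divide_mul_l.
have lift a : ~ (P | a) -> cong (P * P) ((a ^^ p) ^^ p.-1) 1.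
  move=> Ha; rewrite -powM mulnC powM -(pow1n p); apply: cong_lift => //.
    exact: Z.divide_refl.
  exact: fermat_Z.
have E1 : cong (P * P) (q' ^^ (1 + e * q.-1) * c ^^ p) ((z ^^ q.-1) ^^ p).
  have -> : (z ^^ q.-1) ^^ p = q' ^^ (e * q.-1) * S ^^ q.-1.
    by rewrite -powM mulnC powM -Ez pow_mull -powM; ring.
  have -> : q' ^^ (1 + e * q.-1) * c ^^ p = q' ^^ (e * q.-1) * (q' * R).
    by rewrite powD powS Z.pow_0_r Ec; ring.
  by apply: cong_mul => //; apply: cong_refl.
have := cong_pow _ _ _ p.-1 E1; rewrite pow_mull => H.
have npzq : ~ (P | z ^^ q.-1) by apply: np1.
have H1 := cong_trans _ _ _ _ H (lift _ npzq).
apply: cong_trans H1.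
rewrite -{1}(Z.mul_1_r ((_ ^^ _) ^^ _)); apply: cong_mul; first exact: cong_refl.
by apply: cong_sym; apply: lift.
Qed.

(** By Euler's theorem the order of 2^(q-1) modulo q^(e+1) divides q^e; the hypothesis at q^(e-1)
    makes it equal to q^e. *)
Lemma exponent_congruence q e p : prime q -> prime p -> (0 < e)%N ->
  odd q -> 2 ^^ (q.-1 * q ^ e.-1) mod Z.of_nat q ^^ e.+1 <> 1 ->
  cong (Z.of_nat q ^^ e.+1) ((2 ^^ q.-1) ^^ p.-1) 1 -> (q ^ e %| p.-1)%N.
Proof.
move=> pq pp e0 oq Hne H.
have q1 := prime_gt1 pq.
have nq2 : ~ (Z.of_nat q | 2).
  by move=> /Z.divide_pos_le H2; have : Z.of_nat q <= 2 by [apply: H2]; lia.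
have G : Z.gcd (Z.of_nat q ^^ e.+1) (2 ^^ q.-1) = 1.
  by apply: coprime_pow; apply: prime_coprime_Z.
have N1 : 1 < Z.of_nat q ^^ e.+1.
  by rewrite powS; have := pow_pos (Z.of_nat q) e; nia.
have Hg := cong_pow_gcd _ _ _ _ G (euler_Z q 2 e pq nq2) H.
have /(dvdn_pfactor _ _ pq) [i ie Ei] : (gcdn (q ^ e) p.-1 %| q ^ e)%N by apply: dvdn_gcdl.
rewrite Ei in Hg.
have [Eie|nie] := eqVneq i e; first by rewrite -Eie -Ei dvdn_gcdr.
case: Hne.
have ie1 : (i <= e.-1)%N by lia.
have : cong (Z.of_nat q ^^ e.+1) (2 ^^ (q.-1 * q ^ e.-1)) 1.
  rewrite -(subnKC ie1) expnD mulnA powM powM -(pow1n (q ^ (e.-1 - i))).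
  exact: cong_pow.
by move/cong_modP => ->; [rewrite Z.mod_small; lia | lia].
Qed.

Definition pevalmod (p : seq Z) (w l : Z) : Z := foldr (fun a r => (a + w * r) mod l) 0 p.

Lemma pevalmodP p w l : 0 < l -> cong l (pevalmod [seq a mod l | a <- p] w l) (peval p w).
Proof.
move=> l0; elim: p => [|a p IH]; first exact: cong_refl.
apply: cong_trans (cong_mod _ _ l0) _; apply: cong_add; first exact: cong_mod.
by apply: cong_mul => //; apply: cong_refl.
Qed.

(* Primality of l = hp + 1 by Pocklington, with base 2. *)
Definition pocklington_check (p h : Z) : bool :=
  let l := h * p + 1 in
  [&& 0 <? h, h <=? p + 1, Zpow_mod 2 (h * p) l =? 1
    & Z.gcd (Zpow_mod 2 h l - 1) l =? 1].

(** Each t is a possible value of z^p modulo l, and the local x is the resulting w = (t / q^e - 1) /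
    2, where [iq] inverts q^e and (l + 1) / 2 inverts 2. It is excluded because 4w + 1 = (2x+1)^2
    would be a nonresidue, or because W_q(w) / q is neither 0 nor an h-th root of unity, hence not a
    p-th power. *)
Definition sieve_check (W : seq Z) (q e p h w : Z) : bool :=
  let l := h * p + 1 in
  let rs := powers l w (Z.to_nat h) in
  let W' := [seq a mod l | a <- W] in
  let iq := Zpow_mod q ((l - 2) * e) l in
  let qh := Zpow_mod q h l in
  [&& pocklington_check p h, Z.odd l, uniq rs, Zpow_mod w h l =? 1,
    (q ^ e * iq) mod l =? 1 &
    all (fun t => let x := ((t * iq - 1) * ((l + 1) / 2)) mod l in
      (Zpow_mod (4 * x + 1) ((l - 1) / 2) l =? l - 1) ||
      (let v := pevalmod W' x l in ~~ (v =? 0) && ~~ (Zpow_mod v h l =? qh)))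
      (0 :: rs)].

Lemma pocklington_checkP p h : prime p -> pocklington_check (Z.of_nat p) (Z.of_nat h) ->
  prime (h * p + 1).
Proof.
move=> pp /and4P [/Z.ltb_spec0 h0 /Z.leb_spec0 hp /Z.eqb_spec H2 /Z.eqb_spec Hg].
have p1 := prime_gt1 pp.
have l1 : 1 < Z.of_nat h * Z.of_nat p + 1 by nia.
have El : Z.of_nat h * Z.of_nat p + 1 = Z.of_nat (h * p + 1) by lia.
rewrite !Zpow_mod_correct in H2 Hg; try lia.
apply: (pocklington p h 2) => //; try lia.
  rewrite -El; apply/cong_modP; first by lia.
  by rewrite Nat2Z.inj_mul H2 Z.mod_small; lia.
rewrite -El; apply: etrans Hg.
have [k ->] : exists k, 2 ^^ h - 1 = 2 ^^ h mod (Z.of_nat h * Z.of_nat p + 1) - 1 + k * (Z.of_nat h * Z.of_nat p + 1).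
  exists (2 ^^ h / (Z.of_nat h * Z.of_nat p + 1)).
  have := Z.div_mod (2 ^^ h) (Z.of_nat h * Z.of_nat p + 1); lia.
by rewrite Z.gcd_comm Z.gcd_add_mult_diag_r Z.gcd_comm.
Qed.

Lemma pevalmod_range p w l : 0 < l -> 0 <= pevalmod p w l < l.
Proof. by case: p => [|a p] l0; [rewrite /=; lia | apply: Z.mod_pos_bound]. Qed.

Lemma sieve_checkP q e p h w x z c R : prime p ->
  sieve_check (sum_quotient q) (Z.of_nat q) (Z.of_nat e) (Z.of_nat p) (Z.of_nat h) w ->
  power_sum 1 x * Z.of_nat q ^^ e = z ^^ p ->
  peval (sum_quotient q) (x * (x + 1)) = Z.of_nat q * R -> R = c ^^ p -> False.
Proof.
move=> pp /and5P [Hpk Lodd uq /Z.eqb_spec Hw /andP [/Z.eqb_spec Hiq /allP Hall]] Ez ER Ec.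
have pl := pocklington_checkP p h pp Hpk.
have h0 : (0 < h)%N by case/and4P: Hpk => /Z.ltb_spec0; lia.
have p0 := prime_gt0 pp.
set l := (h * p + 1)%N in pl.
have El : Z.of_nat h * Z.of_nat p + 1 = Z.of_nat l by rewrite /l; lia.
rewrite El Nat2Z.id in uq; rewrite !El Nat2Z.id in Hall; rewrite !El in Hiq Hw Lodd.
have l1 := prime_gt1 pl; have L1 : 1 < Z.of_nat l by lia.
have L0 : 0 < Z.of_nat l by lia.
set L := Z.of_nat l in El Lodd uq Hw Hiq Hall L1 L0.
have pm a n : 0 <= n -> Zpow_mod a n L = a ^ n mod L by move=> ?; apply: Zpow_mod_correct; lia.
rewrite pm in Hw; last by lia.
have Hw1 : cong L (w ^^ h) 1 by apply/cong_modP => //; rewrite Hw Z.mod_small; lia.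
have El' : l = (h * p + 1)%N by [].
have [r Hr Er] := power_residue l p h w z pl El' h0 p0 uq Hw1.
have := Hall r Hr; set iq := Zpow_mod _ _ _ in Hiq *; set x' := (_ mod L).
have Hiq1 : cong L (Z.of_nat q ^^ e * iq) 1.
  by apply/cong_modP => //; rewrite Hiq Z.mod_small; lia.
have [o Eo] : exists o, L = 2 * o + 1 by have /Z.odd_spec := Lodd.
have Eh : (L + 1) / 2 = o + 1.
  by rewrite Eo (_ : 2 * o + 1 + 1 = (o + 1) * 2) ?Z.div_mul //; ring.
have Hx : cong L x' (x * (x + 1)).
  apply: cong_trans (cong_mod _ _ L0) _; rewrite Eh.
  have C1 : cong L (r * iq) (power_sum 1 x).
    apply: cong_trans (cong_mul _ _ _ _ _ (cong_sym _ _ _ Er) (cong_refl _ iq)) _.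
    rewrite -Ez -Z.mul_assoc -{2}(Z.mul_1_r (power_sum 1 x)).
    by apply: cong_mul => //; apply: cong_refl.
  case: C1 => k Hk; rewrite power_sum1 in Hk.
  exists (k * (o + 1) + x * (x + 1)).
  transitivity ((r * iq - (x * x + (x + 1) * (x + 1))) * (o + 1) + x * (x + 1) * (2 * o + 1)); first ring.
  by rewrite Hk -Eo; ring.
move=> /orP [/Z.eqb_spec H|/andP [/negP v0 /negP vh]].
  have EL2 : (L - 1) / 2 = Z.of_nat l./2.
    by rewrite Eo (_ : 2 * o + 1 - 1 = o * 2) ?Z.div_mul //; lia.
  rewrite EL2 pm in H; last by lia.
  have C : cong L (((2 * x + 1) * (2 * x + 1)) ^^ l./2) (-1).
    apply: (cong_trans _ _ ((4 * x' + 1) ^^ l./2)).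
      apply: cong_pow; apply: cong_sym.
      by case: Hx => k Hk; exists (4 * k); lia.
    apply: cong_trans (cong_sym _ _ _ (cong_mod _ _ L0)) _; rewrite H.
    by exists 1; lia.
  rewrite pow_mull -powD addnn in C.
  have El2 : l./2.*2 = l.-1 by lia.
  rewrite El2 in C.
  case: (Znumtheory.Zdivide_dec L (2 * x + 1)) => HX.
    have D1 : (L | 1).
      have HX2 : (L | (2 * x + 1) ^^ l.-1).
        have l2 : (0 < l.-1)%N by lia.
        by rewrite -(prednK l2) powS; apply: Z.divide_mul_l.
      have -> : 1 = (2 * x + 1) ^^ l.-1 - -1 - (2 * x + 1) ^^ l.-1 by ring.
      exact: Z.divide_sub_r.
    by have := Z.divide_pos_le _ _ Z.lt_0_1 D1; clear -L1; lia.
  have D2 : (L | 2) := cong_trans _ _ _ _ (cong_sym _ _ _ (fermat_Z l _ pl HX)) C.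
  by have := Z.divide_pos_le _ _ Z.lt_0_2 D2; clear -L1 Eo; lia.
have Hv : cong L (pevalmod [seq a mod L | a <- sum_quotient q] x' L) (Z.of_nat q * R).
  by rewrite -ER; apply: cong_trans (pevalmodP _ _ _ L0) _; apply: peval_cong.
have Hrange := pevalmod_range [seq a mod L | a <- sum_quotient q] x' L L0.
set v := pevalmod _ _ _ in v0 vh Hv Hrange.
have nLc : ~ (L | c).
  move=> H; apply: v0; apply/Z.eqb_spec.
  have HR : (L | R) by rewrite Ec -(prednK p0) powS; apply: Z.divide_mul_l.
  have : (L | v).
    have -> : v = (v - Z.of_nat q * R) + Z.of_nat q * R by ring.
    by apply: Z.divide_add_r => //; apply: Z.divide_mul_r.
  move=> D; case: (Z_le_gt_dec v 0) => V0; first by clear -V0 Hrange; lia.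
  by have := Z.divide_pos_le _ _ (Z.gt_lt _ _ V0) D; clear -Hrange; lia.
apply: vh; apply/Z.eqb_spec; rewrite !pm; try lia.
apply/cong_modP => //; apply: cong_trans (cong_pow _ _ _ h Hv) _.
rewrite pow_mull -{2}(Z.mul_1_r (Z.of_nat q ^^ h)); apply: cong_mul; first exact: cong_refl.
rewrite Ec -powM mulnC; have := fermat_Z l c pl nLc.
by rewrite (_ : l.-1 = h * p)%N //; rewrite /l; lia.
Qed.

End Sieve.

(** * Exponents below the bound: tables and local obstructions *)

Section SmallExponents.
Local Open Scope Z_scope.

(* About 5.12 (m^2 + (q-1)^2) with m = q^e, as [exponent_inequality] requires. *)
Definition exponent_bound (q e : nat) : Z :=
  if q == 5%N then if e == 1%N then 230 else 3300 else if q == 13%N then 1620 else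
  if q == 17%N then 2800 else if q == 29%N then 8330 else if q == 37%N then 13650 else 16800.

(* Triples (p, h, w): l = hp + 1 is prime and w has order h modulo l. *)
Definition sieve_table (q e : nat) : seq (Z * Z * Z) :=
  if q == 5%N then if e == 1%N then [::
    (11, 2, 22); (31, 10, 305); (41, 18, 542); (61, 6, 284); (71, 8, 277);
    (101, 6, 211); (131, 2, 262); (151, 6, 385); (181, 6, 830); (191, 12, 2180);
    (211, 10, 2036)]
  else [::
    (101, 6, 211); (151, 6, 385); (251, 2, 502); (401, 8, 22); (601, 6, 1400);
    (701, 18, 11415); (751, 6, 3716); (1051, 12, 11079); (1151, 6, 5051);
    (1201, 6, 5369); (1301, 20, 19703); (1451, 2, 2902); (1601, 2, 3202);
    (1801, 12, 7761); (1901, 2, 3802); (1951, 22, 33820); (2251, 10, 22195);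
    (2351, 2, 4702); (2551, 6, 10760); (2801, 8, 5684); (2851, 6, 10310);
    (3001, 10, 6388); (3251, 6, 15680)]
  else if q == 13%N then [::
    (53, 2, 106); (79, 4, 203); (131, 2, 262); (157, 10, 950); (313, 6, 1391);
    (443, 2, 886); (521, 32, 4368); (547, 10, 1868); (599, 8, 3420); (677, 8, 979);
    (859, 22, 5238); (863, 6, 1498); (911, 2, 1822); (937, 6, 2014); (1093, 4, 1904);
    (1171, 6, 6504); (1223, 2, 2446); (1249, 10, 12192); (1301, 20, 19703);
    (1327, 4, 1804); (1483, 10, 11373); (1613, 6, 2914)]
  else if q == 17%N then [::
    (3, 2, 6); (103, 6, 367); (137, 6, 649); (239, 2, 478); (307, 4, 632);
    (409, 4, 316); (443, 2, 886); (613, 10, 5472); (647, 14, 7332); (919, 4, 1309);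
    (953, 2, 1906); (1021, 10, 1969); (1123, 4, 2280); (1259, 14, 11541);
    (1327, 4, 1804); (1361, 6, 3093); (1429, 4, 3301); (1531, 6, 4122);
    (1667, 8, 4831); (1871, 8, 3847); (1973, 2, 3946); (2143, 4, 6378);
    (2347, 6, 2776); (2381, 12, 567); (2551, 6, 10760); (2687, 14, 16037);
    (2789, 12, 4966)]
  else if q == 29%N then [::
    (59, 12, 187); (233, 2, 466); (349, 10, 2968); (523, 12, 1096); (929, 8, 146);
    (1103, 2, 2206); (1277, 20, 6719); (1451, 2, 2902); (1567, 4, 1523);
    (1741, 22, 37400); (1973, 2, 3946); (2089, 22, 39059); (2437, 4, 9393);
    (2843, 32, 30492); (3191, 30, 52287); (3307, 4, 6672); (3539, 2, 7078);
    (4003, 6, 18757); (4177, 10, 9518); (4409, 2, 8818); (4583, 26, 43363);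
    (4931, 6, 14708); (5279, 2, 10558); (5569, 4, 17242); (5743, 4, 12134);
    (5801, 6, 24206); (6091, 18, 105236); (6323, 2, 12646); (6961, 18, 81679);
    (7019, 12, 27651); (7193, 2, 14386); (7309, 10, 30369); (7541, 2, 15082);
    (8179, 4, 11332); (8237, 14, 49933)]
  else if q == 37%N then [::
    (3, 2, 6); (149, 8, 524); (223, 12, 1501); (593, 2, 1186); (1259, 14, 11541);
    (1481, 2, 2962); (1777, 4, 304); (1999, 10, 14636); (2221, 6, 3143);
    (2591, 18, 30686); (2887, 4, 8095); (3109, 4, 9110); (3257, 6, 12324);
    (3331, 10, 5925); (3701, 20, 73114); (3923, 6, 18087); (4219, 40, 48266);
    (4441, 6, 20805); (4663, 16, 6467); (5107, 6, 11587); (5477, 14, 53044);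
    (6143, 20, 39388); (6217, 10, 59553); (6661, 22, 4500); (6883, 6, 39298);
    (7253, 12, 33197); (7549, 4, 15799); (7919, 8, 32532); (7993, 4, 3772);
    (8363, 12, 2603); (8807, 8, 63226); (9029, 2, 18058); (9103, 34, 265205);
    (9473, 2, 18946); (9547, 4, 2658); (9769, 18, 114148); (10139, 18, 73291);
    (10657, 18, 8944); (11027, 26, 106579); (11471, 2, 22942); (12211, 18, 118786);
    (12433, 12, 47321); (13099, 12, 79717); (13469, 50, 269190)]
  else [::
    (29, 2, 58); (83, 2, 166); (739, 4, 1222); (821, 8, 736); (1231, 16, 9327);
    (1559, 2, 3118); (1723, 10, 1749); (2297, 14, 27998); (2543, 2, 5086);
    (2707, 16, 22972); (2789, 12, 4966); (2953, 4, 3014); (3527, 6, 16826);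
    (3691, 6, 8605); (4019, 2, 8038); (5003, 2, 10006); (5167, 36, 80762);
    (5413, 6, 8787); (5659, 4, 18662); (5741, 2, 11482); (5987, 6, 29471);
    (6151, 10, 26795); (6397, 4, 22512); (6971, 12, 21210); (7873, 12, 28216);
    (8447, 6, 33148); (8693, 2, 17386); (9103, 34, 265205); (9349, 4, 1991);
    (9431, 12, 13893); (9677, 8, 32893); (9923, 6, 29648); (10169, 8, 70271);
    (10333, 4, 16165); (11071, 10, 41870); (11317, 10, 51067); (11399, 8, 72982);
    (12301, 12, 93862); (12547, 10, 89142); (13121, 32, 99960); (13367, 8, 1054);
    (13613, 14, 10711); (13859, 14, 137854); (14843, 12, 105304); (15581, 6, 16950);
    (15991, 6, 83331); (16073, 12, 157208); (16319, 8, 17922); (16729, 18, 242282)].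

Definition parameters : seq (nat * nat) :=
  [:: (5, 1); (5, 2); (13, 1); (17, 1); (29, 1); (37, 1); (41, 1)]%N.

Fixpoint all_steps (f : Z -> bool) (a s : Z) (n : nat) : bool :=
  if n is n'.+1 then f a && all_steps f (a + s) s n' else true.

Lemma all_stepsP f a s n k : all_steps f a s n -> (k < n)%N -> f (a + Z.of_nat k * s).
Proof.
elim: n a k => [//|n IH] a [|k] /= /andP [Ha Hn] kn.
  by rewrite (_ : a + Z.of_nat 0 * s = a) //; lia.
rewrite (_ : a + Z.of_nat k.+1 * s = a + s + Z.of_nat k * s); last by lia.
exact: IH.
Qed.

Definition small_divisor (ds : seq Z) (P : Z) : bool :=
  has (fun d => (d <? P) && (P mod d =? 0)) ds.

Lemma small_divisorP ds p : all (fun d => 1 <? d) ds -> prime p ->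
  ~~ small_divisor ds (Z.of_nat p).
Proof.
move=> /allP Hds pp; apply/hasPn => d /Hds /Z.ltb_spec0 d1; apply/negP => /andP [/Z.ltb_spec0 dp].
move=> /Z.eqb_spec /Z.mod_divide Hd.
have d0 : d <> 0 by lia.
have [k Hk] := Hd d0.
have /primeP [_ H] := pp.
have : (Z.to_nat d %| p)%N by apply/dvdnP; exists (Z.to_nat k); nia.
by move/H; lia.
Qed.

(* q^n modulo p^2, written in base p. *)
Fixpoint pow_base (q p : Z) (n : positive) : Z * Z :=
  match n with
  | xH => let: (b, a) := Z.div_eucl q p in (a, b)
  | xO n' => let: (a, b) := pow_base q p n' in let: (c, a') := Z.div_eucl (a * a) p in
      (a', (2 * (a * b) + c) mod p)
  | xI n' => let: (a, b) := pow_base q p n' in let: (c, a') := Z.div_eucl (a * a) p in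
      let: (c', a'') := Z.div_eucl (q * a') p in (a'', (q * ((2 * (a * b) + c) mod p) + c') mod p)
  end.

(** The divisors up to 23 spare most composite P the computation of a power. The pair e = 2, P = 3
    is set apart because the exponent 1 + e(q-1) = 9 of [wieferich_cong] is divisible by 3. *)
Definition wieferich_ok (q e : nat) (P : Z) : bool :=
  [|| small_divisor [:: 3; 5; 7; 11; 13; 17; 19; 23] P,
      (let: (a, b) := pow_base (Z.of_nat q) P (Z.to_pos (P - 1)) in ~~ ((a =? 1) && (b mod P =? 0))),
      has (fun t => t.1.1 =? P) (sieve_table q e) | (e == 2%N) && (P =? 3)].

(** All primes up to the square root of 16800, the largest bound, are in the list, so only primes P
    reach the table. *)
Definition progression_ok (q e : nat) (P : Z) : bool :=
  small_divisor [:: 3; 5; 7; 11; 13; 17; 19; 23; 29; 31; 37; 41; 43; 47; 53; 59; 61; 67; 71;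
    73; 79; 83; 89; 97; 101; 103; 107; 109; 113; 127] P ||
  has (fun t => t.1.1 =? P) (sieve_table q e).

Definition parameters_ok (u : nat * nat) : bool :=
  let: (q, e) := u in let qe := Z.of_nat (q ^ e) in
  [&& all_steps (wieferich_ok q e) 3 2 (Z.to_nat (exponent_bound q e / 2)),
    all_steps (progression_ok q e) (1 + 2 * qe) (2 * qe)
      (Z.to_nat ((exponent_bound q e - 2) / (2 * qe))) &
    let W := sum_quotient q in
    all (fun t => sieve_check W (Z.of_nat q) (Z.of_nat e) t.1.1 t.1.2 t.2) (sieve_table q e)].

Lemma parameters_okE : all parameters_ok parameters.
Proof. by vm_cast_no_check (erefl true). Qed.


Lemma pow_baseP q p n : 1 < p -> let: (a, b) := pow_base q p n in
  0 <= a < p /\ cong (p * p) (a + b * p) (q ^ Z.pos n).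
Proof.
move=> p1; elim: n => [n IH|n IH|]; cbn [pow_base].
- move: IH; case: (pow_base q p n) => a b [Ha [k Hk]].
  have := Z_div_mod (a * a) p; case: (Z.div_eucl (a * a) p) => c a' H1.
  have {H1} [|H1 H1'] := H1; first by lia.
  have := Z_div_mod (q * a') p; case: (Z.div_eucl (q * a') p) => c' a'' H2.
  have {H2} [|H2 H2'] := H2; first by lia.
  split=> //; rewrite (Pos2Z.inj_xI n) Z.pow_add_r // Z.pow_1_r (Z.mul_comm 2 (Z.pos n)) Z.pow_mul_r // Z.pow_2_r.
  have := Z.div_mod (2 * (a * b) + c) p; set r := _ mod p; set d := _ / p => H3.
  have {H3} H3 := H3 ltac:(lia).
  have := Z.div_mod (q * r + c') p; set r' := _ mod p; set d' := _ / p => H4.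
  have {H4} H4 := H4 ltac:(lia).
  have Er' : r' = q * r + c' - p * d' by lia.
  have Er : r = 2 * (a * b) + c - p * d by lia.
  have Eq : q ^ Z.pos n = a + b * p - k * (p * p) by lia.
  rewrite Eq Er' Er.
  have Ea2 : a'' = q * a' - p * c' by lia.
  have Ea1 : a' = a * a - p * c by lia.
  rewrite Ea2 Ea1.
  exists (- q * d - d' + 2 * q * k * (a + b * p) - q * b * b - q * k * k * p * p); ring.
- move: IH; case: (pow_base q p n) => a b [Ha [k Hk]].
  have := Z_div_mod (a * a) p; case: (Z.div_eucl (a * a) p) => c a' H1.
  have {H1} [|H1 H1'] := H1; first by lia.
  split=> //; rewrite (Pos2Z.inj_xO n) (Z.mul_comm 2 (Z.pos n)) Z.pow_mul_r // Z.pow_2_r.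
  have := Z.div_mod (2 * (a * b) + c) p; set r := _ mod p; set d := _ / p => H3.
  have {H3} H3 := H3 ltac:(lia).
  have Er : r = 2 * (a * b) + c - p * d by lia.
  have Eq : q ^ Z.pos n = a + b * p - k * (p * p) by lia.
  have Ea1 : a' = a * a - p * c by lia.
  rewrite Eq Er Ea1.
  exists (- d + 2 * k * (a + b * p) - b * b - k * k * p * p); ring.
- have := Z_div_mod q p; case: (Z.div_eucl q p) => b a H1.
  have {H1} [|H1 H1'] := H1; first by lia.
  by split=> //; rewrite Z.pow_1_r H1; exists 0; ring.
Qed.

Definition residues (l : nat) : seq Z := [seq Z.of_nat i | i <- iota 0 l].

Lemma residuesP l a : (0 < l)%N -> exists2 r, r \in residues l & cong (Z.of_nat l) a r.
Proof.
move=> l0; have L0 : 0 < Z.of_nat l by lia.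
exists (a mod Z.of_nat l); last by apply/cong_sym/cong_mod.
have H := Z.mod_pos_bound a _ L0.
by apply/mapP; exists (Z.to_nat (a mod Z.of_nat l)); [rewrite mem_iota | ]; lia.
Qed.

Definition residue_power (l n : nat) (u a : Z) : bool :=
  has (fun t => (u * t ^^ n - a) mod Z.of_nat l =? 0) (residues l).

Lemma residue_powerP l n u a b z : (0 < l)%N -> cong (Z.of_nat l) b a -> b = u * z ^^ n ->
  residue_power l n u a.
Proof.
move=> l0 H E; have [r Hr Er] := residuesP l z l0.
apply/hasP; exists r => //; apply/Z.eqb_spec/Z.mod_divide; first by lia.
apply: cong_trans H; apply: cong_sym; rewrite E; apply: cong_mul; first exact: cong_refl.
exact: cong_pow.
Qed.

Definition local_check (l n q e : nat) : bool :=
  let W := sum_quotient q in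
  all (fun x => ~~ [&& residue_power l n 1 (power_sum 1 x * Z.of_nat q ^^ e),
    residue_power l n (Z.of_nat q) (peval W (x * (x + 1))) &
    residue_power l n 1 (power_sum (q ^ e) x)]) (residues l).

Lemma power_sum_cong N m x x' : cong N x x' -> cong N (power_sum m x) (power_sum m x').
Proof.
move=> H; have H1 : cong N (x + 1) (x' + 1) by apply: cong_add => //; apply: cong_refl.
by apply: cong_add; apply: cong_pow; apply: cong_mul.
Qed.

Lemma local_checkP l n q e x y z c R : (0 < l)%N -> local_check l n q e ->
  power_sum 1 x * Z.of_nat q ^^ e = z ^^ n ->
  peval (sum_quotient q) (x * (x + 1)) = Z.of_nat q * R -> R = c ^^ n ->
  power_sum (q ^ e) x = y ^^ n -> False.
Proof.
move=> l0 /allP H Ez ER Ec Ey; have [r /H /negP Hr Er] := residuesP l x l0.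
have Er1 : cong (Z.of_nat l) (x + 1) (r + 1) by apply: cong_add => //; apply: cong_refl.
apply: Hr; apply/and3P; split.
- apply: (residue_powerP _ _ _ _ _ z l0 _ (etrans Ez (esym (Z.mul_1_l _)))).
  by apply: cong_mul; [apply: power_sum_cong | apply: cong_refl].
- rewrite Ec in ER; apply: (residue_powerP _ _ _ _ _ c l0 _ ER).
  by apply: peval_cong; apply: cong_mul.
- by apply: (residue_powerP _ _ _ _ _ y l0 _ (etrans Ey (esym (Z.mul_1_l _)))); apply: power_sum_cong.
Qed.

(** The fourth entry describes the exponent 1 + e(q-1) of [wieferich_cong]: it is q, or 9 for q = 5
    and e = 2. The next one is the condition of [exponent_congruence] on the order of 2^(q-1). The
    moduli 7, 16 and 3 exclude n = 4, and 7 excludes n = 3 for e = 2. *)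
Definition parameters_data (u : nat * nat) : bool :=
  let: (q, e) := u in
  [&& prime q, odd q, (0 < e)%N,
   (1 + e * q.-1 == q)%N || (e == 2%N) && (q == 5%N),
   ~~ (2 ^^ (q.-1 * q ^ e.-1) mod Z.of_nat q ^^ e.+1 =? 1),
   take 2 (sum_quotient q) == [:: 1; 2 * Z.of_nat q.-1],
   local_check (if q == 13 then 7 else if q == 37 then 16 else 3)%N 4 q e &
   (e == 2%N) ==> local_check 7 3 q e].

Lemma parameters_dataE : all parameters_data parameters.
Proof. by vm_compute. Qed.


Definition special_solution (n q e : nat) (x y z c R : Z) : Prop :=
  [/\ (q, e) \in parameters, 1 <= x /\ 0 < y, 0 < z /\ 0 < c,
    (Z.of_nat q | power_sum 1 x) /\ Z.gcd (Z.of_nat q) R = 1 &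
    [/\ power_sum 1 x * Z.of_nat q ^^ e = z ^^ n, R = c ^^ n,
      peval (sum_quotient q) (x * (x + 1)) = Z.of_nat q * R & power_sum (q ^ e) x = y ^^ n]].

Lemma special_solution_fourth_power q e x y z c R : ~ special_solution 4 q e x y z c R.
Proof.
case=> /(allP parameters_dataE) /and5P [_ _ _ _ /and4P [_ _ H _]] _ _ _ [Ez Ec ER Ey].
by apply: (local_checkP _ _ _ _ _ _ _ _ _ _ H Ez ER Ec Ey); case: (_ == _); last case: (_ == _).
Qed.

Lemma sieve_table_check q e p x y z c R : prime p -> special_solution p q e x y z c R ->
  has (fun t => t.1.1 =? Z.of_nat p) (sieve_table q e) -> False.
Proof.
move=> pp [/(allP parameters_okE) /and3P [_ _ /allP Hs] _ _ _ [Ez Ec ER _]] /hasP [[[P h] w]].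
move=> /Hs; cbn [fst snd] => H /Z.eqb_spec EP; rewrite EP in H.
have h0 : 0 < h by case/andP: H => /andP [/Z.ltb_spec0].
rewrite -(Z2Nat.id h) in H; last by lia.
exact: (sieve_checkP _ _ _ _ _ _ _ _ _ pp H Ez ER Ec).
Qed.

Lemma pow_base_test q p : (1 < p)%N -> cong (Z.of_nat p * Z.of_nat p) (Z.of_nat q ^^ p.-1) 1 ->
  let: (a, b) := pow_base (Z.of_nat q) (Z.of_nat p) (Z.to_pos (Z.of_nat p - 1)) in
  (a =? 1) && (b mod Z.of_nat p =? 0).
Proof.
move=> p1 H; have P1 : 1 < Z.of_nat p by lia.
have := pow_baseP (Z.of_nat q) (Z.of_nat p) (Z.to_pos (Z.of_nat p - 1)) P1.
case: pow_base => a b [Ha]; rewrite Z2Pos.id; last by lia.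
rewrite (_ : Z.of_nat p - 1 = Z.of_nat p.-1) => [H2|]; last by lia.
have {H2 H} [k Hk] := cong_trans _ _ _ _ H2 H.
have a1 : a = 1.
  have D : (Z.of_nat p | a - 1) by exists (k * Z.of_nat p - b); lia.
  case: (Z.eq_dec a 1) => // na; case: D => d Hd.
  have : d = 0 by clear -Hd Ha P1; nia.
  by move=> d0; rewrite d0 in Hd; lia.
apply/andP; split; apply/Z.eqb_spec => //; apply/Z.mod_divide; first by lia.
by exists k; rewrite a1 in Hk; clear -Hk P1; nia.
Qed.

Lemma special_solution_small_exponent p q e x y z c R : prime p -> odd p ->
  special_solution p q e x y z c R -> exponent_bound q e <= Z.of_nat p.
Proof.
move=> pp po H; case: (Z_lt_ge_dec (Z.of_nat p) (exponent_bound q e)) => [Hp|]; last by lia.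
exfalso; have Hsieve := sieve_table_check q e p x y z c R pp H.
have [Hpar [Hx Hy] _ [qS _] [Ez Ec ER Ey]] := H.
have /and5P [pq oq e0 He /and4P [/negP H2 /eqP Et _ /implyP Hl]] := allP parameters_dataE _ Hpar.
have /and3P [Hw Hpr _] := allP parameters_okE _ Hpar.
have p1 := prime_gt1 pp; have q1 := prime_gt1 pq.
have pge3 : (3 <= p)%N by clear -p1 po; lia.
case: (Znumtheory.Zdivide_dec (Z.of_nat p) (x * (x + 1))) => Hpw; last first.
  have C := two_power_cong q e p x y pq oq pp po Hx Hy qS Ey Hpw.
  have /dvdnP [k Hk] : (q ^ e %| p.-1)%N.
    apply: exponent_congruence C => // E; apply: H2; exact/Z.eqb_spec.
  have oqe : odd (q ^ e) by rewrite oddX oq orbT.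
  have ok : ~~ odd k.
    have : ~~ odd p.-1 by clear -po p1; lia.
    by rewrite Hk oddM oqe andbT.
  have k0 : (0 < k)%N by clear -Hk p1; lia.
  set Q := (q ^ e)%N in Hk Hpr.
  have EP : Z.of_nat p = 1 + 2 * Z.of_nat Q + Z.of_nat (k./2.-1) * (2 * Z.of_nat Q).
    (* Both p and q^e are odd, so p lies in the progression 1 + 2q^e, 1 + 4q^e, ... enumerated by
       [progression_ok]. *)
    have Ek : k = (2 * k./2.-1 + 2)%N by clear -ok k0; lia.
    have EpN : p = (k * Q + 1)%N by clear -Hk p1; lia.
    by rewrite {1}EpN {1}Ek; clear; lia.
  have Q0 : 0 < Z.of_nat Q by clear -Hk p1; nia.
  have kn : (k./2.-1 < Z.to_nat ((exponent_bound q e - 2) / (2 * Z.of_nat Q)))%N.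
    have : Z.of_nat k./2.-1 + 1 <= (exponent_bound q e - 2) / (2 * Z.of_nat Q).
      by apply: Z.div_le_lower_bound; clear -EP Hp Q0; lia.
    by move: (_ / _) => D; clear; lia.
  have := all_stepsP _ _ _ _ _ Hpr kn; rewrite -EP => /orP [|/Hsieve //].
  by apply/negP; apply: small_divisorP.
have C : cong (Z.of_nat p * Z.of_nat p) ((Z.of_nat q ^^ (1 + e * q.-1)) ^^ p.-1) 1.
  have [W2 EW] : exists W2, sum_quotient q = [:: 1, 2 * Z.of_nat q.-1 & W2].
    by move: Et; case: (sum_quotient q) => [|a [|b W2]] // [-> ->]; exists W2.
  exact: (wieferich_cong q e p x z c R W2 pq pp qS Ez EW ER Ec).
have npq : p != q.
  apply/eqP => Epq; rewrite -Epq in qS.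
  have : (Z.of_nat p | power_sum 1 x - 2 * (x * (x + 1))).
    by apply: Z.divide_sub_r => //; apply: Z.divide_mul_r.
  have -> : power_sum 1 x - 2 * (x * (x + 1)) = 1 by rewrite power_sum1; ring.
  by move=> /Z.divide_1_r_nonneg; clear -p1; lia.
case/boolP: ((e == 2%N) && (p == 3%N)) => [/andP [e2 /eqP Ep]|H23].
  rewrite Ep in Ez Ec Ey.
  exact: (local_checkP 7 3 q e x y z c R _ (Hl e2) Ez ER Ec Ey).
have G : Z.gcd (Z.of_nat p) (Z.of_nat q) = 1.
  apply: prime_coprime_Z => // [[l Hl']].
  have : (p %| q)%N by apply/dvdnP; exists (Z.to_nat l); clear -Hl' p1 q1; nia.
  by rewrite dvdn_prime2 // (negbTE npq).
have GN : coprime (1 + e * q.-1) p.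
  case/orP: He => [/eqP ->|/andP [/eqP e2 /eqP q5]].
    by rewrite prime_coprime // dvdn_prime2 // eq_sym.
  rewrite coprime_sym prime_coprime //; apply/negP; rewrite e2 q5 => D.
  have : (p %| 3 ^ 2)%N by [].
  by rewrite Euclid_dvdX // dvdn_prime2 // andbT => E3; move: H23; rewrite e2 E3.
have C1 : cong (Z.of_nat p * Z.of_nat p) (Z.of_nat q ^^ p.-1) 1.
  (* The exponent 1 + e(q-1) is prime to p, so it cancels against p(p-1), the order of the units
     modulo p^2. *)
  have -> : p.-1 = gcdn ((1 + e * q.-1) * p.-1) (p * p.-1).
    by rewrite -muln_gcdl (eqP GN) mul1n.
  apply: cong_pow_gcd.
  - by apply: gcd_mul1.
  - by rewrite powM.
  - rewrite mulnC powM.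
    have npq' : ~ (Z.of_nat p | Z.of_nat q).
      move=> D; have : (Z.of_nat p | 1) by rewrite -G; apply: Z.gcd_greatest => //; apply: Z.divide_refl.
      by move=> /Z.divide_1_r_nonneg; clear -p1; lia.
    have := euler_Z p (Z.of_nat q) 1 pp npq'.
    by rewrite !powS Z.pow_0_r Z.mul_1_r expn1.
have kn : (p./2.-1 < Z.to_nat (exponent_bound q e / 2))%N.
  have : Z.of_nat p./2.-1 + 1 <= exponent_bound q e / 2.
    by apply: Z.div_le_lower_bound; clear -Hp po pge3; lia.
  by move: (_ / _) => D; clear; lia.
have := all_stepsP _ _ _ _ _ Hw kn.
have -> : 3 + Z.of_nat p./2.-1 * 2 = Z.of_nat p by clear -po pge3; lia.
case/or4P.
- by apply/negP; apply: small_divisorP.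
- by have := pow_base_test q p p1 C1; case: pow_base => a b ->.
- exact: Hsieve.
- by move=> /andP [e2 /Z.eqb_spec P3]; move: H23; rewrite e2 (_ : p = 3%N) //; clear -P3; lia.
Qed.

End SmallExponents.

(** * Aurifeuille's identity and the p-th root in Z[sqrt(-q)] *)

Section Aurifeuille.
Local Open Scope Z_scope.

(* Aurifeuillian identity: sum_quotient q = C^2 + q (4w + 1) E^2. *)
Definition aurifeuille_C (q : nat) : seq Z :=
  if q == 5%N then [:: 1; 4; -1] else
  if q == 13%N then [:: 1; 12; 47; 56; -20; -16; -1] else
  if q == 17%N then [:: 1; 16; 95; 244; 185; -248; -384; -64; 1] else
  if q == 29%N then [:: 1; 28; 335; 2216; 8650; 18824; 13349; -39088; -121184; -147968; -87764;
    -20128; 782; 312; -1] else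
  if q == 37%N then [:: 1; 36; 575; 5344; 31718; 122920; 295397; 318712; -454173; -2477828;
    -4791085; -5400912; -3799568; -1667904; -448400; -71808; -6467; -268; -1]
  else [:: 1; 40; 719; 7644; 53043; 248160; 763724; 1303376; -264598; -8390416; -25479419;
    -44283164; -49905559; -36421360; -15850676; -2977776; 400245; 257192; 25201; -892; 1].

Definition aurifeuille_E (q : nat) : seq Z :=
  if q == 5%N then [:: 0; 1] else
  if q == 13%N then [:: 0; 1; 8; 18; 8; 1] else
  if q == 17%N then [:: 0; 1; 12; 52; 96; 64; 0; -2] else
  if q == 29%N then [:: 0; 1; 24; 248; 1440; 5135; 11504; 15756; 11792; 2812; -1824; -1112; -96;
    3] else
  if q == 37%N then [:: 0; 1; 32; 458; 3864; 21315; 80584; 212734; 391832; 494015; 408304;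
    202092; 46224; -2790; -3632; -614; -24; 1]
  else [:: 0; 1; 36; 588; 5760; 37676; 173264; 573882; 1376368; 2358469; 2765284; 1958230;
    405472; -644552; -678496; -285598; -49904; -341; 556; -4].

(** A constant K for which K W_q - q w (4w + 1) E^2 has no negative coefficient. As V = (2x+1) E,
    this gives w V^2 <= K R, so that V is small against sqrt R and the argument of V + U sqrt(-q) is
    close to an odd multiple of pi/2. *)
Definition aurifeuille_K (q : nat) : Z :=
  if q == 5%N then 20 else if q == 13%N then 52 else if q == 17%N then 272 else
  if q == 29%N then 1044 else if q == 37%N then 148 else 2624.

Definition aurifeuille_check (q : nat) : bool :=
  let C := aurifeuille_C q in let E := aurifeuille_E q in
  let T := pscale (Z.of_nat q) (pmul [:: 1; 4] (pmul E E)) in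
  (sum_quotient q == padd (pmul C C) T) &&
  all (fun a => 0 <=? a) (padd (pscale (aurifeuille_K q) (sum_quotient q)) (pscale (-1) (0 :: T))).

Lemma aurifeuille_checkE : all aurifeuille_check [:: 5; 13; 17; 29; 37; 41]%N.
Proof. by vm_compute. Qed.

Lemma peval_ge0 p w : 0 <= w -> all (fun a => 0 <=? a) p -> 0 <= peval p w.
Proof.
move=> w0; elim: p => [|a p IH] /=; first by lia.
by move=> /andP [/Z.leb_spec0 a0 /IH]; nia.
Qed.

Lemma aurifeuille q w : q \in [:: 5; 13; 17; 29; 37; 41]%N ->
  let C := peval (aurifeuille_C q) w in let E := peval (aurifeuille_E q) w in
  peval (sum_quotient q) w = C * C + Z.of_nat q * ((4 * w + 1) * (E * E)).
Proof.
move=> /(allP aurifeuille_checkE) /andP [/eqP -> _] C E.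
by rewrite peval_add peval_scale !peval_mul -/C -/E; cbn [peval]; ring.
Qed.

Lemma aurifeuille_bound q w : q \in [:: 5; 13; 17; 29; 37; 41]%N -> 0 <= w ->
  let E := peval (aurifeuille_E q) w in
  Z.of_nat q * (w * ((4 * w + 1) * (E * E))) <= aurifeuille_K q * peval (sum_quotient q) w.
Proof.
move=> /(allP aurifeuille_checkE) /andP [_ H] w0 E.
have := peval_ge0 _ w w0 H; rewrite peval_add !peval_scale; cbn [peval].
by rewrite peval_scale !peval_mul -/E; cbn [peval]; lia.
Qed.

Lemma coprime_of_primes a b :
  (forall r, prime r -> (Z.of_nat r | a) -> (Z.of_nat r | b) -> False) -> Z.gcd a b = 1.
Proof.
move=> H; have g0 := Z.gcd_nonneg a b.
have Ha := Z.gcd_divide_l a b; have Hb := Z.gcd_divide_r a b.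
have [g1|g1] := leqP (Z.to_nat (Z.gcd a b)) 1.
  case: (Z.eq_dec (Z.gcd a b) 1) => // ng.
  have gE : Z.gcd a b = 0 by lia.
  rewrite gE in Ha Hb.
  by case: (H 2%N) => //; apply: Z.divide_trans (_ : (0 | _)) => //; exists 0.
have D : (Z.of_nat (pdiv (Z.to_nat (Z.gcd a b))) | Z.gcd a b).
  have /dvdnP [k Hk] := pdiv_dvd (Z.to_nat (Z.gcd a b)).
  by exists (Z.of_nat k); lia.
case: (H (pdiv (Z.to_nat (Z.gcd a b)))).
- exact: pdiv_prime.
- exact: Z.divide_trans D Ha.
- exact: Z.divide_trans D Hb.
Qed.

Lemma power_sum_double m x : power_sum m x = x ^^ (2 * m) + (x + 1) ^^ (2 * m).
Proof. by rewrite /power_sum !pow_mull mul2n -addnn !powD. Qed.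

Lemma power_sum_odd m x : (0 < m)%N -> Z.odd (power_sum m x).
Proof.
move=> m0; rewrite /power_sum Z.odd_add !Z.odd_pow; try lia.
by rewrite !Z.odd_mul Z.odd_add /=; case: (Z.odd x).
Qed.

Lemma prime_dvd_odd r a : prime r -> Z.odd a -> (Z.of_nat r | a) -> ~ (Z.of_nat r | 2).
Proof.
move=> pr oa Ha H2; have r1 := prime_gt1 pr.
have r2 : (r = 2)%N by have := Z.divide_pos_le _ _ Z.lt_0_2 H2; lia.
by move: Ha oa; rewrite r2 => -[k ->]; rewrite Z.odd_mul andbF.
Qed.

Section Coprime.
Variables (q : nat) (x U R : Z).
Let w := x * (x + 1).
Let X := 2 * x + 1.
Let E := peval (aurifeuille_E q) w.
Hypotheses (Hq : q \in [:: 5; 13; 17; 29; 37; 41]%N)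
  (EU : peval (aurifeuille_C q) w = Z.of_nat q * U)
  (ER : peval (sum_quotient q) w = Z.of_nat q * R) (gR : Z.gcd (Z.of_nat q) R = 1).

Lemma aurifeuille_norm : R = X * E * (X * E) + Z.of_nat q * (U * U).
Proof.
have q0 : Z.of_nat q <> 0 by move: Hq; rewrite !inE => /or4P [| | |/or3P []] /eqP ->.
have := aurifeuille q w Hq; cbn zeta; rewrite ER EU -/E => H.
apply/(Z.mul_cancel_l _ _ _ q0); rewrite H /X /w; ring.
Qed.

(* A prime r dividing C and E at x divides them at x + r, so that r^2 divides
   F_q(x + r) - F_q(x) = 2 q r (x^(2q-1) + (x+1)^(2q-1)) mod r^2. *)
Lemma aurifeuille_coprime : Z.gcd U (X * E) = 1.
Proof.
apply: coprime_of_primes => r pr rU rV; set r' := Z.of_nat r in rU rV.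
have [pq oq] : prime q /\ odd q by move: Hq; rewrite !inE => /or4P [| | |/or3P []] /eqP ->.
have r1 := prime_gt1 pr; have q1 := prime_gt1 pq.
have n1 : ~ (r' | 1) by move=> /Z.divide_1_r_nonneg; rewrite /r'; lia.
have rR : (r' | R).
  by rewrite aurifeuille_norm; apply: Z.divide_add_r; [apply: Z.divide_mul_r | do 2! apply: Z.divide_mul_r].
have nq : ~ (r' | Z.of_nat q).
  by move=> H; apply: n1; rewrite -gR; apply: Z.gcd_greatest.
have EF : power_sum q x = power_sum 1 x * (Z.of_nat q * R) by rewrite -ER -sum_quotientE.
have rF : (r' | power_sum q x) by rewrite EF; do 2! apply: Z.divide_mul_r.
have n2 : ~ (r' | 2) by apply: prime_dvd_odd rF => //; apply: power_sum_odd; lia.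
have n0 : (r' | x) -> (r' | x + 1) -> False.
  by move=> H1 H2; apply: n1; rewrite (_ : 1 = x + 1 - x); [apply: Z.divide_sub_r | ring].
have q0 : Z.of_nat q <> 0 by lia.
case: (prime_dvd_mul _ _ _ pr rV) => [rX|rE].
  have rx : (r' | x).
    have C : cong r' ((x + 1) * (x + 1)) (x * x).
      by rewrite /cong (_ : _ - _ = X); [| rewrite /X; ring].
    have : (r' | 2 * (x * x) ^^ q).
      have -> : 2 * (x * x) ^^ q = power_sum q x - (((x + 1) * (x + 1)) ^^ q - (x * x) ^^ q).
        by rewrite /power_sum; ring.
      by apply: Z.divide_sub_r => //; apply: cong_pow.
    by move=> /(prime_dvd_mul _ _ _ pr) [//|/(prime_dvd_pow _ _ _ pr) /(prime_dvd_mul _ _ _ pr) []].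
  by apply: (n0 rx); rewrite (_ : x + 1 = X - x); [apply: Z.divide_sub_r | rewrite /X; ring].
set x' := x + r'.
have Cx : cong r' x' x by exists 1; rewrite /x'; ring.
have Cw : cong r' (x' * (x' + 1)) w.
  by apply: cong_mul => //; apply: cong_add => //; apply: cong_refl.
have sq a b : (r' | a) -> (r' | b) -> (r' * r' | a * b).
  by move=> [k ->] [l ->]; exists (k * l); ring.
have F' : (r' * r' | power_sum q x').
  rewrite sum_quotientE // aurifeuille //; apply: Z.divide_mul_r; apply: Z.divide_add_r.
    have H : (r' | peval (aurifeuille_C q) (x' * (x' + 1))).
      apply/cong0P; apply: cong_trans (peval_cong _ _ _ _ Cw) _; apply/cong0P.
      by rewrite EU; apply: Z.divide_mul_r.
    exact: sq.
  have H : (r' | peval (aurifeuille_E q) (x' * (x' + 1))).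
    by apply/cong0P; apply: cong_trans (peval_cong _ _ _ _ Cw) _; apply/cong0P.
  by do 2! apply: Z.divide_mul_r; apply: sq.
have FR : (r' * r' | power_sum q x).
  rewrite EF aurifeuille_norm; do 2! apply: Z.divide_mul_r; apply: Z.divide_add_r; first exact: sq.
  by apply: Z.divide_mul_r; apply: sq.
set G := x ^^ (2 * q).-1 + (x + 1) ^^ (2 * q).-1.
have rG : (r' | G).
  have E2q : (2 * q = (2 * q).-1.+1)%N by lia.
  have [u1 Hu1] := pow_first_order x r' (2 * q).-1.
  have [u2 Hu2] := pow_first_order (x + 1) r' (2 * q).-1.
  rewrite -E2q in Hu1 Hu2.
  have {F'} F' : (r' * r' | power_sum q x' - power_sum q x) by apply: Z.divide_sub_r.
  have Ed : power_sum q x' - power_sum q x = r' * (2 * Z.of_nat q * G) + r' * r' * (u1 + u2).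
    rewrite !power_sum_double /x' (_ : x + r' + 1 = x + 1 + r'); last by ring.
    by rewrite Hu1 Hu2 (_ : Z.of_nat (2 * q) = 2 * Z.of_nat q) /G; [ring | lia].
  have [k Hk] := F'.
  have H : (r' | 2 * Z.of_nat q * G).
    exists (k - (u1 + u2)); apply/(Z.mul_cancel_l _ _ r'); first by rewrite /r'; lia.
    by rewrite Ed in Hk; clear -Hk; lia.
  by case: (prime_dvd_mul _ _ _ pr H) => // /(prime_dvd_mul _ _ _ pr) [].
have E2q : (2 * q = (2 * q).-1.+1)%N by lia.
have D a : a ^^ (2 * q) = a * a ^^ (2 * q).-1 by rewrite {1}E2q powS.
have rx1 : (r' | x + 1).
  apply: (prime_dvd_pow r _ (2 * q).-1 pr).
  have -> : (x + 1) ^^ (2 * q).-1 = power_sum q x - x * G.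
    by rewrite power_sum_double !D /G; ring.
  by apply: Z.divide_sub_r => //; apply: Z.divide_mul_r.
apply: n0 (rx1).
apply: (prime_dvd_pow r _ (2 * q).-1 pr).
have -> : x ^^ (2 * q).-1 = G - (x + 1) ^^ (2 * q).-1 by rewrite /G; ring.
apply: Z.divide_sub_r => //.
have -> : (2 * q).-1 = (2 * q).-2.+1 by lia.
by rewrite powS; apply: Z.divide_mul_l.
Qed.
End Coprime.

Lemma special_solution_quadratic p q e x y z c R : (1 < p)%N -> odd p -> (p %% 3 != 0)%N ->
  special_solution p q e x y z c R ->
  exists g B U V, [/\ qnorm (Z.of_nat q) g = c, qnorm (Z.of_nat q) B = 1,
    qpow (Z.of_nat q) g p = qmul (Z.of_nat q) B (V, U), Z.gcd U c = 1 &
    R = V * V + Z.of_nat q * (U * U) /\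
    (2 * x + 1) * (2 * x + 1) * (V * V) <= 5 * aurifeuille_K q * R].
Proof.
move=> p1 po p3 [Hpar [Hx _] [_ Hc] [qS gR] [Ez Ec ER _]].
have Hq : q \in [:: 5; 13; 17; 29; 37; 41]%N.
  by move: Hpar; rewrite !inE !xpair_eqE => /or4P [| | |/or4P []] /andP [/eqP -> _].
set w := x * (x + 1) in ER; set E := peval (aurifeuille_E q) w.
have [pq q0] : prime q /\ 0 < Z.of_nat q by move: Hq; rewrite !inE => /or4P [| | |/or3P []] /eqP ->.
(* The identity reads qR = C^2 + q(4w + 1)E^2, so q divides C and can be cancelled. *)
have [U HU] : (Z.of_nat q | peval (aurifeuille_C q) w).
  have : (Z.of_nat q | peval (aurifeuille_C q) w * peval (aurifeuille_C q) w).
    have := aurifeuille q w Hq; cbn zeta; rewrite ER => H.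
    exists (R - (4 * w + 1) * (E * E)); rewrite /E; clear -H; lia.
  by move=> /(prime_dvd_mul _ _ _ pq) [].
rewrite Z.mul_comm in HU; set V := (2 * x + 1) * E.
have EN : R = V * V + Z.of_nat q * (U * U) := aurifeuille_norm q x U R Hq HU ER.
have gUV : Z.gcd U V = 1 := aurifeuille_coprime q x U R Hq HU ER gR.
have cR : (c | R) by rewrite Ec -(prednK (ltnW p1)) powS; apply: Z.divide_factor_l.
have gU : Z.gcd U c = 1.
  rewrite Z.gcd_comm; apply: coprime_dvd_l cR _; rewrite EN Z.gcd_comm.
  rewrite (_ : _ + _ = V * V + Z.of_nat q * U * U); last by ring.
  by rewrite Z.gcd_add_mult_diag_r; apply: coprime_mul.
have gq : Z.gcd (Z.of_nat q) c = 1.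
  by rewrite Z.gcd_comm; apply: coprime_dvd_l cR _; rewrite Z.gcd_comm.
have EA : qnorm (Z.of_nat q) (V, U) = c ^^ p by rewrite -Ec EN.
have [g [B [ng nB EB]]] := quadratic_root q (V, U) c p Hq p1 po p3 Hc gU gq EA.
exists g, B, U, V; split=> //; split=> //.
have w0 : 1 <= w by rewrite /w; nia.
have := aurifeuille_bound q w Hq (Z.le_trans 0 1 w ltac:(lia) w0); cbn zeta; rewrite -/E ER => H.
have EV : (4 * w + 1) * (E * E) = V * V by rewrite /V /w; ring.
have {H} H : w * (V * V) <= aurifeuille_K q * R.
  by rewrite EV in H; clear -H q0; nia.
(* As w >= 1, 4w + 1 <= 5w, which is the origin of the factor 5. *)
have -> : (2 * x + 1) * (2 * x + 1) = 4 * w + 1 by rewrite /w; ring.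
have V0 : 0 <= V * V by clear; nia.
by clear -H w0 V0; nia.
Qed.
End Aurifeuille.

(** * Arguments of powers and norms near multiples of pi/4 *)

Section Angles.
Local Open Scope R_scope.

Lemma unit_angle a b : a * a + b * b = 1 -> exists t, a = cos t /\ b = sin t.
Proof.
move=> H; have Ha : -1 <= a <= 1 by nra.
have E : 1 - a² = b² by rewrite /Rsqr; lra.
case: (Rle_lt_dec 0 b) => Hb.
  by exists (acos a); rewrite cos_acos // sin_acos // E sqrt_Rsqr.
exists (- acos a); rewrite cos_neg sin_neg cos_acos // sin_acos // E; split=> //.
by rewrite sqrt_Rsqr_abs Rabs_left //; lra.
Qed.

(** One angle serves all powers, so an estimate at the exponent p can be carried over to the
    exponents a and b. *)
Lemma polar_form (D u v N : Z) : Z.lt 0 D -> Z.lt 0 N -> qnorm D (u, v) = N ->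
  exists t, forall n, IZR (qpow D (u, v) n).1 = sqrt (IZR N) ^ n * cos (INR n * t) /\
    sqrt (IZR D) * IZR (qpow D (u, v) n).2 = sqrt (IZR N) ^ n * sin (INR n * t).
Proof.
move=> HD HN E.
have D0 : 0 < IZR D by apply: IZR_lt.
have N0 : 0 < IZR N by apply: IZR_lt.
have sD := sqrt_sqrt _ (Rlt_le _ _ D0); have sN := sqrt_sqrt _ (Rlt_le _ _ N0).
have N1 := sqrt_lt_R0 _ N0; have D1 := sqrt_lt_R0 _ D0.
set d := sqrt (IZR D) in sD D1 *; set r := sqrt (IZR N) in sN N1 *.
have EN : IZR u * IZR u + IZR D * (IZR v * IZR v) = IZR N by rewrite -!mult_IZR -plus_IZR -E.
have [t [H1 H2]] : exists t, IZR u / r = cos t /\ d * IZR v / r = sin t.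
  apply: unit_angle; apply: (Rmult_eq_reg_r (r * r)); last by nra.
  field_simplify; last by lra.
  by rewrite /= !Rmult_1_r; nra.
have {H1} H1 : IZR u = r * cos t by rewrite -H1; field; lra.
have {H2} H2 : d * IZR v = r * sin t by rewrite -H2; field; lra.
exists t; elim=> [|n [IH1 IH2]].
  by rewrite Rmult_0_l cos_0 sin_0 /=; split; ring.
rewrite qpowS /qmul S_INR Rmult_plus_distr_r Rmult_1_l (Rplus_comm _ t) cos_plus sin_plus.
move: IH1 IH2; case: (qpow D (u, v) n) => a b; cbn [fst snd] => IH1 IH2.
rewrite minus_IZR plus_IZR !mult_IZR -sD; cbn [pow]; split.
  by transitivity (IZR u * IZR a - (d * IZR v) * (d * IZR b)); [ring | rewrite H1 H2 IH1 IH2; ring].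
transitivity (IZR u * (d * IZR b) + (d * IZR v) * IZR a); first by ring.
by rewrite H1 H2 IH1 IH2; ring.
Qed.

Lemma near_odd_multiple a : exists k e, a = (2 * IZR k + 1) * (PI / 2) + e /\ Rabs e <= PI / 2.
Proof.
have P0 := PI_RGT_0; have [H1 H2] := base_Int_part (a / PI).
set k := Int_part (a / PI) in H1 H2.
have Ea : a = a / PI * PI by field; lra.
exists k, (a - (2 * IZR k + 1) * (PI / 2)); split; first by ring.
by apply: Rabs_le; rewrite Ea; clear -H1 H2 P0; move: (IZR k) (a / PI) H1 H2 => K b H1 H2; nra.
Qed.

(** On [0, 2] one has sin x >= x - x^3/6 >= x/3. The interval reaches to 2 because pi/2 is bounded
    through pi <= 4. *)
Lemma sin_lower_bound e : Rabs e <= 2 -> Rabs e <= 3 * Rabs (sin e).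
Proof.
have pos x : 0 <= x -> x <= 2 -> x <= 3 * sin x.
  move=> x0 x2; have [H _] := pre_sin_bound x 0 x0 (Rle_trans x 2 4 x2 ltac:(lra)).
  by move: H; rewrite /sin_approx /sin_term /=; nra.
have abs x : 0 <= x -> x <= 2 -> Rabs x <= 3 * Rabs (sin x).
  move=> x0 x2; have := pos x x0 x2; have := Rle_abs (sin x); rewrite (Rabs_pos_eq _ x0); lra.
case: (Rle_lt_dec 0 e) => He; first by rewrite {1}Rabs_pos_eq //; apply: abs.
rewrite {1}Rabs_left // => H; have := abs (- e); rewrite sin_neg !Rabs_Ropp; apply; lra.
Qed.

Lemma sin_shift_abs k d : Rabs (sin (IZR k * PI + d)) = Rabs (sin d).
Proof.
have S : sin (IZR k * PI) = 0 by apply: sin_eq_0_1; exists k.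
rewrite sin_plus S Rmult_0_l Rplus_0_l Rabs_mult.
have := sin2_cos2 (IZR k * PI); rewrite S /Rsqr => H.
suff -> : Rabs (cos (IZR k * PI)) = 1 by rewrite Rmult_1_l.
by rewrite /Rabs; case: Rcase_abs => ?; nra.
Qed.

Lemma cos_shift_abs k d : Rabs (cos ((2 * IZR k + 1) * (PI / 2) + d)) = Rabs (sin d).
Proof.
have -> : (2 * IZR k + 1) * (PI / 2) + d = PI / 2 + (IZR k * PI + d) by field.
by rewrite cos_plus cos_PI2 sin_PI2 Rmult_0_l Rmult_1_l Rminus_0_l Rabs_Ropp sin_shift_abs.
Qed.

Lemma abs_sin_le d : Rabs (sin d) <= Rabs d.
Proof.
have pos x : 0 <= x -> Rabs (sin x) <= x.
  move=> x0; apply: Rabs_le; split; last first.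
    by case: (Rle_lt_or_eq_dec 0 x x0) => [/sin_lt_x|<-]; [|rewrite sin_0]; lra.
  case: (Rle_lt_dec x 2) => x2; last by have := SIN_bound x; lra.
  by have [] := pre_sin_bound x 0 x0 (Rle_trans x 2 4 x2 ltac:(lra)); rewrite /sin_approx /sin_term /=; nra.
case: (Rle_lt_dec 0 d) => Hd; first by rewrite (Rabs_pos_eq d) //; apply: pos.
have := pos (- d); rewrite sin_neg Rabs_Ropp (Rabs_left d) //; apply; lra.
Qed.

(** For a negative exponent the conjugate replaces the inverse: its argument is also the opposite
    one, and the coordinates stay integral. *)
Definition signed_pow (D : Z) (g : Z * Z) (a : Z) : Z * Z :=
  qpow D (if Z.ltb a 0 then qconj g else g) (Z.abs_nat a).

Lemma signed_polar D u v N t a :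
  (forall n, IZR (qpow D (u, v) n).1 = sqrt (IZR N) ^ n * cos (INR n * t) /\
    sqrt (IZR D) * IZR (qpow D (u, v) n).2 = sqrt (IZR N) ^ n * sin (INR n * t)) ->
  IZR (signed_pow D (u, v) a).1 = sqrt (IZR N) ^ Z.abs_nat a * cos (IZR a * t) /\
  sqrt (IZR D) * IZR (signed_pow D (u, v) a).2 = sqrt (IZR N) ^ Z.abs_nat a * sin (IZR a * t).
Proof.
move=> H; have [H1 H2] := H (Z.abs_nat a); rewrite /signed_pow.
case: Z.ltb_spec => a0.
  rewrite -qconj_pow /qconj; cbn [fst snd].
  have -> : IZR a * t = - (INR (Z.abs_nat a) * t).
    by rewrite INR_IZR_INZ (_ : Z.of_nat (Z.abs_nat a) = Z.opp a) ?opp_IZR; [ring | lia].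
  by rewrite cos_neg sin_neg opp_IZR; split=> //; rewrite -Ropp_mult_distr_r H2; ring.
have -> : IZR a * t = INR (Z.abs_nat a) * t.
  by rewrite INR_IZR_INZ (_ : Z.of_nat (Z.abs_nat a) = a) //; lia.
by [].
Qed.

(* The real numbers R0 +- R1 sqrt D are, up to the factor |P| |G|, trigonometric functions of
   arg P +- arg G; the case depends on the multiple of pi/4 closest to arg P + arg G. *)
Definition eighth_turn_form (P G T : Z * Z) : Prop :=
  [\/ T = (Z.mul P.2 G.1, Z.mul P.1 G.2),
    T = (Z.mul (Z.sub P.1 P.2) G.1, Z.opp (Z.mul (Z.add P.1 P.2) G.2)),
    T = (Z.mul P.1 G.1, Z.opp (Z.mul P.2 G.2)) |
    T = (Z.mul (Z.add P.1 P.2) G.1, Z.mul (Z.sub P.1 P.2) G.2)].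

Lemma conjugate_product_bound (d rho f g e r0 r1 : R) :
  r0 + d * r1 = rho * f -> r0 - d * r1 = rho * g -> Rabs f <= 2 * e -> Rabs g <= 2 ->
  Rabs (r0 * r0 - d * d * (r1 * r1)) <= 4 * e * (rho * rho).
Proof.
move=> H1 H2 Hf Hg.
have -> : r0 * r0 - d * d * (r1 * r1) = (rho * rho) * (f * g).
  by transitivity ((r0 + d * r1) * (r0 - d * r1)); [ring | rewrite H1 H2; ring].
rewrite !Rabs_mult; have := Rabs_pos f; have := Rabs_pos g.
have -> : Rabs rho * Rabs rho = rho * rho by rewrite -Rabs_mult Rabs_pos_eq //; nra.
move=> g0 f0; have r2 : 0 <= rho * rho by nra.
have H : Rabs f * Rabs g <= 4 * e by nra.
by nra.
Qed.

(** Changing the sign of sqrt D conjugates G, that is, replaces B by -B. The conjugates of T.1 + T.2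
    sqrt D are therefore rP rG f(A + B) and rP rG f(A - B), where f is sin, cos - sin, cos or cos +
    sin, chosen to vanish at M pi/4. The first conjugate is small with d; the second is bounded
    trivially. *)
Lemma eighth_turn (P G : Z * Z) (D : Z) (rP rG A B d : R) (M : Z) :
  Z.lt 0 D -> IZR P.1 = rP * cos A -> IZR P.2 = rP * sin A ->
  IZR G.1 = rG * cos B -> sqrt (IZR D) * IZR G.2 = rG * sin B ->
  A + B = IZR M * (PI / 4) + d ->
  exists2 T, eighth_turn_form P G T &
    Rabs (IZR (Z.sub (Z.mul T.1 T.1) (Z.mul D (Z.mul T.2 T.2)))) <= 4 * Rabs d * (rP * rG * (rP * rG)).
Proof.
move=> D0 P1 P2 G1 G2 EAB.
have SB x := SIN_bound x; have CB x := COS_bound x.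
have E4 : cos (PI / 4) = sin (PI / 4) by rewrite cos_PI4 sin_PI4.
have [Hj Hi] : M = Z.add (Z.mul 4 (Z.div M 4)) (Z.modulo M 4) /\
    (Z.le 0 (Z.modulo M 4) /\ Z.lt (Z.modulo M 4) 4).
  by split; [apply: Z.div_mod | apply: Z.mod_pos_bound].
set j := Z.div M 4 in Hj; set i := Z.modulo M 4 in Hj Hi.
have key T f g : IZR T.1 + sqrt (IZR D) * IZR T.2 = rP * rG * f ->
    IZR T.1 - sqrt (IZR D) * IZR T.2 = rP * rG * g -> Rabs f <= 2 * Rabs d -> Rabs g <= 2 ->
    Rabs (IZR (Z.sub (Z.mul T.1 T.1) (Z.mul D (Z.mul T.2 T.2)))) <= 4 * Rabs d * (rP * rG * (rP * rG)).
  move=> H1 H2 Hf Hg; rewrite minus_IZR !mult_IZR -(sqrt_sqrt (IZR D)); last by apply/Rlt_le/IZR_lt.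
  exact: conjugate_product_bound H1 H2 Hf Hg.
have Rd := Rabs_pos d.
have : [\/ i = Z0, i = Zpos 1, i = Zpos 2 | i = Zpos 3].
  have : i = Z0 \/ i = Zpos 1 \/ i = Zpos 2 \/ i = Zpos 3 by lia.
  by move=> [|[|[|]]] ->; [apply: Or41 | apply: Or42 | apply: Or43 | apply: Or44].
case=> Ei; rewrite Ei in Hj.
- exists (Z.mul P.2 G.1, Z.mul P.1 G.2); first exact: Or41.
  apply: (key _ (sin (A + B)) (sin (A - B))); rewrite ?(sin_plus A B) ?sin_minus; cbn [fst snd].
  + by rewrite !mult_IZR P1 P2 G1; transitivity (rP * sin A * (rG * cos B) + rP * cos A * (sqrt (IZR D) * IZR G.2)); [ring | rewrite G2; ring].
  + by rewrite !mult_IZR P1 P2 G1; transitivity (rP * sin A * (rG * cos B) - rP * cos A * (sqrt (IZR D) * IZR G.2)); [ring | rewrite G2; ring].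
  + rewrite -(sin_plus A B) EAB Hj.
    have -> : IZR (Z.add (Z.mul 4 j) 0) * (PI / 4) + d = IZR j * PI + d.
      by rewrite plus_IZR mult_IZR; field.
    by rewrite sin_shift_abs; have := abs_sin_le d; lra.
  + by rewrite -sin_minus; apply: Rabs_le; have := SB (A - B); lra.
- exists (Z.mul (Z.sub P.1 P.2) G.1, Z.opp (Z.mul (Z.add P.1 P.2) G.2)); first exact: Or42.
  apply: (key _ (cos (A + B) - sin (A + B)) (cos (A - B) - sin (A - B))); cbn [fst snd].
  + rewrite opp_IZR !mult_IZR plus_IZR minus_IZR P1 P2 G1 cos_plus sin_plus.
    by transitivity ((rP * cos A - rP * sin A) * (rG * cos B) - (rP * cos A + rP * sin A) * (sqrt (IZR D) * IZR G.2)); [ring | rewrite G2; ring].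
  + rewrite opp_IZR !mult_IZR plus_IZR minus_IZR P1 P2 G1 cos_minus sin_minus.
    by transitivity ((rP * cos A - rP * sin A) * (rG * cos B) + (rP * cos A + rP * sin A) * (sqrt (IZR D) * IZR G.2)); [ring | rewrite G2; ring].
  + rewrite EAB Hj.
    have -> : IZR (Z.add (Z.mul 4 j) 1) * (PI / 4) + d = (IZR j * PI + d) + PI / 4.
      by rewrite plus_IZR mult_IZR; field.
    set m := IZR j * PI + d; rewrite (cos_plus m) (sin_plus m) E4; set s := sin (PI / 4).
    have -> : cos m * s - sin m * s - (sin m * s + cos m * s) = - 2 * s * sin m by ring.
    rewrite !Rabs_mult /m sin_shift_abs.
    have Hs : Rabs s <= 1 by apply: Rabs_le; apply: SB.
    have -> : Rabs (- 2) = 2 by rewrite Rabs_left; lra.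
    by have := abs_sin_le d; have := Rabs_pos (sin d); have := Rabs_pos s; nra.
  + by apply: Rabs_le; have := SB (A - B); have := CB (A - B); lra.
- exists (Z.mul P.1 G.1, Z.opp (Z.mul P.2 G.2)); first exact: Or43.
  apply: (key _ (cos (A + B)) (cos (A - B))); rewrite ?(cos_plus A B) ?cos_minus; cbn [fst snd].
  + by rewrite opp_IZR !mult_IZR P1 P2 G1; transitivity (rP * cos A * (rG * cos B) - rP * sin A * (sqrt (IZR D) * IZR G.2)); [ring | rewrite G2; ring].
  + by rewrite opp_IZR !mult_IZR P1 P2 G1; transitivity (rP * cos A * (rG * cos B) + rP * sin A * (sqrt (IZR D) * IZR G.2)); [ring | rewrite G2; ring].
  + rewrite -(cos_plus A B) EAB Hj.
    have -> : IZR (Z.add (Z.mul 4 j) 2) * (PI / 4) + d = (2 * IZR j + 1) * (PI / 2) + d.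
      by rewrite plus_IZR mult_IZR; field.
    by rewrite cos_shift_abs; have := abs_sin_le d; lra.
  + by rewrite -cos_minus; apply: Rabs_le; have := CB (A - B); lra.
- exists (Z.mul (Z.add P.1 P.2) G.1, Z.mul (Z.sub P.1 P.2) G.2); first exact: Or44.
  apply: (key _ (cos (A + B) + sin (A + B)) (cos (A - B) + sin (A - B))); cbn [fst snd].
  + rewrite !mult_IZR plus_IZR minus_IZR P1 P2 G1 cos_plus sin_plus.
    by transitivity ((rP * cos A + rP * sin A) * (rG * cos B) + (rP * cos A - rP * sin A) * (sqrt (IZR D) * IZR G.2)); [ring | rewrite G2; ring].
  + rewrite !mult_IZR plus_IZR minus_IZR P1 P2 G1 cos_minus sin_minus.
    by transitivity ((rP * cos A + rP * sin A) * (rG * cos B) - (rP * cos A - rP * sin A) * (sqrt (IZR D) * IZR G.2)); [ring | rewrite G2; ring].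
  + rewrite EAB Hj.
    have -> : IZR (Z.add (Z.mul 4 j) 3) * (PI / 4) + d = (IZR (Z.add j 1) * PI + d) - PI / 4.
      by rewrite !plus_IZR mult_IZR; field.
    set m := IZR (Z.add j 1) * PI + d; rewrite (cos_minus m) (sin_minus m) E4; set s := sin (PI / 4).
    have -> : cos m * s + sin m * s + (sin m * s - cos m * s) = 2 * s * sin m by ring.
    rewrite !Rabs_mult /m sin_shift_abs.
    have Hs : Rabs s <= 1 by apply: Rabs_le; apply: SB.
    have -> : Rabs 2 = 2 by rewrite Rabs_pos_eq; lra.
    by have := abs_sin_le d; have := Rabs_pos (sin d); have := Rabs_pos s; nra.
  + by apply: Rabs_le; have := SB (A - B); have := CB (A - B); lra.
Qed.

End Angles.

(** * Error terms of the two arguments and of their combination *)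

Section AngleCombination.
Local Open Scope R_scope.

(** For parts close to each other in absolute value it is the doubled angle that is near an odd
    multiple of pi/2, since cos(2pt) = (a1^2 - a2^2) / N. *)
Lemma double_angle_error (p : nat) (r X M1 t a1 a2 N : R) : 0 < N -> 0 < X ->
  r * r = N -> a1 = r * cos (INR p * t) -> a2 = r * sin (INR p * t) ->
  X * Rabs (a1 * a1 - a2 * a2) <= M1 * N ->
  exists k e, 2 * (INR p * t) = (2 * IZR k + 1) * (PI / 2) + e /\ X * Rabs e <= 3 * M1.
Proof.
move=> N0 X0 rN E1 E2 H; have [k [e [Ek He]]] := near_odd_multiple (2 * (INR p * t)).
exists k, e; split=> //.
have P4 := PI_4.
have E : a1 * a1 - a2 * a2 = N * cos (2 * (INR p * t)) by rewrite E1 E2 cos_2a -rN; ring.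
rewrite E Rabs_mult Ek cos_shift_abs Rabs_pos_eq in H; last by lra.
have {}He := sin_lower_bound e (Rle_trans _ (PI / 2) 2 He ltac:(lra)).
have H2 : X * Rabs (sin e) <= M1 by apply: (Rmult_le_reg_l N) => //; lra.
by have := Rabs_pos (sin e); nra.
Qed.

Lemma single_angle_error (p : nat) (r X K t a1 N : R) : 0 < N -> 0 < X -> 0 <= K -> 
  r * r = N -> a1 = r * cos (INR p * t) -> X * X * (a1 * a1) <= K * K * N ->
  exists k e, INR p * t = (2 * IZR k + 1) * (PI / 2) + e /\ X * Rabs e <= 3 * K.
Proof.
move=> N0 X0 K0 rN E1 H; have [k [e [Ek He]]] := near_odd_multiple (INR p * t).
exists k, e; split=> //.
have P4 := PI_4.
have {}He := sin_lower_bound e (Rle_trans _ (PI / 2) 2 He ltac:(lra)).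
have Ec : cos (INR p * t) * cos (INR p * t) = Rabs (sin e) * Rabs (sin e).
  rewrite Ek -(cos_shift_abs k e) -Rabs_mult Rabs_pos_eq //; nra.
set sn := Rabs (sin e) in He Ec; have s0 : 0 <= sn by apply: Rabs_pos.
have H2 : X * X * (sn * sn) <= K * K.
  apply: (Rmult_le_reg_l N) => //; rewrite -Ec; apply: Rle_trans (_ : K * K * N <= _); last by lra.
  by apply: Rle_trans H; rewrite E1 -rN; apply: Req_le; ring.
have H3 : X * sn <= K.
  have s1 : 0 <= X * sn by nra.
  by apply: Rnot_lt_le => H4; nra.
by nra.
Qed.

(** In units of pi/4, p t1 is near 2 k1 + 1 and p t2 near 2(2 k2 + 1). After division by p the
    combination is near a multiple of pi/4 exactly when p divides the combined integer; this is the
    condition that defines the lattice. The same division absorbs |a| and |b| in the error. *)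
Lemma combined_angle_error (p : nat) (X M1 K a b k1 k2 M e1 e2 t1 t2 : R) :
  (0 < p)%N -> 0 < X -> 
  2 * (INR p * t1) = (2 * k1 + 1) * (PI / 2) + e1 -> X * Rabs e1 <= 3 * M1 ->
  INR p * t2 = (2 * k2 + 1) * (PI / 2) + e2 -> X * Rabs e2 <= 3 * K ->
  a * (2 * k1 + 1) + b * (2 * (2 * k2 + 1)) = M * INR p ->
  Rabs a <= INR p -> Rabs b <= INR p ->
  exists d, a * t1 + b * t2 = M * (PI / 4) + d /\ X * Rabs d <= 2 * M1 + 3 * K.
Proof.
move=> p0 X0 E1 H1 E2 H2 EM Ha Hb; have P0 : 0 < INR p by apply: lt_0_INR; apply/ltP.
set d := (a * (e1 / 2) + b * e2) / INR p.
exists d; split.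
  apply: (Rmult_eq_reg_l (INR p)); last by lra.
  transitivity (a * (2 * (INR p * t1)) / 2 + b * (INR p * t2)); first by field.
  rewrite E1 E2 /d; transitivity (PI / 4 * (M * INR p) + (a * (e1 / 2) + b * e2)); last by field; lra.
  by rewrite -EM; field.
have Hd : INR p * Rabs d = Rabs (a * (e1 / 2) + b * e2).
  by rewrite -{1}(Rabs_pos_eq (INR p)) -?Rabs_mult /d; [congr Rabs; field; lra | lra].
have T := Rabs_triang (a * (e1 / 2)) (b * e2); rewrite !Rabs_mult in T.
have E12 : Rabs (/ 2) = / 2 by rewrite Rabs_pos_eq; lra.
rewrite E12 -Hd in T.
have A1 := Rabs_pos a; have B1 := Rabs_pos b; have C1 := Rabs_pos e1; have D1 := Rabs_pos e2.
move: (Rabs a) (Rabs b) (Rabs e1) (Rabs e2) (Rabs d) A1 B1 C1 D1 Ha Hb H1 H2 T.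
move=> a' b' f1 f2 d' A1 B1 C1 D1 Ha Hb H1 H2 T.
have Hd' : d' <= f1 / 2 + f2.
  apply: (Rmult_le_reg_l (INR p)) => //; apply: Rle_trans T _.
  by rewrite Rmult_plus_distr_l; apply: Rplus_le_compat; apply: Rmult_le_compat_r => //; lra.
have : X * d' <= X * (f1 / 2 + f2) by apply: Rmult_le_compat_l => //; lra.
have M0 : 0 <= M1 by have : 0 <= X * f1 by [nra]; lra.
by lra.
Qed.

End AngleCombination.

(** * The combined estimate as an inequality between integers *)

Section AngleCombinationZ.
Local Open Scope Z_scope.

Lemma IZR_pow x n : IZR (x ^^ n) = Rpow_def.pow (IZR x) n.
Proof. by rewrite pow_IZR. Qed.

Lemma sqrt_pow_square y n : 0 < y ->
  Rmult (Rpow_def.pow (sqrt (IZR y)) n) (Rpow_def.pow (sqrt (IZR y)) n) = IZR (y ^^ n).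
Proof.
by move=> y0; rewrite -Rpow_mult_distr sqrt_sqrt ?IZR_pow //; apply/Rlt_le/IZR_lt.
Qed.

Lemma angle_combination (p : nat) (D y c X M1 K : Z) (g h : Z * Z) :
  (0 < p)%N -> 0 < D -> 0 < y -> 0 < c -> 0 < X -> 0 <= K ->
  qnorm 1 g = y -> qnorm D h = c ->
  let A := qpow 1 g p in let C := qpow D h p in
  X * Z.abs (A.1 * A.1 - A.2 * A.2) <= M1 * y ^^ p -> X * X * (C.1 * C.1) <= K * K * c ^^ p ->
  exists s t, forall a b, (Z.of_nat p | a * s + b * t) ->
    Z.abs a <= Z.of_nat p -> Z.abs b <= Z.of_nat p ->
    exists2 T, eighth_turn_form (signed_pow 1 g a) (signed_pow D h b) T &
      X * Z.abs (T.1 * T.1 - D * (T.2 * T.2)) <=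
        4 * (2 * M1 + 3 * K) * (y ^^ Z.abs_nat a * c ^^ Z.abs_nat b).
Proof.
case: g => u v; case: h => gg hh p0 D0 y0 c0 X0 K0 ng nh A C HA HC.
have [t1 Ht1] := polar_form 1 u v y Z.lt_0_1 y0 ng.
have [t2 Ht2] := polar_form D gg hh c D0 c0 nh.
have X0' := IZR_lt _ _ X0.
have [A1 A2] := Ht1 p; rewrite sqrt_1 Rmult_1_l in A2.
have Np y' : 0 < y' -> Rlt 0 (IZR (y' ^^ p)) by move=> ?; apply/IZR_lt/pow_pos.
have [k1 [e1 [E1 He1]]] := double_angle_error p _ (IZR X) (IZR M1) t1 _ _ _ (Np y y0) X0'
  (sqrt_pow_square y p y0) A1 A2 ltac:(rewrite -!mult_IZR -minus_IZR -abs_IZR -mult_IZR; exact: IZR_le).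
have [C1 _] := Ht2 p.
have [k2 [e2 [E2 He2]]] := single_angle_error p _ (IZR X) (IZR K) t2 _ _ (Np c c0) X0' (IZR_le _ _ K0)
  (sqrt_pow_square c p c0) C1 ltac:(rewrite -!mult_IZR; exact: IZR_le).
(* The lattice is given by the odd multiples of pi/4 and of pi/2 found above. *)
exists (2 * k1 + 1), (2 * (2 * k2 + 1)) => a b [M HM] Ha Hb.
have HM' : Rplus (Rmult (IZR a) (Rplus (Rmult 2 (IZR k1)) 1)) (Rmult (IZR b) (Rmult 2 (Rplus (Rmult 2 (IZR k2)) 1))) = Rmult (IZR M) (INR p).
  by rewrite INR_IZR_INZ -!(mult_IZR, plus_IZR) HM.
have Hab z : Z.abs z <= Z.of_nat p -> Rle (Rabs (IZR z)) (INR p).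
  by move=> Hz; rewrite INR_IZR_INZ -abs_IZR; apply: IZR_le.
have [d [Ed Hd]] := combined_angle_error p _ _ _ _ _ _ _ _ _ _ _ _ p0 X0' E1 He1 E2 He2 HM' (Hab a Ha) (Hab b Hb).
have [P1 P2] := signed_polar 1 u v y t1 a Ht1; rewrite sqrt_1 Rmult_1_l in P2.
have [G1 G2] := signed_polar D gg hh c t2 b Ht2.
have [T HT Hle] := eighth_turn _ _ D _ _ _ _ d M D0 P1 P2 G1 G2 Ed.
exists T => //; apply: le_IZR.
rewrite mult_IZR abs_IZR mult_IZR (mult_IZR (y ^^ _)) -!sqrt_pow_square //.
set rP := Rpow_def.pow _ _ in Hle *; set rG := Rpow_def.pow _ _ in Hle *.
have {Hle} := Rmult_le_compat_l _ _ _ (Rlt_le _ _ X0') Hle.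
have -> : IZR (4 * (2 * M1 + 3 * K)) = Rmult 4 (Rplus (Rmult 2 (IZR M1)) (Rmult 3 (IZR K))).
  by rewrite -!(mult_IZR, plus_IZR).
move/Rle_trans; apply.
have H0 : Rle 0 (Rmult (Rmult rP rG) (Rmult rP rG)) by exact: Rle_0_sqr.
by clear -Hd H0; nra.
Qed.

End AngleCombinationZ.

(** * Contradiction for exponents above the bound *)

Section LargeExponents.
Local Open Scope Z_scope.

(** Hermite's bound in dimension 2: for a reduced basis with norms n <= n' and inner product i, n n'
    = i^2 + p^2 and |i| <= n/2, so 3n^2 <= 4p^2. *)
Lemma short_vector p s t : prime p -> exists a b, [/\ a <> 0 \/ b <> 0, (Z.of_nat p | a * s + b * t) &
  3 * ((a * a + b * b) * (a * a + b * b)) <= 4 * (Z.of_nat p * Z.of_nat p)].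
Proof.
move=> pp; have p1 := prime_gt1 pp; set P := Z.of_nat p.
have P1 : 1 < P by rewrite /P; lia.
case: (Znumtheory.Zdivide_dec P s) => Hs.
  by exists 1, 0; split; [left | rewrite Z.mul_1_l Z.add_0_r | nia].
have [u v Huv] := Zis_gcd_bezout _ _ _ (Zgcd_is_gcd P s).
rewrite (prime_coprime_Z _ _ pp Hs) in Huv.
pose L (w : Z * Z) := (P | w.1 * s + w.2 * t).
have Lsub w w' k : L w -> L w' -> L (w.1 - k * w'.1, w.2 - k * w'.2).
  rewrite /L; cbn [fst snd] => -[i Hi] [j Hj]; exists (i - k * j).
  by transitivity (w.1 * s + w.2 * t - k * (w'.1 * s + w'.2 * t)); [ring | rewrite Hi Hj; ring].
have La : L (P, 0) by exists s; cbn [fst snd]; ring.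
have Lb : L (- t * v, 1).
  exists (t * u); cbn [fst snd]; rewrite (_ : 1 * t = t * (u * P + v * s)); last by rewrite Huv; ring.
  by rewrite /P; ring.
have [[a b] [[a' b'] [HL _ det H1 H2]]] :=
  lattice_reduction 1 P L (P, 0) (- t * v, 1) Z.lt_0_1 ltac:(lia) Lsub La Lb ltac:(cbn [fst snd]; ring).
rewrite /qnorm in H1 H2; cbn [fst snd] in det, H1, H2.
exists a, b; split=> //.
  case: (Z.eq_dec a 0) => Ha; [right => Hb | by left].
  by rewrite Ha Hb in det; lia.
set n := a * a + b * b; set i := a * a' + b * b'; set n' := a' * a' + b' * b'.
have E : n * n' = i * i + P * P by rewrite -det /n /n' /i; ring.
have H1' : 2 * Z.abs i <= n by rewrite /i /n; lia.
have H2' : n <= n' by rewrite /n' /n; lia.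
have n0 : 0 <= n by rewrite /n; nia.
have H3 : 4 * (i * i) <= n * n by clear -H1' n0; nia.
by clear -E H3 H2' n0; nia.
Qed.

(** Modulo a prime divisor of the norm, g^(n+2) is (2 g.1)^(n+1) g; if that prime also divided 2
    g.1, it would divide both coordinates. *)
Lemma root_coprime D g n A : qpow D g n.+2 = A -> Z.gcd A.1 A.2 = 1 ->
  Z.gcd (2 * g.1) (qnorm D g) = 1.
Proof.
move=> E gA; apply: coprime_of_primes => r pr H1 H2.
have [C1 C2] := qpow_norm_mod _ _ _ n.+1 H2; rewrite E in C1 C2.
have H0 k : (Z.of_nat r | (2 * g.1) ^^ n.+1 * k).
  by rewrite powS -Z.mul_assoc; apply: Z.divide_mul_l.
have : (Z.of_nat r | Z.gcd A.1 A.2).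
  by apply: Z.gcd_greatest; apply/cong0P; [apply: cong_trans C1 _ | apply: cong_trans C2 _]; apply/cong0P.
by rewrite gA => /Z.divide_1_r_nonneg; have := prime_gt1 pr; lia.
Qed.

Lemma coprime_not_dvd N a : 1 < N -> Z.gcd a N = 1 -> ~ (N | a).
Proof.
move=> N1 G H; have : (N | Z.gcd a N) by apply: Z.gcd_greatest => //; apply: Z.divide_refl.
by rewrite G => /Z.divide_1_r_nonneg; lia.
Qed.

(** Modulo the norm a power is a unit times g or its conjugate. Non-vanishing of the integers r0 and
    r1 is read off there, without any use of angles. *)
Lemma signed_pow_mod D g N a : qnorm D g = N -> Z.gcd (2 * g.1) N = 1 -> a <> 0 ->
  exists k v, [/\ Z.gcd k N = 1, g.1 * g.1 + D * (v * v) = N, cong N (signed_pow D g a).1 (k * g.1) &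
    cong N (signed_pow D g a).2 (k * v)].
Proof.
move=> ng gN a0; rewrite /signed_pow; set g' := if _ then _ else _.
have Hg : g'.1 = g.1 /\ qnorm D g' = N.
  by rewrite /g'; case: ifP => _; rewrite ?qnorm_conj.
have [n ->] : exists n, Z.abs_nat a = n.+1 by exists (Z.abs_nat a).-1; lia.
have HN : (N | qnorm D g') by rewrite Hg.2; apply: Z.divide_refl.
have [C1 C2] := qpow_norm_mod _ _ _ n HN; rewrite Hg.1 in C1 C2.
exists ((2 * g.1) ^^ n), g'.2; split=> //; last by rewrite -Hg.2 /qnorm Hg.1.
by rewrite Z.gcd_comm; apply: coprime_pow_r; rewrite Z.gcd_comm.
Qed.

Lemma signed_pow_nonzero D g N a : 1 < N -> qnorm D g = N -> Z.gcd (2 * g.1) N = 1 ->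
  (signed_pow D g a).1 <> 0 /\ ((signed_pow D g a).2 = 0 -> a = 0).
Proof.
move=> N1 ng gN; case: (Z.eq_dec a 0) => a0; first by rewrite a0.
have g1 : Z.gcd g.1 N = 1 by apply: coprime_dvd_l gN; exists 2.
have [k [v [gk Ev C1 C2]]] := signed_pow_mod _ _ _ _ ng gN a0.
split=> E.
  rewrite E in C1; apply: (coprime_not_dvd N (k * g.1) N1); first exact: gcd_mul1.
  by apply/cong0P/cong_sym.
rewrite E in C2; case: (coprime_not_dvd N (g.1 * g.1) N1); first exact: gcd_mul1.
have Hv : (N | v).
  apply: (Z.gauss _ k); last by rewrite Z.gcd_comm.
  by apply/cong0P/cong_sym.
have -> : g.1 * g.1 = N - D * (v * v) by rewrite -Ev; ring.
by apply: Z.divide_sub_r; [apply: Z.divide_refl | do 2! apply: Z.divide_mul_r].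
Qed.

Lemma signed_gauss_pow_nonzero g N a : 1 < N -> qnorm 1 g = N -> Z.gcd (2 * g.1) N = 1 ->
  (signed_pow 1 g a).1 + (signed_pow 1 g a).2 <> 0 /\ (signed_pow 1 g a).1 - (signed_pow 1 g a).2 <> 0.
Proof.
move=> N1 ng gN; case: (Z.eq_dec a 0) => a0; first by rewrite a0.
have [k [v [gk Ev C1 C2]]] := signed_pow_mod _ _ _ _ ng gN a0.
have g1 : Z.gcd g.1 N = 1 by apply: coprime_dvd_l gN; exists 2.
have H s : s = 1 \/ s = -1 -> ~ (N | k * (g.1 + s * v)).
  move=> Hs /Z.gauss H.
  case: (coprime_not_dvd N (2 * g.1 * g.1) N1); first exact: gcd_mul1.
  have -> : 2 * g.1 * g.1 = N + (g.1 + s * v) * (g.1 - s * v).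
    by rewrite -Ev; case: Hs => ->; ring.
  apply: Z.divide_add_r; first exact: Z.divide_refl.
  by apply/Z.divide_mul_l/H; rewrite Z.gcd_comm.
split=> E.
  apply: (H 1); first by left.
  apply/cong0P/cong_sym; rewrite -E Z.mul_add_distr_l Z.mul_1_l; exact: cong_add.
apply: (H (-1)); first by right.
apply/cong0P/cong_sym; rewrite -E (_ : k * (g.1 + -1 * v) = k * g.1 + - (k * v)); last by ring.
by rewrite -Z.add_opp_r; apply: cong_add => //; apply: cong_opp.
Qed.

Lemma eighth_turn_form_nonzero (D : Z) (P G T : Z * Z) : eighth_turn_form P G T ->
  P.1 <> 0 -> P.1 + P.2 <> 0 -> P.1 - P.2 <> 0 -> G.1 <> 0 -> P.2 <> 0 \/ G.2 <> 0 ->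
  T.1 <> 0 \/ T.2 <> 0.
Proof.
move=> HT H1 H2 H3 H4 H5; case: HT => ->; cbn [fst snd]; last 3 first.
- by left; nia.
- by left; nia.
- by left; nia.
- by case: H5 => H; [left | right]; nia.
Qed.

Lemma square_ne_prime_square q a b : prime q -> a * a = Z.of_nat q * (b * b) -> a = 0 /\ b = 0.
Proof.
move=> pq E; have q1 := prime_gt1 pq.
case: (Z.eq_dec b 0) => b0; first by split=> //; rewrite b0 in E; nia.
have En : (Z.abs_nat a ^ 2 = q * Z.abs_nat b ^ 2)%N by nia.
have b0' : (0 < Z.abs_nat b ^ 2)%N by rewrite expn_gt0; lia.
have := congr1 (logn q) En; rewrite (lognM _ (prime_gt0 pq) b0') !lognX (logn_prime q pq) eqxx.
by move: (logn q _) (logn q _) => k l; lia.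
Qed.


(** Relative to their sum, x^m and (x+1)^m differ by at most m / (2x + 1); this puts the argument of
    gamma^p close to an odd multiple of pi/4. *)
Lemma power_difference_bound x m : 1 <= x ->
  0 <= (x + 1) ^^ m - x ^^ m /\
  (2 * x + 1) * ((x + 1) ^^ m - x ^^ m) <= Z.of_nat m * ((x + 1) ^^ m + x ^^ m).
Proof.
move=> Hx; elim: m => [|m [IH0 IH]]; first by rewrite !Z.pow_0_r; lia.
have Ha := pow_pos x m ltac:(lia); rewrite !powS (_ : Z.of_nat m.+1 = Z.of_nat m + 1); last by lia.
move: (x ^^ m) ((x + 1) ^^ m) Ha IH0 IH => a b.
move: (Z.of_nat m) (Zle_0_nat m) => M M0 Ha IH0 IH.
split; first by clear -Hx Ha IH0; nia.
set d := b - a in IH0 IH; set s := b + a in IH.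
have E1 : 2 * ((x + 1) * b - x * a) = (2 * x + 1) * d + s by rewrite /d /s; ring.
have E2 : 2 * ((x + 1) * b + x * a) = (2 * x + 1) * s + d by rewrite /d /s; ring.
have H : (2 * x + 1) * ((2 * x + 1) * d + s) <= (M + 1) * ((2 * x + 1) * s + d).
  have T1 : (2 * x + 1) * ((2 * x + 1) * d) <= (2 * x + 1) * (M * s).
    by apply: Z.mul_le_mono_nonneg_l => //; clear -Hx; lia.
  have T2 : 0 <= (M + 1) * d by apply: Z.mul_nonneg_nonneg => //; clear -M0; lia.
  by clear -T1 T2; lia.
by clear -H E1 E2; nia.
Qed.

(** The square root of 5 [aurifeuille_K q], rounded up: it bounds (2x + 1)|V| / sqrt R. *)
Definition angle_bound (q : nat) : Z :=
  if q == 5%N then 10 else if q == 13%N then 17 else if q == 17%N then 37 else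
  if q == 29%N then 73 else if q == 37%N then 28 else 115.

(** The constant of [angle_combination] for M1 = 2 q^e and K = [angle_bound q]. *)
Definition approximation_bound (q e : nat) : Z :=
  4 * (2 * (2 * Z.of_nat (q ^ e)) + 3 * angle_bound q).

Definition large_exponent_check (u : nat * nat) : bool :=
  let: (q, e) := u in let m := Z.of_nat (q ^ e) in let q1 := Z.of_nat q.-1 in
  let B := exponent_bound q e in let h := 1600 * (m * m + q1 * q1) in
  [&& 4 * (h * h) <=? 3 * (361 * 361) * (B * B), 200 + Z.of_nat e <=? B,
    approximation_bound q e ^ 40 <? Z.of_nat q ^ 200 &
    5 * aurifeuille_K q <=? angle_bound q * angle_bound q].

Lemma large_exponent_checkE : all large_exponent_check parameters.
Proof. by vm_compute. Qed.

(** With T = 2ma + 2 q1 b and n = a^2 + b^2, Cauchy-Schwarz gives T^2 <= 4(m^2 + q1^2) n. If 20T >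
    19P, then 361 P^2 < h n, since 361 = 19^2 and 1600 = 4 times 20^2; this contradicts 3n^2 <= 4P^2
    together with P >= B. *)
Lemma exponent_inequality P B m q1 a b : 0 < P -> 0 <= B <= P -> 0 <= m -> 0 <= q1 -> 0 <= a -> 0 <= b ->
  let h := 1600 * (m * m + q1 * q1) in 4 * (h * h) <= 3 * (361 * 361) * (B * B) ->
  3 * ((a * a + b * b) * (a * a + b * b)) <= 4 * (P * P) ->
  20 * (2 * m * a + 2 * q1 * b) <= 19 * P.
Proof.
move=> Ppos HB m0 q0 a0 b0 h Hh Hn.
set n := a * a + b * b in Hn; set T := 2 * m * a + 2 * q1 * b; set M2 := m * m + q1 * q1 in h Hh *.
case: (Z_le_gt_dec (20 * T) (19 * P)) => // HT; exfalso.
have T2 : T * T <= 4 * M2 * n.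
  have H : 0 <= (m * b - q1 * a) * (m * b - q1 * a) by apply: Z.square_nonneg.
  by rewrite /T /M2 /n; clear -H; lia.
have n0 : 0 <= n by rewrite /n; nia.
have M0 : 0 <= M2 by rewrite /M2; nia.
have P0 : 0 < P * P by apply: Z.mul_pos_pos.
have H1 : 361 * (P * P) < h * n by rewrite /h; clear -HT T2 HB n0 M0; nia.
have H2 : (361 * (P * P)) * (361 * (P * P)) < (h * n) * (h * n).
  by apply: Z.mul_lt_mono_nonneg; lia.
have h0 : 0 <= h * h by apply: Z.square_nonneg.
have BP : B * B <= P * P by apply: Z.mul_le_mono_nonneg; lia.
have H3 : (h * h) * (3 * (n * n)) <= (h * h) * (4 * (P * P)) by apply: Z.mul_le_mono_nonneg_l.
have H4 : 4 * (h * h) * (P * P) <= 3 * (361 * 361) * (P * P) * (P * P).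
  by apply: Z.mul_le_mono_nonneg_r; lia.
by clear -H2 H3 H4; lia.
Qed.

Lemma pow_le_base x y n : 0 <= x -> x <= y -> x ^^ n <= y ^^ n.
Proof. by move=> x0 xy; apply: Z.pow_le_mono_l. Qed.

Lemma pow_le_base_inv x y n : (0 < n)%N -> 0 <= y -> x ^^ n <= y ^^ n -> x <= y.
Proof.
move=> n0 y0 H; case: (Z_le_gt_dec x y) => // Hxy.
have : y ^^ n < x ^^ n by apply: Z.pow_lt_mono_l; lia.
by lia.
Qed.

Lemma pow_le_exponent x m n : 0 < x -> (m <= n)%N -> x ^^ m <= x ^^ n.
Proof. by move=> x0 mn; apply: Z.pow_le_mono_r; lia. Qed.

(* Elimination of Y from X <= L Y and Y^p <= X^(19p/20). *)
Lemma base_bound X L Y p T : (0 < p)%N -> 0 < X -> 0 <= L -> 0 <= Y -> X <= L * Y ->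
  Y ^^ p <= X ^^ T -> (20 * T <= 19 * p)%N -> X <= L ^ 20.
Proof.
move=> p0 X0 L0 Y0 H1 H2 H3.
have H4 : X ^^ p <= L ^^ p * X ^^ T.
  apply: Z.le_trans (pow_le_base _ _ p (Z.lt_le_incl _ _ X0) H1) _.
  rewrite pow_mull; apply: Z.mul_le_mono_nonneg_l => //.
  by apply: Z.pow_nonneg.
have Xp n : 0 < X ^^ n by apply: pow_pos.
have {H4} H4 : X ^^ (20 * p) <= L ^^ (20 * p) * X ^^ (19 * p).
  have E20 a : a ^^ (20 * p) = (a ^^ p) ^^ 20 by rewrite mulnC powM.
  rewrite !E20.
  have H5 := pow_le_base _ _ 20 (Z.lt_le_incl _ _ (Xp p)) H4.
  apply: Z.le_trans H5 _; rewrite pow_mull; apply: Z.mul_le_mono_nonneg_l.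
    by apply: Z.pow_nonneg; apply: Z.pow_nonneg.
  by rewrite -powM mulnC; apply: pow_le_exponent.
have E : (20 * p = p + 19 * p)%N by rewrite -mulSn.
have {H4} H4 : X ^^ p <= (L ^ 20) ^^ p.
  apply: (proj2 (Z.mul_le_mono_pos_r _ _ (X ^^ (19 * p)) (Xp _))).
  by rewrite -powD -E; apply: Z.le_trans H4 _; rewrite powM; apply: Z.le_refl.
by apply: (pow_le_base_inv _ _ p p0 _ H4); apply: Z.pow_nonneg.
Qed.

(** Since q divides z, S q^e = z^p >= q^p, so S is at least q^(p-e). *)
Lemma special_solution_size p q e x y z c R : (Z.of_nat e + 200 <= Z.of_nat p) ->
  special_solution p q e x y z c R -> Z.of_nat q ^ 200 <= (2 * x + 1) * (2 * x + 1).
Proof.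
move=> Hp [Hpar [Hx _] [Hz _] [qS _] [Ez _ _ _]].
have /and5P [pq _ _ _ _] := allP parameters_dataE _ Hpar.
have q1 := prime_gt1 pq.
have qz : Z.of_nat q <= z.
  apply: Z.divide_pos_le => //; apply: (prime_dvd_pow _ _ p pq).
  by rewrite -Ez; apply: Z.divide_mul_l.
have H : Z.of_nat q ^^ p <= power_sum 1 x * Z.of_nat q ^^ e.
  by rewrite Ez; apply: pow_le_base => //; lia.
have [k [Ek k200]] : exists k, p = (k + e)%N /\ (200 <= k)%N by exists (p - e)%N; lia.
rewrite Ek powD in H.
have {}H : Z.of_nat q ^^ k <= power_sum 1 x.
  by apply: (proj2 (Z.mul_le_mono_pos_r _ _ (Z.of_nat q ^^ e) _)) => //; apply: pow_pos; lia.
have Q200 : Z.of_nat q ^^ 200 <= Z.of_nat q ^^ k by apply: pow_le_exponent; lia.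
rewrite power_sum1 in H; change (Z.of_nat 200) with 200 in Q200.
by move: (Z.of_nat q ^^ k) (Z.of_nat q ^ 200) H Q200 => A B H Q; clear -H Q Hx; nia.
Qed.


Lemma power_sum_le m x : 1 <= x -> (0 < m)%N -> power_sum m x <= (2 * x + 1) ^^ (2 * m).
Proof.
move=> Hx m0; rewrite powM /power_sum.
have -> : (2 * x + 1) ^^ 2 = (2 * x + 1) * (2 * x + 1) by rewrite !powS Z.pow_0_r; ring.
have key a b n : 0 <= a -> 0 <= b -> a ^^ n.+1 + b ^^ n.+1 <= (a + b) ^^ n.+1.
  move=> a0 b0; elim: n => [|n IH]; first by rewrite !powS !Z.pow_0_r; lia.
  have An : 0 <= a ^^ n.+1 by apply: Z.pow_nonneg.
  have Bn : 0 <= b ^^ n.+1 by apply: Z.pow_nonneg.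
  rewrite !(powS _ n.+1); move: (a ^^ n.+1) (b ^^ n.+1) ((a + b) ^^ n.+1) An Bn IH => A B C A0 B0 H.
  by clear -A0 B0 H a0 b0; nia.
have := key (x * x) ((x + 1) * (x + 1)) m.-1; rewrite prednK // => H.
apply: Z.le_trans (H _ _) _; try by apply: Z.square_nonneg.
by apply: pow_le_base; clear -Hx; nia.
Qed.

Lemma power_sum_quotient_le q x R : 1 <= x -> prime q -> odd q ->
  peval (sum_quotient q) (x * (x + 1)) = Z.of_nat q * R -> R <= (2 * x + 1) ^^ (2 * q.-1).
Proof.
move=> Hx pq oq ER; have q1 := prime_gt1 pq.
have H := power_sum_le q x Hx (ltnW q1).
have Eq : (2 * q = (2 * q.-1).+2)%N by lia.
rewrite sum_quotientE // ER power_sum1 Eq !powS in H.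
have X0 : 0 < (2 * x + 1) ^^ (2 * q.-1) by apply: pow_pos; lia.
have q2 : 2 <= Z.of_nat q by lia.
move: ((2 * x + 1) ^^ (2 * q.-1)) X0 H => T X0 H.
case: (Z_le_gt_dec R T) => // RT; exfalso.
have H1 : 2 * T < Z.of_nat q * R by clear -q2 RT X0; nia.
have H2 : (2 * x + 1) * ((2 * x + 1) * T) <= (x * x + (x + 1) * (x + 1)) * (2 * T).
  by clear -X0; nia.
by clear -H H1 H2 Hx; nia.
Qed.

Lemma gauss_unit_squares B a b A : qnorm 1 B = 1 -> A = qmul 1 B (a, b) -> Z.gcd a b = 1 ->
  Z.abs (A.1 * A.1 - A.2 * A.2) = Z.abs (b * b - a * a) /\ Z.gcd A.1 A.2 = 1.
Proof.
move=> nB -> g; have [s [t [Hs Ht H]]] := gauss_unit_mul B a b nB.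
by case: H => ->; cbn [fst snd]; case: Hs => ->; case: Ht => ->;
  rewrite ?Z.mul_1_l -?Z.opp_eq_mul_m1 ?Z.gcd_opp_l ?Z.gcd_opp_r; split=> //; try lia; rewrite Z.gcd_comm.
Qed.

Lemma quadratic_unit D B : 1 < D -> qnorm D B = 1 -> B = (1, 0) \/ B = (-1, 0).
Proof.
case: B => a b D1; rewrite /qnorm; cbn [fst snd] => H.
have b0 : b = 0 by clear -D1 H; nia.
rewrite b0 in H *.
have [->|->] : a = 1 \/ a = -1 by clear -H; nia.
  by left.
by right.
Qed.

Lemma coprime_of_norm D U V c R p : (0 < p)%N -> R = V * V + D * (U * U) -> R = c ^^ p ->
  Z.gcd U c = 1 -> Z.gcd V U = 1.
Proof.
move=> p0 E Ec g; apply: coprime_of_primes => r pr HV HU.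
have : (Z.of_nat r | Z.gcd U c).
  apply: Z.gcd_greatest => //; apply: (prime_dvd_pow _ _ p pr); rewrite -Ec E.
  by apply: Z.divide_add_r; [apply: Z.divide_mul_l | do 2! apply: Z.divide_mul_r].
by rewrite g => /Z.divide_1_r_nonneg; have := prime_gt1 pr; lia.
Qed.

Lemma special_solution_large_exponent p q e x y z c R : prime p -> odd p ->
  special_solution p q e x y z c R -> Z.of_nat p < exponent_bound q e.
Proof.
move=> pp po H; case: (Z_lt_ge_dec (Z.of_nat p) (exponent_bound q e)) => // Hp; exfalso.
have [Hpar [Hx Hy] [Hz Hc] [qS gR] [Ez Ec ER Ey]] := H.
have /and5P [pq oq e0 _ _] := allP parameters_dataE _ Hpar.
have /and4P [/Z.leb_spec0 chk1 /Z.leb_spec0 chk2 _ /Z.leb_spec0 chk4] :=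
  allP large_exponent_checkE _ Hpar.
have p200 : Z.of_nat e + 200 <= Z.of_nat p by clear -chk2 Hp; lia.
have p1 := prime_gt1 pp; have q1 := prime_gt1 pq; have p0 := ltnW p1.
have p3 : (p %% 3 != 0)%N.
  apply/eqP => /eqP; rewrite -/(dvdn 3 p) dvdn_prime2 // => /eqP Ep.
  by move: p200; rewrite -Ep; clear; lia.
set m := (q ^ e)%N in Ey chk1 *; set X := 2 * x + 1.
have m0 : (0 < m)%N by rewrite expn_gt0 ltnW.
have X0 : 0 < X by rewrite /X; lia.
have [g [B [ng nB EB]]] := power_sum_gauss_root m x y p Hx Hy p0 Ey.
have [EA gA] := gauss_unit_squares B _ _ _ nB EB (coprime_succ_pow m x).
have HA : X * Z.abs ((qpow 1 g p).1 * (qpow 1 g p).1 - (qpow 1 g p).2 * (qpow 1 g p).2)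
    <= (2 * Z.of_nat m) * y ^^ p.
  have Dd k : k ^^ m * k ^^ m = k ^^ (2 * m) by rewrite -powD addnn mul2n.
  rewrite EA -Ey power_sum_squares !Dd.
  have [D0 D1] := power_difference_bound x (2 * m) Hx.
  rewrite Z.abs_eq // (Z.add_comm (x ^^ _)) (_ : 2 * Z.of_nat m = Z.of_nat (2 * m)) //; lia.
have gy : Z.gcd (2 * g.1) y = 1.
  by rewrite -ng; apply: (root_coprime 1 g p.-2 (qpow 1 g p)) => //; congr qpow; lia.
have [h [B' [U [V [nh nB' EB' gU [EN HV]]]]]] := special_solution_quadratic p q e x y z c R p1 po p3 H.
have EC : qpow (Z.of_nat q) h p = (V, U) \/ qpow (Z.of_nat q) h p = (- V, - U).
  rewrite EB'; have [->|->] := quadratic_unit (Z.of_nat q) B' ltac:(lia) nB'.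
    by left; rewrite qmul1.
  by right; rewrite /qmul; cbn [fst snd]; congr (_, _); ring.
have HC : X * X * ((qpow (Z.of_nat q) h p).1 * (qpow (Z.of_nat q) h p).1) <=
    angle_bound q * angle_bound q * c ^^ p.
  have -> : (qpow (Z.of_nat q) h p).1 * (qpow (Z.of_nat q) h p).1 = V * V.
    by case: EC => ->; cbn [fst snd]; ring.
  apply: Z.le_trans HV _; rewrite -Ec; apply: Z.mul_le_mono_nonneg_r => //.
  by rewrite Ec; apply: Z.pow_nonneg; lia.
have gh : Z.gcd (2 * h.1) c = 1.
  rewrite -nh; apply: (root_coprime (Z.of_nat q) h p.-2 (qpow (Z.of_nat q) h p)).
    by congr qpow; lia.
  have gVU := coprime_of_norm _ _ _ _ _ _ p0 EN Ec gU.
  by case: EC => ->; cbn [fst snd]; rewrite ?Z.gcd_opp_l ?Z.gcd_opp_r.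
have q0 : 0 < Z.of_nat q by lia.
have K0 : 0 <= angle_bound q by rewrite /angle_bound; do ! case: ifP => _.
have [s [t Hst]] := angle_combination p (Z.of_nat q) y c X (2 * Z.of_nat m) (angle_bound q) g h
  p0 q0 Hy Hc X0 K0 ng nh HA HC.
have [a [b [nab dab Nab]]] := short_vector p s t pp.
have Pp : 4 <= Z.of_nat p by lia.
have Habs u v : 3 * ((u * u + v * v) * (u * u + v * v)) <= 4 * (Z.of_nat p * Z.of_nat p) ->
    Z.abs u <= Z.of_nat p.
  move: (Z.of_nat p) Pp => P P4 Hu; case: (Z_le_gt_dec (Z.abs u) P) => // Hgt; exfalso.
  have u2 : 4 * P < u * u by clear -Hgt P4; nia.
  have u3 : P * P < u * u by clear -Hgt P4; nia.
  have Hn : u * u <= u * u + v * v by clear; nia.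
  by move: (u * u) (u * u + v * v) u2 u3 Hn Hu => A N u2 u3 Hn Hu; clear -u2 u3 Hn Hu P4; nia.
have [T HT HTle] := Hst a b dab (Habs a b Nab) (Habs b a ltac:(rewrite (Z.add_comm (b * b)); exact: Nab)).
(* The check [approximation_bound] ^ 40 < q^200 meets q^200 <= X^2. *)
have HXL : approximation_bound q e ^ 20 < X.
  case: (Z_lt_ge_dec (approximation_bound q e ^ 20) X) => // /Z.ge_le HX1; exfalso.
  have HX : Z.of_nat q ^ 200 <= X * X := special_solution_size p q e x y z c R p200 H.
  have /and4P [_ _ /Z.ltb_spec0 chk3 _] := allP large_exponent_checkE _ Hpar.
  have E40 : approximation_bound q e ^ 40 = approximation_bound q e ^ 20 * approximation_bound q e ^ 20.
    by rewrite -Z.pow_add_r.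
  rewrite E40 in chk3.
  have HX2 : X * X <= approximation_bound q e ^ 20 * approximation_bound q e ^ 20.
    by apply: Z.mul_le_mono_nonneg => //; apply: Z.lt_le_incl.
  exact: (Z.lt_irrefl _ (Z.lt_le_trans _ _ _ (Z.lt_le_trans _ _ _ chk3 HX) HX2)).
(* Non-vanishing modulo c requires c > 1; for c = 1 the bound on V would give X <=
   [angle_bound q]. *)
have c1 : 1 < c.
  case: (Z_le_gt_dec c 1) => C1; last by clear -C1; lia.
  exfalso; have Ec1 : c = 1 by clear -C1 Hc; lia.
  rewrite Ec1 pow1n in Ec; rewrite Ec -/X in EN HV.
  have V1 : 1 <= V * V.
    have q2 : 2 <= Z.of_nat q by clear -q1; lia.
    move: (V * V) (U * U) (Z.square_nonneg V) (Z.square_nonneg U) EN => W W' W0 W1 EN.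
    by case: (Z.eq_dec W' 0) => W'0; [rewrite W'0 in EN; clear -EN; lia | clear -EN W0 W1 W'0 q2; nia].
  have XK : X <= angle_bound q.
    case: (Z_le_gt_dec X (angle_bound q)) => // XK; exfalso.
    have : angle_bound q * angle_bound q < X * X by apply: Z.mul_lt_mono_nonneg; clear -XK K0; lia.
    have := Z.mul_le_mono_nonneg_l _ _ _ (Z.square_nonneg X) V1.
    by clear -HV chk4; lia.
  apply: (Z.lt_irrefl X); apply: Z.le_lt_trans HXL.
  have LK : angle_bound q <= approximation_bound q e by rewrite /approximation_bound; clear -K0; lia.
  have L1 : 1 <= approximation_bound q e by clear -LK XK X0; lia.
  have := Z.pow_le_mono_r _ 1 20 (Z.lt_le_trans 0 1 _ Z.lt_0_1 L1) ltac:(done).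
  by rewrite Z.pow_1_r; apply: Z.le_trans; apply: Z.le_trans LK.
have y1 : 1 < y.
  case: (Z_le_gt_dec y 1) => Y1; last by clear -Y1; lia.
  have Ey1 : y = 1 by clear -Y1 Hy; lia.
  rewrite Ey1 pow1n /power_sum in Ey; exfalso.
  have F1 : 0 < (x * x) ^^ m by apply: pow_pos; clear -Hx; nia.
  have F2 : 0 < ((x + 1) * (x + 1)) ^^ m by apply: pow_pos; clear -Hx; nia.
  by clear -F1 F2 Ey; lia.
have [HP1 HP2] := signed_pow_nonzero 1 g y a y1 ng gy.
have [HP3 HP4] := signed_gauss_pow_nonzero g y a y1 ng gy.
have [HG1 HG2] := signed_pow_nonzero (Z.of_nat q) h c b c1 nh gh.
have Tn : T.1 <> 0 \/ T.2 <> 0.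
  apply: (eighth_turn_form_nonzero (Z.of_nat q) _ _ _ HT) => //.
  by case: nab => Hn; [left => /HP2 | right => /HG2].
have Tn' : T.1 * T.1 - Z.of_nat q * (T.2 * T.2) <> 0.
  move=> E0; have [T1 T2] : T.1 = 0 /\ T.2 = 0.
    by apply: (square_ne_prime_square q) => //; clear -E0; lia.
  by case: Tn.
set Y := y ^^ _ * c ^^ _ in HTle.
have Y0 : 0 < Y by apply: Z.mul_pos_pos; apply: pow_pos.
(* The norm of r0 + r1 sqrt q is a nonzero integer, so its absolute value is at least 1. *)
have HY : X <= approximation_bound q e * Y.
  apply: Z.le_trans HTle; move: (_ - _) Tn' => w Hw; clear -Hw X0; nia.
have L0 : 0 <= approximation_bound q e by rewrite /approximation_bound; clear -K0; lia.
set T2 := (2 * m * Z.abs_nat a + 2 * q.-1 * Z.abs_nat b)%N.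
have HYp : Y ^^ p <= X ^^ T2.
  rewrite /T2 powD (powM _ (2 * m)) (powM _ (2 * q.-1)) /Y pow_mull.
  have swap u k : (u ^^ k) ^^ p = (u ^^ p) ^^ k by rewrite -!powM mulnC.
  rewrite !(swap _ (Z.abs_nat _)).
  have Hy' : y ^^ p <= X ^^ (2 * m) by rewrite -Ey; apply: power_sum_le.
  have Hc' : c ^^ p <= X ^^ (2 * q.-1) by rewrite -Ec; apply: (power_sum_quotient_le q x R).
  have Y1 : 0 <= y ^^ p by apply: Z.pow_nonneg; clear -Hy; lia.
  have C1 : 0 <= c ^^ p by apply: Z.pow_nonneg; clear -Hc; lia.
  by apply: Z.mul_le_mono_nonneg; [apply: Z.pow_nonneg | apply: pow_le_base | apply: Z.pow_nonneg | apply: pow_le_base].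
have HT2 : (20 * T2 <= 19 * p)%N.
  have sq k : Z.abs k * Z.abs k = k * k by case: (Z.abs_spec k) => -[_ ->]; ring.
  have := exponent_inequality (Z.of_nat p) (exponent_bound q e) (Z.of_nat m) (Z.of_nat q.-1) (Z.abs a) (Z.abs b).
  rewrite !sq => HE.
  have {HE} := HE ltac:(clear -p1; lia) ltac:(clear -Hp chk2; lia) (Zle_0_nat _) (Zle_0_nat _)
    (Z.abs_nonneg _) (Z.abs_nonneg _) chk1 Nab.
  by rewrite /T2; move: (q.-1) => r; clear; lia.
have HX1 := base_bound X _ Y p T2 p0 X0 L0 (Z.lt_le_incl _ _ Y0) HY HYp HT2.
by apply: (Z.lt_irrefl X); apply: Z.le_lt_trans HXL.
Qed.

End LargeExponents.

(** * Reduction to n = 4 or an odd prime, and transfer to [int] *)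

Section Conclusion.
Local Open Scope Z_scope.

Lemma no_special_solution n q e x y z c R : n = 4%N \/ odd n /\ prime n ->
  ~ special_solution n q e x y z c R.
Proof.
case=> [->|[on pn]] H; first exact: special_solution_fourth_power H.
have H1 := special_solution_small_exponent _ _ _ _ _ _ _ _ pn on H.
by have := special_solution_large_exponent _ _ _ _ _ _ _ _ pn on H; clear -H1; lia.
Qed.

Lemma split_power_sum_absurd n d x y : n = 4%N \/ odd n /\ prime n -> d \in runge_moduli ->
  1 <= x -> 0 < y -> power_sum d x = y ^^ n -> ~ split_power_sum n d x.
Proof.
move=> Hn Hd Hx Hy Ey [[z [t [W [Hz Ht Ez EW Et]]]]|[q [e [z [c [R [Hq Hm [Hz Hc] HqS [Ez Ec EF]]]]]]]].
  case: Hn => [n4|[on pn]].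
    by rewrite n4 in Ez Et; apply: (power_sum_not_fourth_power d x z t W).
  rewrite power_sum1 in Ez.
  exact: (consecutive_squares_not_odd_power x z n Hx Hz on (prime_gt1 pn) Ez).
have oq : odd q by move: Hq; rewrite !inE => /or4P [| | |/or3P []] /eqP ->.
have ER : peval (sum_quotient q) (x * (x + 1)) = Z.of_nat q * R.
  have S0 := power_sum_gt0 1 x Hx; rewrite sum_quotientE // in EF.
  by apply: Z.mul_reg_l EF; clear -S0; lia.
have [Hpar Ed] : (q, e) \in parameters /\ d = (q ^ e)%N.
  case: Hm => [[-> ->]|[-> [-> ->]]] //; split; last by rewrite expn1.
  by move: Hq; rewrite !inE => /or4P [| | |/or3P []] /eqP ->.
rewrite Ed in Ey.
by apply: (no_special_solution n q e x y z c R Hn).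
Qed.

Lemma runge_moduli_split n d x y : (0 < n)%N -> d \in runge_moduli -> 1 <= x -> 0 < y ->
  power_sum d x = y ^^ n -> split_power_sum n d x.
Proof.
move=> n0 Hd Hx Hy; have chk : all (fun d => (d == 25%N) ||
  prime d && ((d \in [:: 5; 13; 17; 29; 37; 41]%N) || (d %% 4 == 3)%N)) runge_moduli by vm_compute.
case/orP: (allP chk d Hd) => [/eqP ->|/andP [pd cd]]; first exact: power_sum_split_25.
exact: power_sum_split_prime.
Qed.

(** A suitable divisor k built from 3, 7 and 11, or k = 1, leaves a prime or 25. *)
Lemma base_reduction m : odd m -> (3 <= m <= 49)%N ->
  exists d k, [/\ m = (d * k)%N, d \in runge_moduli & k \in [:: 1; 3; 7; 9; 11]%N].
Proof.
move=> om Hm; have chk : all (fun m => has (fun k => (k %| m)%N && (m %/ k \in runge_moduli)%N)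
  [:: 1; 3; 7; 9; 11]%N) [seq (2 * i + 3)%N | i <- iota 0 24] by vm_compute.
have Hin : m \in [seq (2 * i + 3)%N | i <- iota 0 24].
  by apply/mapP; exists (m - 3)./2; [rewrite mem_iota | ]; lia.
have /hasP [k Hk /andP [kd Hd]] := allP chk m Hin.
by exists (m %/ k)%N, k; split=> //; rewrite divnK.
Qed.

Lemma power_sum_not_power m x y n : odd m -> (3 <= m <= 49)%N -> n = 4%N \/ odd n /\ prime n ->
  1 <= x -> 0 < y -> power_sum m x <> y ^^ n.
Proof.
move=> om Hm Hn Hx Hy E; have [d [k [Em Hd Hk]]] := base_reduction m om Hm.
have n0 : (0 < n)%N by case: Hn => [->|[_ /prime_gt0]].
rewrite Em in E; have [y' Hy' E'] := power_sum_reduce d k x y n Hx Hy n0 Hk E.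
by apply: (split_power_sum_absurd n d x y') => //; apply: runge_moduli_split E'.
Qed.

Lemma prime_or_four_divisor n : (3 <= n)%N -> exists2 r, r = 4%N \/ odd r /\ prime r & (r %| n)%N.
Proof.
move=> n3; case: (boolP (4 %| n)%N) => [H4|H4]; first by exists 4%N => //; left.
have [t [t1 ot tn]] : exists t, [/\ (1 < t)%N, odd t & (t %| n)%N].
  case: (boolP (odd n)) => on; first by exists n; split=> //; apply: ltnW.
  exists n./2; split; try lia.
  by apply/dvdnP; exists 2%N; lia.
exists (pdiv t); last by apply: dvdn_trans tn; apply: pdiv_dvd.
right; split; last exact: pdiv_prime.
exact: dvdn_odd (pdiv_dvd t) ot.
Qed.

Lemma power_sum_perfect_power m x y n : odd m -> (3 <= m <= 49)%N -> (3 <= n)%N ->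
  power_sum m x = y ^^ n -> x = -1 \/ x = 0.
Proof.
move=> om Hm Hn E.
case: (Z.eq_dec x 0) => x0; [by right | case: (Z.eq_dec x (-1)) => x1; [by left | exfalso]].
have {x0 x1} [x' Hx' {}E] : exists2 x', 1 <= x' & power_sum m x' = y ^^ n.
  case: (Z_le_gt_dec 1 x) => Hx; first by exists x.
  (* The substitution x -> -1 - x exchanges the two squares. *)
  exists (-1 - x); first by lia.
  rewrite -E /power_sum Z.add_comm; congr (_ + _); congr (_ ^^ _); ring.
have [r Hr /dvdnP [j Ej]] := prime_or_four_divisor n Hn.
have F0 := power_sum_gt0 m x' Hx'.
rewrite Ej powM in E; rewrite E in F0.
(* A positive base is needed: for r = 4 the absolute value provides it, for odd r the positivity of
   the sum does. *)
case: (Hr) => [r4|[or pr]].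
  apply: (power_sum_not_power m x' (Z.abs (y ^^ j)) r om Hm Hr Hx').
    by apply/Z.abs_pos => y0; rewrite y0 r4 in F0.
  rewrite E r4 (_ : 4 = 2 * 2)%N // !powM; congr (_ ^^ 2).
  by rewrite !powS !Z.pow_0_r !Z.mul_1_r Z.abs_square.
apply: (power_sum_not_power m x' (y ^^ j) r om Hm Hr Hx') => //.
case: (Z_lt_ge_dec 0 (y ^^ j)) => // /Z.ge_le y0; exfalso.
have [i Ei] : exists i, r = (i.*2).+1 by exists r./2; lia.
move: F0; rewrite Ei powS -addnn powD; move: (y ^^ j) y0 => u u0.
by move: (u ^^ i) => v; clear -u0; nia.
Qed.

Lemma Z_of_int_exp (x : int) n : Z_of_int (GRing.exp x n) = Z_of_int x ^^ n.
Proof.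
elim: n => [|n IH]; first by rewrite GRing.expr0 Z.pow_0_r.
by rewrite GRing.exprS powS -IH; lia.
Qed.

End Conclusion.

Import Order.TTheory GRing.Theory Num.Theory.
Local Open Scope ring_scope.

Theorem theorem1p1 (k : int) (hk_mod : (k = 2 %[mod 4])%Z)
  (hk_ge : 6 <= k) (hk_le : k <= 100)
  (x y n : int) (hn : 3 <= n) (hxyn : x ^ k + (x + 1) ^ k = y ^ n) :
  x = -1 \/ x = 0.
Proof.
case: k hk_mod hk_ge hk_le hxyn => // k hk_mod hk_ge hk_le.
case: n hn => // n hn; rewrite -!exprnP => E.
have [m Ek [om Hm]] : exists2 m, k = (2 * m)%N & odd m /\ (3 <= m <= 49)%N.
  by exists k./2; lia.
have n3 : (3 <= n)%N by lia.
have EZ : power_sum m (Z_of_int x) = Z.pow (Z_of_int y) (Z.of_nat n).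
  rewrite power_sum_double -(Z_of_int_exp y) -E Ek.
  have -> : Z.add (Z_of_int x) (Zpos xH) = Z_of_int (x + 1) by lia.
  by rewrite -!Z_of_int_exp; lia.
case: (power_sum_perfect_power m (Z_of_int x) (Z_of_int y) n om Hm n3 EZ) => Hx; [left | right]; lia.
Qed.
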